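(* Let $\Sigma\subset\mathbb{R}^3$ be a generic, pure $3$-dimensional, hereditary, simplicial fan such that $\mathrm{lk}(\Sigma)$ is simply connected, equipped with uniform smoothness $1$ (i.e. $\alpha(\tau)=1$ for interior $\tau\in\Sigma_2$ and $\alpha(\tau)=-1$ for $\tau\in\Sigma_2\cap\partial\Sigma$, so $\Sigma^{-1}=\partial\Sigma$). Then for all $d\ge0$, \[\dim_{\mathbb{R}}C^1(\Sigma)_d=\chi(\mathcal{R}/\mathcal{J}[\Sigma,\partial\Sigma],d):=\sum_{i=0}^3(-1)^i\sum_{\gamma\in\Sigma_{3-i}\setminus(\partial\Sigma)_{3-i}}HF(S/J(\gamma),d);\] equivalently, $H_2(\mathcal{R}/\mathcal{J}[\Sigma,\partial\Sigma])=0$.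
   Context: $S=\mathbb{R}[x,y,z]$, $HF(M,d)=\dim_{\mathbb{R}}M_d$. A cone is the positive hull of finitely many vectors in $\mathbb{R}^3$, of dimension that of its linear span $\mathrm{aff}(\gamma)$; a fan is a finite set of cones closed under faces, any two meeting in a common face; $\Sigma_i$ = $i$-dim cones; pure $3$-dim: all facets (maximal cones) are $3$-dimensional; simplicial: each cone generated by linearly independent vectors; hereditary: for each face $\psi$ the graph on facets containing $\psi$ (edges for pairs sharing a $2$-face) is connected. $\partial\Sigma$ = subfan of faces contained in a $2$-face lying in exactly one facet. $\mathrm{lk}(\Sigma)$ is the polytopal complex of the convex hulls of the unit ray generators of the cones (topologically $\Sigma\cap\mathbb{S}^2$). ''Generic'' means: for the given combinatorial type, the ray coordinates are chosen in a suitable nonempty Zariski-open (general position) set. $l_\tau$ generates the ideal of $\mathrm{aff}(\tau)$; $J(\tau)=\langle l_\tau^2\rangle$ for interior $\tau\in\Sigma_2$; $J(\gamma)=\sum_{\tau\supseteq\gamma\text{ interior}}J(\tau)$ for non-facets, $J(\sigma)=0$ for facets. $C^1(\Sigma)$ is the graded $S$-module of tuples $(F_\sigma)_{\sigma\in\Sigma_3}$ with $l_\tau^2\mid F_{\sigma_1}-F_{\sigma_2}$ whenever $\sigma_1\cap\sigma_2=\tau\in\Sigma_2$; degree-$d$ part = tuples of forms of degree $d$. With $u_\rho$ unit ray generators, $P(\gamma)=\mathrm{conv}(\{0\}\cup\{u_\rho:\rho\subseteq\gamma\})$; $\mathcal{R}/\mathcal{J}[\Sigma,\partial\Sigma]_i=\bigoplus_{\gamma\in\Sigma_i\setminus(\partial\Sigma)_i}S/J(\gamma)$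 with differential induced by the cellular boundary of the relative cellular chain complex of $(P(\Sigma),\mathrm{lk}(\Sigma)\cup P(\partial\Sigma))$ with $S$ coefficients. *)

(* Defs.v *)
From HB Require Import structures.
From mathcomp Require Import all_boot all_order all_algebra.
From mathcomp Require Import reals.
From mathcomp Require Import mpoly.
From Stdlib Require Import ClassicalEpsilon.

Set Implicit Arguments.
Unset Strict Implicit.
Unset Printing Implicit Defensive.

Import Order.TTheory GRing.Theory Num.Theory.
Local Open Scope ring_scope.

(* A simplicial fan with n rays is given by a ray matrix V : 'M[R]_(n,3)      *)
(* (row i = generator v_i of the i-th ray) and a set F of facets, each facet  *)
(* being the set of indices of its 3 generating rays.  The cones of the fan   *)
(* are the positive hulls of the subsets of facets (the empty set gives the   *)
(* cone {0}); in particular the fan is pure and 3-dimensional by construction.*)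

Section Fan.
Variables (R : realType) (n : nat).
Implicit Types (V : 'M[R]_(n, 3)) (F : {set {set 'I_n}}) (A B g : {set 'I_n}).
Local Notation fset := {set 'I_n}.

Definition pos_hull V A : 'rV[R]_3 -> Prop := fun x =>
  exists c : 'I_n -> R, (forall i, 0 <= c i) /\ (forall i, i \notin A -> c i = 0) /\
    x = \sum_(i < n) c i *: row i V.

Definition lin_indep V A : Prop :=
  forall c : 'I_n -> R, (forall i, i \notin A -> c i = 0) ->
    \sum_(i < n) c i *: row i V = 0 -> forall i, c i = 0.

Definition is_cone F A : bool := [exists s in F, A \subset s].

Definition is_simplicial_fan3 V F : Prop :=
  (forall s : fset, s \in F -> #|s| = 3%N /\ lin_indep V s) /\
  (forall A B, is_cone F A -> is_cone F B ->
     forall x, (pos_hull V A x /\ pos_hull V B x) <-> pos_hull V (A :&: B) x).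

Definition nfacets F A : nat := #|[set s in F | A \subset s]|.

Definition bd_2face F (t : fset) : bool := is_cone F t && (#|t| == 2%N) && (nfacets F t == 1%N).
Definition int_2face F (t : fset) : bool := is_cone F t && (#|t| == 2%N) && ~~ bd_2face F t.
Definition in_boundary F g : bool := [exists t, bd_2face F t && (g \subset t)].

Definition facet_graph F (psi : {set 'I_n}) : rel {set 'I_n} :=
  fun a b => [&& a \in F, b \in F, psi \subset a, psi \subset b & #|a :&: b| == 2%N].

Definition hereditary F : Prop :=
  forall psi, is_cone F psi -> forall s1 s2, s1 \in F -> s2 \in F ->
    psi \subset s1 -> psi \subset s2 -> connect (facet_graph F psi) s1 s2.

Definition sqdist (x y : 'rV[R]_3) : R := \sum_(k < 3) (x ord0 k - y ord0 k) ^+ 2.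

Definition link_set V F : 'rV[R]_3 -> Prop := fun x =>
  \sum_(k < 3) x ord0 k ^+ 2 = 1 /\ exists2 s, s \in F & pos_hull V s x.

Definition unit_int (t : R) : Prop := 0 <= t <= 1.

Definition cont_path (f : R -> 'rV[R]_3) : Prop :=
  forall t, unit_int t -> forall e, 0 < e -> exists2 dl, 0 < dl &
    forall t', unit_int t' -> `|t - t'| < dl -> sqdist (f t) (f t') < e.

Definition cont_square (H : R -> R -> 'rV[R]_3) : Prop :=
  forall s t, unit_int s -> unit_int t -> forall e, 0 < e -> exists2 dl, 0 < dl &
    forall s' t', unit_int s' -> unit_int t' -> `|s - s'| < dl -> `|t - t'| < dl ->
      sqdist (H s t) (H s' t') < e.

Definition path_in (X : 'rV[R]_3 -> Prop) (f : R -> 'rV[R]_3) : Prop :=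
  cont_path f /\ forall t, unit_int t -> X (f t).

Definition simply_connected (X : 'rV[R]_3 -> Prop) : Prop :=
  (exists x, X x) /\
  (forall x y, X x -> X y -> exists f, path_in X f /\ f 0 = x /\ f 1 = y) /\
  (forall f, path_in X f -> f 0 = f 1 ->
     exists H : R -> R -> 'rV[R]_3,
       cont_square H /\ (forall s t, unit_int s -> unit_int t -> X (H s t)) /\
       (forall t, unit_int t -> H 0 t = f t /\ H 1 t = f 0) /\
       (forall s, unit_int s -> H s 0 = f 0 /\ H s 1 = f 0)).

Definition has_qdim (M : lmodType R) (P Q : M -> Prop) (k : nat) : Prop :=
  (forall x y a, P x -> P y -> P (a *: x + y)) /\ P 0 /\
  (forall x y a, Q x -> Q y -> Q (a *: x + y)) /\ Q 0 /\
  (forall x, Q x -> P x) /\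
  exists B : 'I_k -> M, (forall i, P (B i)) /\
    (forall c : 'I_k -> R, Q (\sum_(i < k) c i *: B i) -> forall i, c i = 0) /\
    (forall x, P x -> exists c : 'I_k -> R, Q (x - \sum_(i < k) c i *: B i)).

(* the dimension of P/Q (well-defined when it exists) *)
Definition qdim (M : lmodType R) (P Q : M -> Prop) : nat :=
  epsilon (inhabits 0%N) (has_qdim P Q).

Definition sp_dim (M : lmodType R) (P : M -> Prop) : nat :=
  qdim P (fun x => x = 0).

Definition Sd (d : nat) : {mpoly R[3]} -> Prop := fun p => p \is d.-homog.

(* l_tau: the linear form det[v_a; v_b; (x,y,z)] vanishing on aff(tau),    *)
(* where tau = {a, b}; it generates the ideal of the plane aff(tau).      *)
Definition lform V (t : fset) : {mpoly R[3]} :=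
  match enum t with
  | [:: a; b] =>
      \det (\matrix_(r < 3, k < 3)
              (if r == 0 :> nat then (V a k)%:MP
               else if r == 1%N :> nat then (V b k)%:MP else 'X_k) : 'M[{mpoly R[3]}]_3)
  | _ => 0
  end.

Definition in_J V F g (p : {mpoly R[3]}) : Prop :=
  exists h : {set 'I_n} -> {mpoly R[3]},
    p = \sum_(t | int_2face F t && (g \subset t)) (lform V t) ^+ 2 * h t.

Definition HF_quot V F g (d : nat) : nat :=
  qdim (Sd d) (fun p => Sd d p /\ in_J V F g p).

Definition spline_d V F (d : nat) : {ffun {set 'I_n} -> {mpoly R[3]}} -> Prop :=
  fun G =>
    (forall s, s \notin F -> G s = 0) /\
    (forall s, s \in F -> G s \is d.-homog) /\
    (forall s1 s2, s1 \in F -> s2 \in F -> #|s1 :&: s2| = 2%N ->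
       exists h : {mpoly R[3]}, G s1 - G s2 = (lform V (s1 :&: s2)) ^+ 2 * h).

Definition chi_RJ V F (d : nat) : int :=
  \sum_(i < 4) (-1) ^+ i *
    \sum_(g | is_cone F g && (#|g| == (3 - i)%N) && ~~ in_boundary F g)
       (HF_quot V F g d)%:Z.

Definition eval_coords (p : {mpoly R[n * 3]}) V : R := p.@[fun k => mxvec V 0 k].

End Fan.

(* Main.v *)
(** The graded pieces of [C^1] and of the modules [S/J(gamma)] fit in a complex
    [0 -> C^1 -> (+) S -> (+) S/J(tau) -> (+) S/J(rho) -> S/J(0) -> 0],
    whose last term is present only for complete fans; its exactness gives the formula.

    Exactness at the edges splits in two.  Edge data that is a cocycle around every interior ray
    has local potentials on the stars of the rays; these glue because the link is simply connected.
    It remains to correct edge data by multiples of the squared edge forms.  In degree two this is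
    dual to the rigidity of the [C^1_2]-cofactor matroid: the link, closed up by coning its boundary,
    is a minimal mod-2 two-cycle, and Fogelsanger's induction (contract an edge, decompose into minimal
    cycles, undo the contraction by vertex splitting) shows that its edge graph is generically
    rigid.  Higher degrees follow because the ideals are generated in degree two, the linear
    syzygies needed for complete fans being supplied by four rays in general position. *)

Require Import Defs.
From HB Require Import structures.
From mathcomp Require Import all_boot all_order all_algebra.
From mathcomp Require Import reals.
From mathcomp Require Import mpoly.
From mathcomp Require Import ring lra zify.
From Stdlib Require Import ClassicalEpsilon.

Set Implicit Arguments.
Unset Strict Implicit.
Unset Printing Implicit Defensive.
Import Order.TTheory GRing.Theory Num.Theory.
Local Open Scope ring_scope.

(** * Linear duality and polynomial genericity *)

(** Why degree two is a rigidity question: in the chart $z=1$, the degree-two part of the ideal at a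
    ray lies in the binary quadratic forms in the linear forms vanishing on that ray, and an
    interior edge contributes the same square at its two ends with opposite signs. A functional that
    kills all edge contributions is a family of quadratic forms on directions, one per ray, whose
    values along each edge agree at its ends. Functionals on ternary quadratic forms always give
    such families; rigidity says that there are no others. With a boundary, the family extends by
    zero to the coning point, and a trivial solution that vanishes at the three points of a coned
    edge is zero, so no condition remains. On a complete fan the total over all rays must vanish, a
    condition present in every degree, and this is what forces the study of linear syzygies.

    The exceptional polynomial must be fixed before the rays. It is built from minors; it is nonzero
    because one rigid placement exists in the chart, and clearing denominators carries it to ray
    coordinates. *)

Lemma linear_duality (R : fieldType) (I J : finType) (A : I -> J -> R) (g : J -> R) :
  (forall c : J -> R, (forall i, \sum_j A i j * c j = 0) -> \sum_j g j * c j = 0) ->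
  exists f : I -> R, forall j, g j = \sum_i f i * A i j.
Proof.
move=> H.
pose M : 'M[R]_(#|I|, #|J|) := \matrix_(i, j) A (enum_val i) (enum_val j).
pose u : 'rV[R]_#|J| := \row_j g (enum_val j).
have : (u <= M)%MS.
  rewrite submxE; apply/eqP/matrixP => i0 k; rewrite !mxE.
  under eq_bigr => j _ do rewrite mxE.
  pose c j := cokermx M (enum_rank j) k.
  rewrite (reindex_onto enum_rank enum_val) /=; last by move=> j _; rewrite enum_valK.
  under eq_bigl => j do rewrite enum_rankK eqxx.
  under eq_bigr => j _ do rewrite enum_rankK.
  apply: (H c) => i.
  have /matrixP/(_ (enum_rank i) k) := mulmx_coker M.
  rewrite !mxE => E; rewrite -[RHS]E.
  rewrite [RHS](reindex_onto enum_rank enum_val) /=; last by move=> j _; rewrite enum_valK.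
  by apply: eq_big => [j|j _]; [rewrite enum_rankK eqxx | rewrite [in RHS]mxE !enum_rankK].
case/submxP => D /matrixP HD; exists (fun i => D 0 (enum_rank i)) => j.
have := HD 0 (enum_rank j); rewrite !mxE enum_rankK => ->.
rewrite (reindex_onto enum_rank enum_val) /=; last by move=> i _; rewrite enum_valK.
by apply: eq_big => [i|i _]; [rewrite enum_rankK eqxx | rewrite [in LHS]mxE !enum_rankK].
Qed.

(** With [minor_rank] below, this turns a lower bound on a rank into the nonvanishing of a
    determinant, hence into a polynomial condition on the entries. *)
Lemma rank_minor (R : fieldType) m n (A : 'M[R]_(m, n)) :
  exists (f : 'I_(\rank A) -> 'I_m) (g : 'I_(\rank A) -> 'I_n), \det (mxsub f g A) != 0.
Proof.
have free1 := maxrowsub_free A; set f := maxrankfun A in free1.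
set B := rowsub f A in free1.
have full : row_full B^T by rewrite /row_full mxrank_tr.
pose g := fullrankfun full.
exists f, g.
have := fullrowsub_unit full.
have -> : rowsub (fullrankfun full) B^T = (mxsub f g A)^T.
  by apply/matrixP => i j; rewrite !mxE.
by rewrite unitmx_tr unitmxE unitfE.
Qed.

Lemma minor_rank (R : fieldType) m n r (A : 'M[R]_(m, n))
    (f : 'I_r -> 'I_m) (g : 'I_r -> 'I_n) :
  \det (mxsub f g A) != 0 -> (r <= \rank A)%N.
Proof.
rewrite -unitfE -unitmxE => U.
have <- : \rank (mxsub f g A) = r by apply/eqP; rewrite -/(row_free _) row_free_unit.
have -> : mxsub f g A = rowsub f (colsub g A) by apply/matrixP => i j; rewrite !mxE.
apply: leq_trans (mxrankS (rowsub_sub _ _)) _.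
rewrite -mxrank_tr -[X in (_ <= X)%N]mxrank_tr.
have -> : (colsub g A)^T = rowsub g A^T by apply/matrixP => i j; rewrite !mxE.
exact: mxrankS (rowsub_sub _ _).
Qed.

Section PolyFun.
Variables (R : realFieldType) (X : Type) (C : (X -> R) -> Prop).

(** Polynomial functions on an arbitrary type with distinguished coordinates [C]. The same closure
    lemmas then serve planar placements, ray matrices and the parameter of a line; [PolyExt]
    replaces functional extensionality. *)
Inductive polyfun : (X -> R) -> Prop :=
| PolyCoord f : C f -> polyfun f
| PolyCst c : polyfun (fun _ => c)
| PolyAdd f g : polyfun f -> polyfun g -> polyfun (fun x => f x + g x)
| PolyMul f g : polyfun f -> polyfun g -> polyfun (fun x => f x * g x)
| PolyExt f g : f =1 g -> polyfun f -> polyfun g.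

Lemma polyfun_opp f : polyfun f -> polyfun (fun x => - f x).
Proof.
by move=> pf; apply: PolyExt (PolyMul (PolyCst (-1)) pf) => x; rewrite mulN1r.
Qed.

Lemma polyfun_sub f g : polyfun f -> polyfun g -> polyfun (fun x => f x - g x).
Proof. by move=> pf pg; apply: PolyAdd pf (polyfun_opp pg). Qed.

Lemma polyfun_sum (I : Type) (r : seq I) (P : pred I) (f : I -> X -> R) :
  (forall i, P i -> polyfun (f i)) -> polyfun (fun x => \sum_(i <- r | P i) f i x).
Proof.
move=> pf; elim: r => [|i r IH].
  by apply: PolyExt (PolyCst 0) => x; rewrite big_nil.
have [Pi|Pi] := boolP (P i); last by apply: PolyExt IH => x; rewrite big_cons (negPf Pi).
by apply: PolyExt (PolyAdd (pf _ Pi) IH) => x; rewrite big_cons Pi.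
Qed.

Lemma polyfun_prod (I : Type) (r : seq I) (P : pred I) (f : I -> X -> R) :
  (forall i, P i -> polyfun (f i)) -> polyfun (fun x => \prod_(i <- r | P i) f i x).
Proof.
move=> pf; elim: r => [|i r IH].
  by apply: PolyExt (PolyCst 1) => x; rewrite big_nil.
have [Pi|Pi] := boolP (P i); last by apply: PolyExt IH => x; rewrite big_cons (negPf Pi).
by apply: PolyExt (PolyMul (pf _ Pi) IH) => x; rewrite big_cons Pi.
Qed.

Lemma polyfun_det m (f : X -> 'M[R]_m) :
  (forall i j, polyfun (fun x => f x i j)) -> polyfun (fun x => \det (f x)).
Proof.
move=> pf; apply: polyfun_sum => s _; apply: PolyMul; first exact: PolyCst.
by apply: polyfun_prod => i _.
Qed.

(* The kernel of a polynomial matrix has minimal dimension, and the span of a polynomial family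
   has maximal dimension, outside the zero set of suitable minors. *)
Lemma open_kernel (I J K : finType) (M : X -> I -> J -> R) (T : X -> K -> I -> R) (x0 : X) :
  (forall i j, polyfun (fun x => M x i j)) ->
  (forall k i, polyfun (fun x => T x k i)) ->
  (forall x k j, \sum_i T x k i * M x i j = 0) ->
  (forall q : I -> R, (forall j, \sum_i q i * M x0 i j = 0) ->
     exists c : K -> R, forall i, q i = \sum_k c k * T x0 k i) ->
  exists2 f, polyfun f & f x0 != 0 /\
    forall x, f x != 0 -> forall q : I -> R, (forall j, \sum_i q i * M x i j = 0) ->
     exists c : K -> R, forall i, q i = \sum_k c k * T x k i.
Proof.
move=> pM pT TM ker0.
pose mM x : 'M[R]_(#|I|, #|J|) := \matrix_(i, j) M x (enum_val i) (enum_val j).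
pose mT x : 'M[R]_(#|K|, #|I|) := \matrix_(k, i) T x (enum_val k) (enum_val i).
have sumE (U : finType) (F : U -> R) : \sum_(u < #|U|) F (enum_val u) = \sum_u F u.
  by rewrite [RHS](reindex_onto enum_val enum_rank) /=; [apply: eq_bigl => u; rewrite enum_valK eqxx|move=> u _; rewrite enum_rankK].
have TM0 x : mT x *m mM x = 0.
  apply/matrixP => k j; rewrite !mxE -[RHS](TM x (enum_val k) (enum_val j)) -[RHS]sumE.
  by apply: eq_bigr => i _; rewrite !mxE.
have spanP x : (kermx (mM x) <= mT x)%MS <->
  (forall q : I -> R, (forall j, \sum_i q i * M x i j = 0) ->
     exists c : K -> R, forall i, q i = \sum_k c k * T x k i).
  split=> [sub q qM|H].
    have : ((\row_i q (enum_val i) : 'rV_#|I|) <= mT x)%MS.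
      apply: submx_trans sub; apply/sub_kermxP/matrixP => i j; rewrite !mxE.
      rewrite -[RHS](qM (enum_val j)) -[RHS]sumE.
      by apply: eq_bigr => l _; rewrite !mxE.
    case/submxP => D /matrixP HD; exists (fun k => D 0 (enum_rank k)) => i.
    have := HD 0 (enum_rank i); rewrite !mxE enum_rankK => ->.
    by rewrite -[RHS]sumE; apply: eq_bigr => k _; rewrite !mxE enum_valK enum_rankK.
  apply/row_subP => r; set v := row r _.
  have vM : v *m mM x = 0 by apply/sub_kermxP; exact: row_sub.
  have [j|c Hc] := H (fun i => v 0 (enum_rank i)).
    have /matrixP/(_ 0 (enum_rank j)) := vM; rewrite mxE [in RHS]mxE => E; rewrite -[RHS]E -[LHS]sumE.
    by apply: eq_bigr => i _; rewrite [mM x _ _]mxE enum_valK enum_rankK.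
  apply/submxP; exists (\row_k c (enum_val k)); apply/matrixP => z i; rewrite ord1.
  have := Hc (enum_val i); rewrite enum_valK => ->; rewrite !mxE -[LHS]sumE.
  by apply: eq_bigr => k _; rewrite !mxE.
have sub0 : (kermx (mM x0) <= mT x0)%MS by apply/spanP.
have [f1 [g1 d1]] := rank_minor (mM x0).
have [f2 [g2 d2]] := rank_minor (mT x0).
exists (fun x => \det (mxsub f1 g1 (mM x)) * \det (mxsub f2 g2 (mT x))).
  apply: PolyMul; apply: polyfun_det => i j.
    by apply: PolyExt (pM (enum_val (f1 i)) (enum_val (g1 j))) => x; rewrite !mxE.
  by apply: PolyExt (pT (enum_val (f2 i)) (enum_val (g2 j))) => x; rewrite !mxE.
split; first by rewrite mulf_neq0.
move=> x; rewrite mulf_eq0 negb_or => /andP[/minor_rank r1 /minor_rank r2].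
apply/spanP.
(* The two minors say that the rank of [mM] and the rank of [mT] have not dropped between [x0] and
   [x], so the kernel has not grown and the span has not shrunk. As the span always lies in the
   kernel, equality at [x0] persists. *)
have subT : (mT x <= kermx (mM x))%MS by apply/sub_kermxP; exact: TM0.
rewrite -(geq_leqif (mxrank_leqif_sup subT)) mxrank_ker.
apply: leq_trans r2; apply: leq_trans (mxrankS sub0); rewrite mxrank_ker.
exact: leq_sub2l.
Qed.

End PolyFun.

Lemma polyfun_comp (R : realFieldType) (X Y : Type) (C : (X -> R) -> Prop) (D : (Y -> R) -> Prop)
    (h : Y -> X) (f : X -> R) :
  (forall g, C g -> polyfun D (fun y => g (h y))) -> polyfun C f -> polyfun D (fun y => f (h y)).
Proof.
move=> hC; elim=> {f}.
- by move=> f /hC.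
- by move=> c; exact: PolyCst.
- by move=> f g _ IHf _ IHg; exact: PolyAdd.
- by move=> f g _ IHf _ IHg; exact: PolyMul.
- by move=> f g fg _ IH; apply: PolyExt IH => y; exact: fg.
Qed.

Lemma polyfun_horner (R : realFieldType) (f : R -> R) :
  polyfun (fun g => g = id) f -> exists p : {poly R}, forall t, f t = p.[t].
Proof.
elim=> {f}.
- by move=> f ->; exists 'X => t; rewrite hornerX.
- by move=> c; exists c%:P => t; rewrite hornerC.
- by move=> f g _ [p Hp] _ [q Hq]; exists (p + q) => t; rewrite hornerD Hp Hq.
- by move=> f g _ [p Hp] _ [q Hq]; exists (p * q) => t; rewrite hornerM Hp Hq.
- by move=> f g fg _ [p Hp]; exists p => t; rewrite -fg.
Qed.

(** The point is also nonzero because it serves as the displacement of a split vertex, which must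
    really leave its origin. *)
Lemma poly_nonroot (R : realFieldType) (p : {poly R}) : p != 0 -> exists2 t, t != 0 & p.[t] != 0.
Proof.
move=> p0; pose s := [seq i.+1%:R : R | i <- iota 0 (size p)].
have us : uniq s by rewrite map_inj_uniq ?iota_uniq // => i j /eqP; rewrite eqr_nat eqSS => /eqP.
have /allPn[t ts pt] : ~~ all (root p) s.
  by apply/negP => al; have := max_poly_roots p0 al us; rewrite size_map size_iota ltnn.
exists t => //; case/mapP: ts => i _ ->; by rewrite pnatr_eq0.
Qed.

(** * Planar cofactor rigidity *)

Section Rigidity.
Variable R : realFieldType.

Definition binq : Type := (R * R * R)%type.

Definition bev (q : binq) (d : R * R) : R :=
  q.1.1 * d.1 ^+ 2 + q.1.2 * d.1 * d.2 + q.2 * d.2 ^+ 2.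

Definition tcoef : Type := (R * R * R * (R * R * R))%type.

(* A ternary quadratic form restricted to the linear forms [l] vanishing at [(x, y, 1)]; such an
   [l] is written [(- dy, dx, dy * x - dx * y)] with [d = (dx, dy)]. *)
Definition triv (c : tcoef) (z : R * R) : binq :=
  let: (c1, c2, c3, (c4, c5, c6)) := c in
  (c1 - c5 * z.2 + c6 * z.2 ^+ 2,
   c2 - c4 * z.2 + c5 * z.1 - 2 * c6 * z.1 * z.2,
   c3 + c4 * z.1 + c6 * z.1 ^+ 2).

(** A line through [z] with direction [d] also passes through every [z + e d], and [triv c] only
    depends on the line. Hence trivial solutions satisfy the edge conditions of every framework. *)
Lemma triv_bev c z (e : R) (d : R * R) :
  bev (triv c z) d = bev (triv c (z.1 + e * d.1, z.2 + e * d.2)) d.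
Proof. case: c => [[[c1 c2] c3] [[c4 c5] c6]]; rewrite /bev /triv /=; ring. Qed.

(** [c] is a quadratic form on the dual plane, and [triv c z] its restriction to the pencil of lines
    through [z]. A form vanishing on two pencils is [c6] times the product of their equations, which
    is what [pair] computes; a third distinct pencil then forces zero. The three points may be
    collinear. *)
Lemma triv_eq0 c z1 z2 z3 : z1 != z2 -> z1 != z3 -> z2 != z3 ->
  triv c z1 = 0 -> triv c z2 = 0 -> triv c z3 = 0 -> c = (0, 0, 0, (0, 0, 0)).
Proof.
case: c => [[[c1 c2] c3] [[c4 c5] c6]].
case: z1 z2 z3 => [x1 y1] [x2 y2] [x3 y3]; rewrite /triv /=.
move=> n12 n13 n23 [A1 B1 C1] [A2 B2 C2] [A3 B3 C3].
have pair x y x' y' : (x, y) != (x', y') ->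
    c1 - c5 * y + c6 * y ^+ 2 = 0 -> c2 - c4 * y + c5 * x - 2 * c6 * x * y = 0 ->
    c3 + c4 * x + c6 * x ^+ 2 = 0 ->
    c1 - c5 * y' + c6 * y' ^+ 2 = 0 -> c2 - c4 * y' + c5 * x' - 2 * c6 * x' * y' = 0 ->
    c3 + c4 * x' + c6 * x' ^+ 2 = 0 ->
    c5 = c6 * (y + y') /\ c4 = - c6 * (x + x').
  move=> ne A B C A' B' C'.
  have e1 : (y - y') * (c5 - c6 * (y + y')) = 0 by move: A A'; lra.
  have e2 : (x - x') * (c4 + c6 * (x + x')) = 0 by move: C C'; lra.
  have e3 : (x - x') ^+ 2 * (c5 - c6 * (y + y')) = 0.
    by transitivity ((x - x') * ((c2 - c4 * y + c5 * x - 2 * c6 * x * y) - (c2 - c4 * y' + c5 * x' - 2 * c6 * x' * y'))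
       + (y - y') * ((c3 + c4 * x + c6 * x ^+ 2) - (c3 + c4 * x' + c6 * x' ^+ 2))); [ring|rewrite B B' C C'; ring].
  have e4 : (y - y') ^+ 2 * (c4 + c6 * (x + x')) = 0.
    by transitivity (- (y - y') * ((c2 - c4 * y + c5 * x - 2 * c6 * x * y) - (c2 - c4 * y' + c5 * x' - 2 * c6 * x' * y'))
       - (x - x') * ((c1 - c5 * y + c6 * y ^+ 2) - (c1 - c5 * y' + c6 * y' ^+ 2))); [ring|rewrite B B' A A'; ring].
  have [dx|dx] := eqVneq x x'.
    have dy : y - y' != 0 by rewrite subr_eq0; apply: contraNneq ne => dy; rewrite dx dy.
    split; first by move/eqP: e1; rewrite mulf_eq0 (negPf dy) /= subr_eq0 => /eqP.
    by move/eqP: e4; rewrite mulf_eq0 expf_eq0 (negPf dy) /= addr_eq0 mulNr => /eqP.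
  have dx' : x - x' != 0 by rewrite subr_eq0.
  split; first by move/eqP: e3; rewrite mulf_eq0 expf_eq0 (negPf dx') /= subr_eq0 => /eqP.
  by move/eqP: e2; rewrite mulf_eq0 (negPf dx') /= addr_eq0 mulNr => /eqP.
have [a12 b12] := pair _ _ _ _ n12 A1 B1 C1 A2 B2 C2.
have [a13 b13] := pair _ _ _ _ n13 A1 B1 C1 A3 B3 C3.
have c60 : c6 = 0.
  apply/eqP; apply: contraNT n23 => c60; apply/eqP; congr (_, _).
    by apply/eqP; rewrite -(inj_eq (addrI x1)) -(inj_eq (mulfI (_ : - c6 != 0))) ?oppr_eq0 // -b12 -b13.
  by apply/eqP; rewrite -(inj_eq (addrI y1)) -(inj_eq (mulfI c60)) -a12 -a13.
have c50 : c5 = 0 by rewrite a12 c60 mul0r.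
have c40 : c4 = 0 by rewrite b12 c60 oppr0 mul0r.
move: A1 B1 C1; rewrite c60 c50 c40 !(mul0r, mulr0, addr0, subr0) => -> -> ->.
by [].
Qed.

Lemma binq_eq0 (q : binq) (d e : R * R) : d.1 * e.2 - d.2 * e.1 != 0 ->
  bev q d = 0 -> bev q e = 0 -> bev q (d.1 + e.1, d.2 + e.2) = 0 -> q = 0.
Proof.
case: q d e => [[A B] C] [d1 d2] [e1 e2]; rewrite /bev /= => D h1 h2 h3.
set De := d1 * e2 - d2 * e1 in D.
(* Polarization: the value at [d + e] minus the values at [d] and [e]. The coefficients are then
   recovered by inverting the change of basis to [d], [e]. *)
have h4 : 2 * A * d1 * e1 + B * (d1 * e2 + d2 * e1) + 2 * C * d2 * e2 = 0 by lra.
have hA : De ^+ 2 * A = 0.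
  transitivity (e2 ^+ 2 * (A * d1 ^+ 2 + B * d1 * d2 + C * d2 ^+ 2)
     + d2 ^+ 2 * (A * e1 ^+ 2 + B * e1 * e2 + C * e2 ^+ 2)
     - e2 * d2 * (2 * A * d1 * e1 + B * (d1 * e2 + d2 * e1) + 2 * C * d2 * e2)).
    rewrite /De; ring.
  by rewrite h1 h2 h4; ring.
have hC : De ^+ 2 * C = 0.
  transitivity (e1 ^+ 2 * (A * d1 ^+ 2 + B * d1 * d2 + C * d2 ^+ 2)
     + d1 ^+ 2 * (A * e1 ^+ 2 + B * e1 * e2 + C * e2 ^+ 2)
     - e1 * d1 * (2 * A * d1 * e1 + B * (d1 * e2 + d2 * e1) + 2 * C * d2 * e2)).
    rewrite /De; ring.
  by rewrite h1 h2 h4; ring.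
have D2 : De ^+ 2 != 0 by rewrite expf_eq0 (negPf D).
move/eqP: hA; rewrite mulf_eq0 (negPf D2) => /eqP A0.
move/eqP: hC; rewrite mulf_eq0 (negPf D2) => /eqP C0.
suff : De ^+ 2 * B = 0 by move/eqP; rewrite mulf_eq0 (negPf D2) => /eqP ->; rewrite A0 C0.
transitivity (- 2 * e1 * e2 * (A * d1 ^+ 2 + B * d1 * d2 + C * d2 ^+ 2)
     - 2 * d1 * d2 * (A * e1 ^+ 2 + B * e1 * e2 + C * e2 ^+ 2)
     + (d1 * e2 + d2 * e1) * (2 * A * d1 * e1 + B * (d1 * e2 + d2 * e1) + 2 * C * d2 * e2)).
  rewrite A0 C0 /De; ring.
by rewrite h1 h2 h4; ring.
Qed.

Section Frameworks.
Variable T : finType.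
Implicit Types (E : rel T) (U : {set T}) (p : T -> R * R) (q : T -> binq).

(** The directions are kept apart from the placement so that the notion still makes sense in a limit
    where two adjacent vertices coincide and their edge has no direction of its own. *)
Definition rigid_along E U p (dir : T -> T -> R * R) : Prop :=
  forall q, (forall a b, E a b -> bev (q a) (dir a b) = bev (q b) (dir a b)) ->
  exists c, forall a, a \in U -> q a = triv c (p a).

Definition pdir p a b : R * R := ((p b).1 - (p a).1, (p b).2 - (p a).2).

Definition rigid E U p := rigid_along E U p (pdir p).

Definition pcoord (f : (T -> R * R) -> R) : Prop :=
  exists a, f = (fun p => (p a).1) \/ f = (fun p => (p a).2).

Definition generic (P : (T -> R * R) -> Prop) : Prop :=
  exists2 f, polyfun pcoord f & (exists p, f p != 0) /\ forall p, f p != 0 -> P p.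

(** Restrict both polynomials to the line joining their points of nonvanishing: each becomes a
    nonzero polynomial in one variable, and so does their product, which therefore has a nonroot. *)
Lemma generic_and P Q : generic P -> generic Q -> generic (fun p => P p /\ Q p).
Proof.
move=> [f pf [[p0 fp0] fP]] [g pg [[p1 gp1] gQ]].
exists (fun p => f p * g p); first exact: PolyMul.
split; last by move=> p; rewrite mulf_eq0 negb_or => /andP[/fP ? /gQ ?].
pose h (t : R) a := ((p0 a).1 + t * ((p1 a).1 - (p0 a).1), (p0 a).2 + t * ((p1 a).2 - (p0 a).2)).
have hC e : pcoord e -> polyfun (fun k : R -> R => k = id) (fun t => e (h t)).
  case=> a [] ->; rewrite /h /=; apply: PolyAdd; try exact: PolyCst;
  by apply: PolyMul; [apply: PolyCoord | exact: PolyCst].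
have [F HF] := polyfun_horner (polyfun_comp hC pf).
have [G HG] := polyfun_horner (polyfun_comp hC pg).
have h0 e : polyfun pcoord e -> e (h 0) = e p0.
  elim=> //= {e}; first by move=> e [a [] ->]; rewrite /h /= mul0r addr0.
  - by move=> e1 e2 _ -> _ ->.
  - by move=> e1 e2 _ -> _ ->.
  - by move=> e1 e2 eq _; rewrite !eq.
have h1 e : polyfun pcoord e -> e (h 1) = e p1.
  elim=> //= {e}; first by move=> e [a [] ->]; rewrite /h /= mul1r addrC subrK.
  - by move=> e1 e2 _ -> _ ->.
  - by move=> e1 e2 _ -> _ ->.
  - by move=> e1 e2 eq _; rewrite !eq.
have F0 : F != 0 by apply: contraNneq fp0 => F0; rewrite -h0 // HF F0 horner0.
have G0 : G != 0 by apply: contraNneq gp1 => G0; rewrite -h1 // HG G0 horner0.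
have [t _ FGt] := poly_nonroot (mulf_neq0 F0 G0).
by exists (h t); rewrite HF HG -hornerM.
Qed.

Lemma generic_weaken (P Q : (T -> R * R) -> Prop) :
  (forall p, P p -> Q p) -> generic P -> generic Q.
Proof. by move=> PQ [f pf [nz fP]]; exists f => //; split=> // p /fP /PQ. Qed.

Lemma genericT : generic (fun _ => True).
Proof.
by exists (fun _ => 1); [exact: PolyCst|split=> //; exists (fun=> (0, 0)); rewrite oner_eq0].
Qed.

Lemma generic_forall (I : eqType) (s : seq I) (P : I -> (T -> R * R) -> Prop) :
  (forall i, i \in s -> generic (P i)) -> generic (fun p => forall i, i \in s -> P i p).
Proof.
elim: s => [|i s IH] H; first by apply: generic_weaken genericT.
have gi := H i (mem_head _ _).
have gs : generic (fun p => forall i, i \in s -> P i p).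
  by apply: IH => j js; apply: H; rewrite inE js orbT.
apply: generic_weaken (generic_and gi gs) => p [Pi Ps] j.
by rewrite inE => /orP[/eqP ->|/Ps].
Qed.

Lemma polyfun_pcoord1 a : polyfun pcoord (fun p => (p a).1).
Proof. by apply: PolyCoord; exists a; left. Qed.

Lemma polyfun_pcoord2 a : polyfun pcoord (fun p => (p a).2).
Proof. by apply: PolyCoord; exists a; right. Qed.

Lemma generic_neq a b : a != b -> generic (fun p => p a != p b).
Proof.
move=> ab; exists (fun p => (p a).1 - (p b).1).
  by apply: polyfun_sub; exact: polyfun_pcoord1.
split; last by move=> p; apply: contraNneq => ->; rewrite subrr.
by exists (fun c => if c == a then (1, 0) else (0, 0)); rewrite eqxx [b == a]eq_sym (negPf ab) subr0 oner_eq0.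
Qed.

Definition area p a b c : R :=
  (pdir p a b).1 * (pdir p a c).2 - (pdir p a b).2 * (pdir p a c).1.

Lemma generic_area a b c : a != b -> a != c -> b != c -> generic (fun p => area p a b c != 0).
Proof.
move=> ab ac bc; exists (fun p => area p a b c).
  by apply: polyfun_sub; apply: PolyMul; apply: polyfun_sub; first
    [exact: polyfun_pcoord1|exact: polyfun_pcoord2].
split=> //; exists (fun d => if d == b then (1, 0) else if d == c then (0, 1) else (0, 0)).
rewrite /area /pdir /= !eqxx (negPf ab) (negPf ac) (eq_sym c) (negPf bc) /=.
by rewrite !subr0 mulr1 mul0r subr0 oner_eq0.
Qed.

(* Vertices outside [U] are unconstrained, so their indicator functions join the trivial
   solutions in the spanning family of the kernel. *)
Lemma rigid_along_open (X : Type) (C : (X -> R) -> Prop) E U (pt : X -> T -> R * R)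
    (dir : X -> T -> T -> R * R) (x0 : X) :
  (forall a b, E a b -> (a \in U) && (b \in U)) ->
  (forall a, polyfun C (fun x => (pt x a).1)) ->
  (forall a, polyfun C (fun x => (pt x a).2)) ->
  (forall a b, E a b -> polyfun C (fun x => (dir x a b).1)) ->
  (forall a b, E a b -> polyfun C (fun x => (dir x a b).2)) ->
  (forall x c a b, E a b -> bev (triv c (pt x a)) (dir x a b) = bev (triv c (pt x b)) (dir x a b)) ->
  rigid_along E U (pt x0) (dir x0) ->
  exists2 f, polyfun C f & f x0 != 0 /\ forall x, f x != 0 -> rigid_along E U (pt x) (dir x).
Proof.
move=> EU p1 p2 d1 d2 trivE rig0.
pose I := (T + T + T)%type.
pose vert (i : I) : T := match i with inl (inl a) => a | inl (inr a) => a | inr a => a end.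
pose mono (i : I) (d : R * R) : R :=
  match i with inl (inl _) => d.1 ^+ 2 | inl (inr _) => d.1 * d.2 | inr _ => d.2 ^+ 2 end.
pose M x (i : I) (e : T * T) : R :=
  if E e.1 e.2 then ((vert i == e.1)%:R - (vert i == e.2)%:R) * mono i (dir x e.1 e.2) else 0.
pose qI (q : T -> binq) (i : I) : R :=
  match i with inl (inl a) => (q a).1.1 | inl (inr a) => (q a).1.2 | inr a => (q a).2 end.
pose Iq (f : I -> R) (a : T) : binq := (f (inl (inl a)), f (inl (inr a)), f (inr a)).
have sumM x q e : \sum_i qI q i * M x i e =
    if E e.1 e.2 then bev (q e.1) (dir x e.1 e.2) - bev (q e.2) (dir x e.1 e.2) else 0.
  rewrite /M; case: ifP => _; last by rewrite big1 // => i _; rewrite mulr0.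
  rewrite /I !big_sumType /=.
  have S (F : T -> R) m : \sum_a F a * (((a == e.1)%:R - (a == e.2)%:R) * m) = (F e.1 - F e.2) * m.
    rewrite (eq_bigr (fun a => (F a * (a == e.1)%:R - F a * (a == e.2)%:R) * m)); last by move=> a _; ring.
    rewrite -mulr_suml; congr (_ * _); rewrite sumrB.
    have D (b : T) : \sum_a F a * (a == b)%:R = F b.
      by rewrite (bigD1 b) //= eqxx mulr1 big1 ?addr0 // => a /negPf ->; rewrite mulr0.
    by rewrite !D.
  by rewrite !S /bev; ring.
pose K := ('I_6 + I)%type.
pose tc (k : 'I_6) : tcoef := let d i := (k == i :> nat)%:R in (d 0%N, d 1%N, d 2%N, (d 3%N, d 4%N, d 5%N)).
pose Tm x (k : K) (i : I) : R := match k with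
  | inl k => if vert i \in U then qI (fun a => triv (tc k) (pt x a)) i else 0
  | inr j => ((j == i) && (vert i \notin U))%:R end.
have spanE x (c : K -> R) i : \sum_k c k * Tm x k i =
   if vert i \in U then qI (fun a => triv (c (inl (inord 0)), c (inl (inord 1)), c (inl (inord 2)), (c (inl (inord 3)), c (inl (inord 4)), c (inl (inord 5)))) (pt x a)) i
   else c (inr i).
  rewrite big_sumType /=; case: ifP => Ui /=.
    rewrite [X in _ + X]big1 ?addr0; last by move=> j _; rewrite andbF mulr0.
    rewrite !big_ord_recl big_ord0 /= /tc /=.
    have -> : lift ord0 (lift ord0 (lift ord0 (lift ord0 (lift ord0 ord0)))) = inord 5 :> 'I_6 by apply: val_inj; rewrite /= inordK.
    have -> : lift ord0 (lift ord0 (lift ord0 (lift ord0 ord0))) = inord 4 :> 'I_6 by apply: val_inj; rewrite /= inordK.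
    have -> : lift ord0 (lift ord0 (lift ord0 ord0)) = inord 3 :> 'I_6 by apply: val_inj; rewrite /= inordK.
    have -> : lift ord0 (lift ord0 ord0) = inord 2 :> 'I_6 by apply: val_inj; rewrite /= inordK.
    have -> : lift ord0 ord0 = inord 1 :> 'I_6 by apply: val_inj; rewrite /= inordK.
    have -> : ord0 = inord 0 :> 'I_6 by apply: val_inj; rewrite /= inordK.
    by case: i Ui => [[a|a]|a] _ /=; rewrite ?inordK //=; ring.
  rewrite big1 ?add0r; last by move=> k _; rewrite mulr0.
  rewrite (bigD1 i) //= eqxx /= mulr1 big1 ?addr0 // => j ji.
  by rewrite (negPf ji) /= mulr0.
have ptq a c : (polyfun C (fun x => (triv c (pt x a)).1.1) /\ polyfun C (fun x => (triv c (pt x a)).1.2)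
   /\ polyfun C (fun x => (triv c (pt x a)).2)) .
  case: c => [[[c1 c2] c3] [[c4 c5] c6]] /=; do !split.
  - apply: (@PolyExt _ _ _ (fun x => c1 + (- c5) * (pt x a).2 + c6 * ((pt x a).2 * (pt x a).2))).
      by move=> y /=; ring.
    by do !(apply: PolyAdd || apply: PolyMul || exact: PolyCst || exact: p2).
  - apply: (@PolyExt _ _ _ (fun x => c2 + (- c4) * (pt x a).2 + c5 * (pt x a).1 + (- 2 * c6) * ((pt x a).1 * (pt x a).2))).
      by move=> y /=; ring.
    by do !(apply: PolyAdd || apply: PolyMul || exact: PolyCst || exact: p2 || exact: p1).
  - apply: (@PolyExt _ _ _ (fun x => c3 + c4 * (pt x a).1 + c6 * ((pt x a).1 * (pt x a).1))).
      by move=> y /=; ring.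
    by do !(apply: PolyAdd || apply: PolyMul || exact: PolyCst || exact: p1).
have rigE x : rigid_along E U (pt x) (dir x) <->
  (forall f : I -> R, (forall e, \sum_i f i * M x i e = 0) -> exists c : K -> R, forall i, f i = \sum_k c k * Tm x k i).
  split=> [rig f Hf|H q Hq].
    have [|c Hc] := rig (Iq f).
      move=> a b Eab; apply/eqP; rewrite -subr_eq0; apply/eqP.
      have := sumM x (Iq f) (a, b); rewrite /= Eab => <-; rewrite -[RHS](Hf (a, b)).
      by apply: eq_bigr => -[[]|].
    case: c Hc => [[[c1 c2] c3] [[c4 c5] c6]] Hc.
    exists (fun k : K => match k with inl k => nth 0 [:: c1; c2; c3; c4; c5; c6] k | inr i => f i end) => i.
    rewrite spanE !inordK //=; case: ifP => // Ui.
    by case: i Ui => [[a|a]|a] /= /Hc; case.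
  have [e|c Hc] := H (qI q).
    by rewrite sumM; case: ifP => // Ee; rewrite (Hq _ _ Ee) subrr.
  exists (c (inl (inord 0)), c (inl (inord 1)), c (inl (inord 2)), (c (inl (inord 3)), c (inl (inord 4)), c (inl (inord 5)))) => a Ua; have := Hc (inl (inl a)); have := Hc (inl (inr a)); have := Hc (inr a).
  rewrite !spanE /= Ua; case: (q a) => [[A B] D] /= -> -> ->.
  by [].
have [i e|k i|x k e||f pf [f0 Hf]] := @open_kernel R X C I (T * T)%type K M Tm x0.
- rewrite /M; move: (d1 e.1 e.2) (d2 e.1 e.2).
  case: (E e.1 e.2) => D1 D2; last exact: PolyCst.
  apply: PolyMul; first exact: PolyCst.
  have := D1 isT; have := D2 isT.
  case: i => [[a|a]|a] /= P2 P1; [|exact: PolyMul|].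
    by apply: PolyExt (PolyMul P1 P1) => x; rewrite expr2.
  by apply: PolyExt (PolyMul P2 P2) => x; rewrite expr2.
- case: k => [k|j] /=; last exact: PolyCst.
  case: (vert i \in U); last exact: PolyCst.
  by have := ptq (vert i) (tc k) => -[P1 [P2 P3]]; case: i P1 P2 P3 => [[a|a]|a].
- case: k => [k|j] /=.
    have := sumM x (fun a => triv (tc k) (pt x a)) e.
    case: ifP => Ee; last by move=> _; rewrite /M Ee big1 // => i _; rewrite mulr0.
    rewrite (trivE _ _ _ _ Ee) subrr => S0; rewrite -[RHS]S0; apply: eq_bigr => i _.
    case: ifP => // Ui; rewrite mul0r /M Ee.
    case/andP: (EU _ _ Ee) => U1 U2.
    have -> : (vert i == e.1) = false by apply/negP => /eqP vi; rewrite vi U1 in Ui.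
    have -> : (vert i == e.2) = false by apply/negP => /eqP vi; rewrite vi U2 in Ui.
    by rewrite subrr mul0r mulr0.
  rewrite big1 // => i _; rewrite /M; case: ifP => Ee; last by rewrite mulr0.
  have [Ui|Ui] := boolP (vert i \in U); first by rewrite andbF mul0r.
  case/andP: (EU _ _ Ee) => U1 U2.
  have -> : (vert i == e.1) = false by apply/negP => /eqP vi; rewrite vi U1 in Ui.
  have -> : (vert i == e.2) = false by apply/negP => /eqP vi; rewrite vi U2 in Ui.
  by rewrite subrr mul0r mulr0.
- exact/rigE.
by exists f => //; split=> // x /Hf H; apply/rigE.
Qed.

(** One rigid placement suffices, so that generic rigidity becomes a property of the graph. *)
Lemma rigid_generic E U p0 : (forall a b, E a b -> (a \in U) && (b \in U)) ->
  rigid E U p0 -> generic (rigid E U).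
Proof.
move=> EU rig.
have [//|//|//|a b _|a b _|p c a b _|//|f pf [f0 Hf]] :=
  @rigid_along_open _ pcoord E U (fun p => p) pdir p0; last first.
  by exists f => //; split=> //; exists p0.
- by rewrite (triv_bev _ _ 1); congr (bev (triv _ _) _); rewrite !mul1r !subrKC; case: (p b).
- by apply: polyfun_sub; exact: polyfun_pcoord2.
- by apply: polyfun_sub; exact: polyfun_pcoord1.
- exact: polyfun_pcoord2.
- exact: polyfun_pcoord1.
Qed.

End Frameworks.
End Rigidity.

(** * Minimal cycles are generically rigid (Fogelsanger) *)

Section VertexSplit.
Variables (R : realFieldType) (T : finType).
Implicit Types (E : rel T) (U : {set T}) (p : T -> R * R).

(* At [e = 0] the two vertices [u] and [v] coincide and the direction [w] of the edge [uv] is kept;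
   the three edges [uv], [v w1], [v w2] then force equal values at [u] and [v]. *)
Lemma rigid_split (E' E : rel T) (U' : {set T}) u v w1 w2 :
  v \notin U' -> u \in U' -> w1 \in U' -> w2 \in U' ->
  u != w1 -> u != w2 -> w1 != w2 ->
  (forall a b, E a b -> (a \in v |: U') && (b \in v |: U')) ->
  E u v -> E u w1 -> E v w1 -> E u w2 -> E v w2 ->
  (forall a b, E' a b -> (a \in U') && (b \in U')) ->
  (forall a b, E' a b -> a != u -> b != u -> E a b) ->
  (forall b, E' u b -> E u b || E v b) -> (forall a, E' a u -> E u a || E v a) ->
  generic (@rigid R T E' U') -> generic (@rigid R T E (v |: U')).
Proof.
move=> vU uU w1U w2U uw1 uw2 w12 EU Euv Euw1 Evw1 Euw2 Evw2 E'U E'E E'u E'u' genE'.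
have [f pf [[p' fp'] fP]] := generic_and genE' (generic_area R uw1 uw2 w12).
have [rig' ar] := fP _ fp'.
have uv : u != v by apply: contraNneq vU => <-.
have neqv x : x \in U' -> (x == v) = false by move=> xU; apply: contraNF vU => /eqP <-.
(* The sum of the directions to [w1] and [w2]. The edges to [w1], to [w2] and between [u] and [v]
   then carry directions of the form [d], [e], [d + e], exactly the zeros required by [binq_eq0];
   independence of [d] and [e] is the area condition. *)
pose w : R * R := ((pdir p' u w1).1 + (pdir p' u w2).1, (pdir p' u w1).2 + (pdir p' u w2).2).
pose pt (e : R) a := if a == v then ((p' u).1 + e * w.1, (p' u).2 + e * w.2) else p' a.
pose sp a b := (a == u) && (b == v) || (a == v) && (b == u).
pose dir e a b := if sp a b then w else pdir (pt e) a b.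
have ptv e : pt e v = ((p' u).1 + e * w.1, (p' u).2 + e * w.2) by rewrite /pt eqxx.
have ptn e a : a != v -> pt e a = p' a by rewrite /pt => /negPf ->.
have pid : polyfun (fun g : R -> R => g = id) id by exact: PolyCoord.
have ppt1 a : polyfun (fun g : R -> R => g = id) (fun e => (pt e a).1).
  rewrite /pt; case: (a == v) => /=; last exact: PolyCst.
  by apply: PolyAdd; [exact: PolyCst | apply: PolyMul pid (PolyCst _ _)].
have ppt2 a : polyfun (fun g : R -> R => g = id) (fun e => (pt e a).2).
  rewrite /pt; case: (a == v) => /=; last exact: PolyCst.
  by apply: PolyAdd; [exact: PolyCst | apply: PolyMul pid (PolyCst _ _)].
have bevN (q : binq R) (d : R * R) s : bev q (s * d.1, s * d.2) = s ^+ 2 * bev q d by rewrite /bev /=; ring.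
have [||||||g pg [g0 gP]] := @rigid_along_open R T R (fun g => g = id) E (v |: U') pt dir 0 EU.
- exact: ppt1.
- exact: ppt2.
- move=> a b _; rewrite /dir; case: (sp a b); first exact: PolyCst.
  by apply: polyfun_sub; exact: ppt1.
- move=> a b _; rewrite /dir; case: (sp a b); first exact: PolyCst.
  by apply: polyfun_sub; exact: ppt2.
- move=> e c a b _; rewrite /dir; case: ifP => [|_].
    case/orP => /andP[/eqP -> /eqP ->]; rewrite ptv ptn //; first exact: triv_bev.
    by rewrite -triv_bev.
  rewrite (triv_bev _ _ 1); congr (bev (triv _ _) _).
  by rewrite !mul1r !subrKC; case: (pt e b).
- move=> q Hq.
  have dirn a b : (a != v) -> (b != v) -> dir 0 a b = pdir p' a b.
    by move=> av bv; rewrite /dir /sp (negPf av) (negPf bv) andbF /= /pdir !ptn.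
  have pt0v : pt 0 v = p' u by rewrite ptv !mul0r !addr0; case: (p' u).
  have dirv b : b != v -> b != u -> dir 0 v b = pdir p' u b.
    by move=> bv bu; rewrite /dir /sp (negPf bu) (negPf bv) !andbF /= /pdir pt0v ptn.
  have quv : q u = q v.
    apply/eqP; rewrite -subr_eq0; apply/eqP.
    have bevB (q1 q2 : binq R) d : bev (q1 - q2) d = bev q1 d - bev q2 d by rewrite /bev /=; ring.
    have step x : x \in U' -> x != u -> E u x -> E v x -> bev (q u - q v) (pdir p' u x) = 0.
      move=> xU xu Eux Evx; rewrite bevB.
      have := Hq _ _ Eux; have := Hq _ _ Evx; rewrite dirv ?neqv // dirn ?neqv // => -> ->.
      by rewrite subrr.
    apply: (@binq_eq0 _ _ (pdir p' u w1) (pdir p' u w2)) => //.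
    + by apply: step; rewrite // eq_sym.
    + by apply: step; rewrite // eq_sym.
    + by have := Hq _ _ Euv; rewrite /dir /sp !eqxx /= bevB => ->; rewrite subrr.
  have [a b E'ab|c Hc] := rig' q.
    have /andP[aU bU] := E'U _ _ E'ab.
    have toU y x : E y x || E v x -> y = u -> x \in U' -> x != u -> bev (q u) (pdir p' u x) = bev (q x) (pdir p' u x).
      move=> + yu xU xu; rewrite yu => /orP[] Ex; have := Hq _ _ Ex; first by rewrite dirn ?neqv.
      by rewrite dirv ?neqv // quv.
    have [au|au] := eqVneq a u; have [bu|bu] := eqVneq b u.
    + by rewrite au bu.
    + by rewrite au in E'ab *; apply: (toU u) => //; exact: E'u.
    + rewrite bu in E'ab *; have := toU u a (E'u' _ E'ab) erefl aU au.
      have N (Q : binq R) : bev Q (pdir p' a u) = bev Q (pdir p' u a) by rewrite /bev /pdir /=; ring.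
      by rewrite !N => ->.
    + by have := Hq _ _ (E'E _ _ E'ab au bu); rewrite dirn ?neqv.
  exists c => a /setU1P[->|aU]; first by rewrite -quv pt0v Hc.
  by rewrite ptn ?neqv // Hc.
have [P HP] := polyfun_horner pg.
have P0 : P != 0 by apply: contraNneq g0 => P0; rewrite HP P0 horner0.
have [t t0 Pt] := poly_nonroot P0.
(* For nonzero [t] the true direction of the edge from [u] to [v] is [w] scaled by [t] or [- t]; the
   scalar enters both sides of the edge condition squared and cancels, so the placement [pt t] is
   rigid in the ordinary sense. *)
apply: (@rigid_generic _ _ _ _ (pt t)) => // q Hq.
apply: (gP t); first by rewrite HP.
move=> a b Eab; have := Hq _ _ Eab; rewrite /dir; case: ifP => // /orP[] /andP[/eqP -> /eqP ->].
  have -> : pdir (pt t) u v = (t * w.1, t * w.2) by rewrite /pdir ptv ptn //=; congr (_, _); ring.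
  by rewrite !bevN => /mulfI; apply; rewrite expf_eq0 (negPf t0).
have -> : pdir (pt t) v u = ((- t) * w.1, (- t) * w.2) by rewrite /pdir ptv ptn //=; congr (_, _); ring.
by rewrite !bevN => /mulfI; apply; rewrite expf_eq0 oppr_eq0 (negPf t0).
Qed.

Lemma rigid_triangle u x y : u != x -> u != y -> x != y ->
  generic (@rigid R T (fun a b => [&& a != b, a \in [set u; x; y] & b \in [set u; x; y]]) [set u; x; y]).
Proof.
move=> ux uy xy.
apply: (@rigid_generic _ _ _ _ (fun a => if a == u then (0, 0) else if a == x then (1, 0) else (0, 1))).
  by move=> a b /and3P[_ -> ->].
move=> q Hq.
have := Hq u x; have := Hq u y; have := Hq x y.
rewrite !inE !eqxx ux uy xy !orbT /= => /(_ isT) + /(_ isT) + /(_ isT).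
rewrite /pdir !eqxx (eq_sym x u) (eq_sym y u) (eq_sym y x) (negPf ux) (negPf uy) (negPf xy) /bev /=.
case Eu: (q u) => [[A0 B0] C0]; case Ex: (q x) => [[Ax Bx] Cx]; case Ey: (q y) => [[Ay By] Cy] /=.
move=> h1 h2 h3.
(* At the points (0,0), (1,0), (0,1): the first three entries are read at [u], the next two from the
   mixed coefficients at [y] and [x], the last from the leading coefficient at [y]. The remaining
   equalities are the three edge equations. *)
exists (A0, B0, C0, (B0 - By, Bx - B0, Ay - A0 + Bx - B0)) => a.
rewrite !inE => /orP[/orP[]|] /eqP ->.
- rewrite Eu eqxx /triv /=; congr (_, _, _); ring.
- rewrite Ex (eq_sym x u) (negPf ux) eqxx /triv /=; congr (_, _, _); move: h1 h2 h3; lra.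
- rewrite Ey (eq_sym y u) (eq_sym y x) (negPf uy) (negPf xy) /triv /=; congr (_, _, _); move: h1 h2 h3; lra.
Qed.

End VertexSplit.

(** * Mod-2 cycles of triangles and their minimal subcycles *)

Section Cycles.
Variable T : finType.
Implicit Types (S M : {set {set T}}) (e s : {set T}).

Definition degc S e : nat := #|[set s in S | e \subset s]|.

Definition cycleb S : bool :=
  [forall s in S, #|s| == 3%N] && [forall e : {set T}, (#|e| == 2%N) ==> ~~ odd (degc S e)].

Definition mincycle S : Prop :=
  [/\ cycleb S, S != set0 &
      forall S', S' \subset S -> cycleb S' -> S' != set0 -> S' = S].

Definition cedge S : rel T := fun a b => (a != b) && [exists s in S, (a \in s) && (b \in s)].

Lemma cyclebP S : reflect ((forall s, s \in S -> #|s| = 3%N) /\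
    (forall e, #|e| = 2%N -> ~~ odd (degc S e))) (cycleb S).
Proof.
apply: (iffP andP) => [[/forall_inP h1 /forallP h2]|[h1 h2]].
  by split=> [s /h1 /eqP //|e /eqP e2]; have := h2 e; rewrite e2.
split; first by apply/forall_inP => s /h1 ->.
by apply/forallP => e; apply/implyP => /eqP; exact: h2.
Qed.

Lemma cedgeP S a b : reflect (a != b /\ exists2 s, s \in S & (a \in s) && (b \in s)) (cedge S a b).
Proof.
apply: (iffP andP) => [[ab /exists_inP[s sS ab_s]]|[ab [s sS ab_s]]]; split=> //; first by exists s.
by apply/exists_inP; exists s.
Qed.

Lemma cedge_sym S a b : cedge S a b = cedge S b a.
Proof.
rewrite /cedge eq_sym; congr (_ && _).
by apply: eq_existsb => s; rewrite (andbC (a \in s)).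
Qed.

Lemma set2_sub (a b : T) s : ([set a; b] \subset s) = (a \in s) && (b \in s).
Proof. by rewrite subUset !sub1set. Qed.

Lemma handshake S u : (forall s, s \in S -> #|s| = 3%N) ->
  (\sum_(w | w != u) degc S [set u; w])%N = (#|[set s in S | u \in s]|).*2.
Proof.
move=> S3.
rewrite (eq_bigr (fun w => \sum_(s in S) ((u \in s) && (w \in s) : nat))%N); last first.
  move=> w _; rewrite /degc -sum1_card big_mkcond /=.
  rewrite [RHS]big_mkcond /=; apply: eq_bigr => s _; rewrite inE set2_sub.
  by case: (s \in S); case: (u \in s); case: (w \in s).
rewrite exchange_big /= -muln2 -sum_nat_const big_mkcond [RHS]big_mkcond /=.
apply: eq_bigr => s _; rewrite inE; case: (boolP (s \in S)) => //= sS.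
case: (boolP (u \in s)) => us; last by rewrite big1.
have := S3 _ sS; rewrite (cardsD1 u) us add1n => -[<-].
by rewrite -sum1_card [RHS]big_mkcond [LHS]big_mkcond /=; apply: eq_bigr => w _; rewrite !inE; case: (w != u); case: (w \in s).
Qed.

Lemma odd_sum (I : Type) (r : seq I) (P : pred I) (F : I -> nat) :
  odd (\sum_(i <- r | P i) F i)%N = \big[addb/false]_(i <- r | P i) odd (F i).
Proof. by apply: (big_morph odd oddD). Qed.

(** The degrees of the edges at [u] have an even sum, so a single unchecked edge at [u] is even as
    well. *)
Lemma cycle_except S u v : u != v -> (forall s, s \in S -> #|s| = 3%N) ->
  (forall e, #|e| = 2%N -> e != [set u; v] -> ~~ odd (degc S e)) -> cycleb S.
Proof.
move=> uv S3 H; apply/cyclebP; split=> // e e2.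
have [->|] := eqVneq e [set u; v]; last exact: H.
have := congr1 odd (handshake u S3); rewrite odd_double (bigD1 v) 1?eq_sym //= oddD.
rewrite odd_sum big1; first by rewrite addbF => ->.
move=> w /andP[wu wv]; apply/negbTE/H; first by rewrite cards2 eq_sym wu.
apply: contraNneq wv => E; have : w \in [set u; v] by rewrite -E !inE eqxx orbT.
by rewrite !inE (negPf wu).
Qed.

Lemma mincycle_exists S s0 : cycleb S -> s0 \in S ->
  exists2 M : {set {set T}}, M \subset S & mincycle M /\ s0 \in M.
Proof.
move=> cS s0S.
have [M /minsetP[/andP[cM s0M] minM] MS] := @minset_exists _ (fun M : {set {set T}} => cycleb M && (s0 \in M)) S (introT andP (conj cS s0S)).
exists M => //; split=> //; split=> //; first by apply/set0Pn; exists s0.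
move=> N NM cN N0.
have [s0N|s0N] := boolP (s0 \in N); first by apply: minM => //; rewrite cN.
(* A nonempty subcycle [N] avoiding [s0] would leave a complementary cycle that still contains [s0],
   against the minimality of [M] among the cycles through [s0]. *)
have cD : cycleb (M :\: N).
  move/cyclebP: cM => [M3 Me]; move/cyclebP: cN => [N3 Ne]; apply/cyclebP; split.
    by move=> s /setDP[/M3].
  move=> e e2; have : degc M e = (degc N e + degc (M :\: N) e)%N.
    rewrite /degc -cardsUI.
    have -> : [set s in N | e \subset s] :&: [set s in M :\: N | e \subset s] = set0.
      by apply/setP => s; rewrite !inE; case: (s \in N); rewrite //= andbF.
    rewrite cards0 addn0; apply: eq_card => s; rewrite !inE.
    by have := subsetP NM s; case: (s \in N); case: (s \in M) => H; rewrite /= ?orbF //; have := H isT.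
  move=> /(congr1 odd); rewrite oddD (negPf (Me e e2)) (negPf (Ne e e2)) /= => <- //.
have : M :\: N = M by apply: minM; rewrite ?subsetDl // cD inE s0N.
move/setP => E; case/set0Pn: N0 => s sN; have := E s.
by rewrite inE sN (subsetP NM _ sN).
Qed.

End Cycles.

(** * Contraction of an edge of a cycle *)

Section Contraction.
Variables (T : finType) (S : {set {set T}}) (u v : T).
Hypotheses (uv : u != v) (cS : cycleb S).
Implicit Types (M : {set {set T}}) (e s : {set T}).

Definition contract s : {set T} := if v \in s then u |: (s :\ v) else s.

(** The triangles that contraction does not collapse to an edge. *)
Definition noedge : {set {set T}} := [set s in S | ~~ ([set u; v] \subset s)].

Definition fiber M e : {set {set T}} := [set s in noedge | (contract s \in M) && (e \subset contract s)].

(** The pushforward of the chain modulo two: images that are hit an even number of times cancel. *)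
Definition contraction : {set {set T}} := [set s' | odd #|[set s in noedge | contract s == s']|].

Lemma in_noedge s : s \in noedge -> s \in S /\ ~ (u \in s /\ v \in s).
Proof. by rewrite inE set2_sub => /andP[-> /negP H]; split=> // -[us vs]; apply: H; rewrite us. Qed.

Lemma card3 s : s \in S -> #|s| = 3%N.
Proof. by move/cyclebP: cS => [H _]; exact: H. Qed.

Lemma notin_contract s : v \notin contract s.
Proof.
rewrite /contract; case: (boolP (v \in s)) => //.
by rewrite !inE eqxx /= orbF eq_sym (negPf uv).
Qed.

Lemma mem_contract s x : x != u -> x != v -> (x \in contract s) = (x \in s).
Proof. by move=> xu xv; rewrite /contract; case: ifP; rewrite // !inE xv (negPf xu). Qed.

Lemma u_contract s : (u \in contract s) = (u \in s) || (v \in s).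
Proof. by rewrite /contract; case: ifP; rewrite ?orbF // !inE eqxx ?orbT. Qed.

Lemma card_contract s : s \in noedge -> #|contract s| = 3%N.
Proof.
case/in_noedge => sS nuv; rewrite /contract; case: ifP => vs; last exact: card3.
have us : u \notin s by apply/negP => us; apply: nuv.
by rewrite cardsU1 !inE uv /= (negPf us) -(card3 sS) (cardsD1 v s) vs.
Qed.

(** Each triangle of [M] has an odd number of preimages, so counting preimages instead of triangles
    preserves parity. *)
Lemma odd_fiber M e : M \subset contraction -> odd #|fiber M e| = odd (degc M e).
Proof.
move=> /subsetP MS; rewrite /degc -!sum1_card.
rewrite (partition_big contract (fun s' => s' \in [set s' in M | e \subset s'])) /=; last first.
  by move=> s; rewrite !inE => /andP[_].
rewrite !odd_sum; apply: eq_bigr => s' s'M.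
have od : odd #|[set s in noedge | contract s == s']|.
  by have := MS s'; rewrite inE; apply; move: s'M; rewrite inE => /andP[].
rewrite [RHS]/= -[RHS]od -sum1_card; congr (odd _); apply: eq_bigl => s; rewrite !inE in s'M *.
by case: eqP => [->|_]; rewrite ?andbF // s'M !andbT.
Qed.

(** The images that cancel have an even number of preimages, so restricting to the fiber over
    [contraction] does not affect parity. *)
Lemma card_even_fiber e :
  odd #|[set s in noedge | e \subset contract s]| = odd (degc contraction e).
Proof.
rewrite -odd_fiber // -!sum1_card [in LHS](partition_big contract predT) //=.
rewrite [in RHS](partition_big contract predT) //= !odd_sum; apply: eq_bigr => s' _.
have [s'S|s'S] := boolP (s' \in contraction).
  congr (odd _); apply: eq_bigl => s; rewrite !inE; case: eqP => [->|]; rewrite ?andbF //.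
  by move: s'S; rewrite inE => ->.
rewrite [in RHS]big_pred0; last first.
  by move=> s; rewrite in_set; case: eqP => [->|]; rewrite ?andbF // (negPf s'S) /= andbF.
apply/negbTE; have [es'|es'] := boolP (e \subset s').
  move: s'S; rewrite inE -sum1_card; congr (~~ odd _); apply: eq_bigl => s.
  by rewrite !inE; case: eqP => [->|]; rewrite ?andbF // es' !andbT.
by rewrite big_pred0 // => s; rewrite !inE; case: eqP => [->|]; rewrite ?andbF // (negPf es') andbF.
Qed.

Lemma sub_contract2 a b s : a != u -> a != v -> b != u -> b != v ->
  ([set a; b] \subset contract s) = ([set a; b] \subset s).
Proof. by move=> au av bu bv; rewrite !set2_sub !mem_contract. Qed.

Lemma degc_split (N : {set {set T}}) x : N \subset noedge -> x != u -> x != v ->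
  #|[set s in N | [set u; x] \subset contract s]| = (degc N [set u; x] + degc N [set v; x])%N.
Proof.
move=> /subsetP Nn xu xv; rewrite /degc -cardsUI.
have -> : [set s in N | [set u; x] \subset s] :&: [set s in N | [set v; x] \subset s] = set0.
  apply/setP => s; rewrite !inE !set2_sub; apply/negP => /and3P[/and3P[sN us _] _ /andP[vs _]].
  by have [_] := in_noedge (Nn _ sN); apply.
rewrite cards0 addn0; apply: eq_card => s; rewrite !inE !set2_sub u_contract mem_contract //.
by case: (s \in N); case: (u \in s); case: (v \in s); case: (x \in s).
Qed.

(** A collapsed triangle through [e] contains [u], [v] and [e]; by cardinality it is their union, so
    at most one triangle is lost. *)
Lemma degc_noedge e : #|e| = 2%N -> ~~ ((u \in e) && (v \in e)) -> 
  degc S e = (degc noedge e + ([set u; v] :|: e \in S))%N.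
Proof.
move=> e2 nuve.
have card4 s : s \in S -> e \subset s -> [set u; v] \subset s -> s = [set u; v] :|: e.
  move=> sS es uvs; apply/esym/eqP; rewrite eqEcard subUset uvs es (card3 sS) /=.
  have := cardsUI [set u; v] e; rewrite cards2 uv e2 /= => c.
  suff : (#|[set u; v] :&: e| < 2)%N by move: c; case: #|_ :&: _| => [|[]]; lia.
  rewrite ltnNge; apply/negP => le; move/negP: nuve; apply.
  have : [set u; v] :&: e == [set u; v] by rewrite eqEcard subsetIl cards2 uv.
  by move/eqP/setIidPl; rewrite set2_sub.
rewrite /degc (cardsD1 ([set u; v] :|: e)) addnC; congr (_ + _)%N.
  apply: eq_card => s; rewrite !inE; apply/idP/idP.
    case/and3P => ne sS es; rewrite sS es andbT /=; apply: contra ne => uvs.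
    by rewrite (card4 s sS es uvs).
  case/andP => /andP[sS nuvs] es; rewrite sS es !andbT; apply: contraNneq nuvs => ->.
  exact: subsetUl.
by rewrite !inE subsetUr andbT.
Qed.

(** The delicate edges join [u] to some [x]: they collect the surviving triangles at [ux] and at
    [vx]. The triangle [uvx], if present, is missing from both counts and thus does not change the
    parity. *)
Lemma contraction_cycle : cycleb contraction.
Proof.
apply/cyclebP; split=> [s'|e e2].
  rewrite inE => od; have /card_gt0P[s] : (0 < #|[set s in noedge | contract s == s']|)%N by case: #|_| od.
  by rewrite inE => /andP[sn /eqP <-]; exact: card_contract.
have S2 e' : #|e'| = 2%N -> ~~ odd (degc S e') by move/cyclebP: cS => [_]; apply.
rewrite -card_even_fiber.
have [ve|ve] := boolP (v \in e).
  rewrite eq_card0 // => s; rewrite !inE; apply/negP => /andP[_ /subsetP/(_ _ ve)].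
  exact/negP/notin_contract.
have [ue|ue] := boolP (u \in e).
  have /eqP/cards1P[x ex] : #|e :\ u| = 1%N by apply/eqP; move: e2; rewrite (cardsD1 u) ue add1n => -[->].
  have xe : x \in e :\ u by rewrite ex inE.
  have xu : x != u by move: xe; rewrite !inE => /andP[].
  have xv : x != v by apply: contraNneq ve => <-; move: xe; rewrite !inE => /andP[].
  have -> : e = [set u; x] by rewrite -ex setD1K.
  rewrite degc_split // oddD.
  have := S2 [set u; x]; have := S2 [set v; x]; rewrite !cards2 (eq_sym u) (eq_sym v) xu xv => /(_ erefl) + /(_ erefl).
  have n1 : ~~ ((u \in [set u; x]) && (v \in [set u; x])).
    by rewrite !inE eqxx [v == u]eq_sym (negPf uv) [v == x]eq_sym (negPf xv).
  have n2 : ~~ ((u \in [set v; x]) && (v \in [set v; x])).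
    by rewrite !inE (negPf uv) [u == x]eq_sym (negPf xu).
  have c1 : #|[set u; x]| = 2%N by rewrite cards2 eq_sym xu.
  have c2 : #|[set v; x]| = 2%N by rewrite cards2 eq_sym xv.
  rewrite (degc_noedge c1 n1) (degc_noedge c2 n2).
  have -> : [set u; v] :|: [set v; x] = [set u; v] :|: [set u; x].
    by apply/setP => z; rewrite !inE; case: (z == u); case: (z == v); case: (z == x).
  by rewrite !oddD; case: (odd _); case: (odd _); case: (odd _).
rewrite (_ : [set _ in _ | _] = [set s in noedge | e \subset s]); last first.
  apply/setP => s; rewrite [LHS]in_set [RHS]in_set; congr (_ && _).
  case/eqP/cards2P: e2 ve ue => x [y [xy ->]]; rewrite !inE !negb_or => /andP[vx vy] /andP[ux uy].
  by rewrite sub_contract2 // eq_sym.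
have := S2 _ e2; rewrite degc_noedge // ?(negPf ue) //.
case: (boolP (_ \in S)) => [inS|]; last by rewrite addn0.
have := card3 inS; rewrite cardsU cards2 uv e2.
rewrite (_ : _ :&: _ = set0) ?cards0 //.
by apply/setP => z; rewrite !inE; apply/negP => /andP[/orP[] /eqP ->]; apply/negP.
Qed.

Lemma contraction_lift s' : s' \in contraction -> exists2 s, s \in noedge & contract s = s'.
Proof.
rewrite inE => od; have /card_gt0P[s] : (0 < #|[set s in noedge | contract s == s']|)%N by case: #|_| od.
by rewrite inE => /andP[sn /eqP <-]; exists s.
Qed.

(** Let [N] be the surviving triangles that map into [M]; the edges [ux] and [vx] have the same
    parity in [N]. If they were all even, [N] would be a cycle, hence all of [S], although a
    triangle containing [uv] is outside [N]. So some [w] has odd parity, and by the handshake at [u]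
    there are two. An odd edge lies in some triangle, so such a [w] is adjacent to both [u] and
    [v]. *)
Lemma common_neighbours M s0 : mincycle S -> cedge S u v -> M \subset contraction -> cycleb M ->
  s0 \in M -> exists w1 w2, [/\ w1 != w2,
   [&& w1 \in cover M, w2 \in cover M & u \in cover M],
   [&& u != w1, u != w2, v != w1 & v != w2],
   cedge S u w1 && cedge S v w1 & cedge S u w2 && cedge S v w2].
Proof.
move=> [_ S0 minS] Euv MS cM s0M.
pose N := [set s in noedge | contract s \in M].
have Nn : N \subset noedge by apply/subsetP => s; rewrite inE => /andP[].
have NS : N \subset S by apply: subset_trans Nn _; apply/subsetP => s; rewrite inE => /andP[].
have N3 s : s \in N -> #|s| = 3%N by move/(subsetP NS)/card3.
have M2 e : #|e| = 2%N -> ~~ odd (degc M e) by move/cyclebP: cM => [_]; apply.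
have fibE e : fiber M e = [set s in N | e \subset contract s].
  by apply/setP => s; rewrite !inE -!andbA.
have Nuv : degc N [set u; v] = 0%N.
  apply: eq_card0 => s; rewrite !inE; apply/negP => /andP[/andP[/andP[_ /negP H] _]].
  by rewrite set2_sub => /andP[us vs]; apply: H; rewrite set2_sub us.
have par x : x != u -> x != v -> odd (degc N [set u; x]) = odd (degc N [set v; x]).
  move=> xu xv; have := M2 [set u; x]; rewrite cards2 eq_sym xu => /(_ erefl).
  by rewrite -odd_fiber // fibE degc_split // oddD negb_add => /eqP.
have nb w : w != u -> odd (degc N [set u; w]) ->
   [/\ w \in cover M, u \in cover M, v != w, cedge S u w & cedge S v w].
  move=> wu od; have wv : w != v by apply: contraTneq od => ->; rewrite Nuv.
  have /card_gt0P[s] : (0 < degc N [set u; w])%N by case: (degc _ _) od.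
  rewrite in_set set2_sub => /andP[sN /andP[us ws]].
  have /card_gt0P[t] : (0 < degc N [set v; w])%N by move: od; rewrite par //; case: (degc _ _).
  rewrite in_set set2_sub => /andP[tN /andP[vt wt]].
  have cM' : contract s \in M by move: sN; rewrite inE => /andP[].
  split; rewrite 1?eq_sym //.
  - by apply/bigcupP; exists (contract s); rewrite ?mem_contract.
  - by apply/bigcupP; exists (contract s); rewrite ?u_contract ?us.
  - by apply/cedgeP; split; [rewrite eq_sym|exists s; [exact: (subsetP NS)|rewrite us]].
  - by apply/cedgeP; split; [rewrite eq_sym|exists t; [exact: (subsetP NS)|rewrite vt]].
have [w1 w1u od1] : exists2 w, w != u & odd (degc N [set u; w]).
  have [/existsP[w /andP[wu od]]|/existsPn H] := boolP [exists w, (w != u) && odd (degc N [set u; w])].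
    by exists w.
  exfalso; have cN : cycleb N.
    apply: (cycle_except uv) => // e e2 _.
    have ev x : x != u -> ~~ odd (degc N [set u; x]) by move=> xu; have := H x; rewrite xu.
    have [ue|ue] := boolP (u \in e).
      have /eqP/cards1P[x ex] : #|e :\ u| = 1%N by apply/eqP; move: e2; rewrite (cardsD1 u) ue add1n => -[->].
      have : x \in e :\ u by rewrite ex inE.
      by rewrite !inE => /andP[xu _]; rewrite -(setD1K ue) ex ev.
    have [ve|ve] := boolP (v \in e).
      have /eqP/cards1P[x ex] : #|e :\ v| = 1%N by apply/eqP; move: e2; rewrite (cardsD1 v) ve add1n => -[->].
      have : x \in e :\ v by rewrite ex inE.
      rewrite !inE => /andP[xv xe]; have xu : x != u by apply: contraNneq ue => <-.
      by rewrite -(setD1K ve) ex -par // ev.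
    rewrite /degc (_ : [set _ in _ | _] = fiber M e); first by rewrite odd_fiber // M2.
    apply/setP => s; rewrite fibE !in_set; congr (_ && _).
    case/eqP/cards2P: e2 ve ue => x [y [xy ->]]; rewrite !inE !negb_or => /andP[vx vy] /andP[ux uy].
    by rewrite sub_contract2 // eq_sym.
  have NS' : N = S.
    apply: minS => //; have [s sn cs] := contraction_lift (subsetP MS _ s0M).
    by apply/set0Pn; exists s; rewrite in_set sn cs.
  case/cedgeP: Euv => _ [s sS /andP[us vs]].
  have : s \in noedge by apply: (subsetP Nn); rewrite NS'.
  by case/in_noedge => _; apply.
have [w2 [w2u w21 od2]] : exists w, [/\ w != u, w != w1 & odd (degc N [set u; w])].
  have [/existsP[w /and3P[wu w1' od]]|/existsPn H] := boolP [exists w, [&& w != u, w != w1 & odd (degc N [set u; w])]].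
    by exists w.
  exfalso; have := congr1 odd (handshake u N3); rewrite odd_double (bigD1 w1) //= oddD od1.
  rewrite odd_sum big1 // => w /andP[wu ww1]; apply/negbTE.
  by have := H w; rewrite wu ww1.
have [a1 a2 a3 a4 a5] := nb _ w1u od1; have [b1 b2 b3 b4 b5] := nb _ w2u od2.
exists w1, w2; split.
- by rewrite eq_sym.
- by rewrite a1 b1 a2.
- by rewrite a3 b3 (eq_sym u) w1u (eq_sym u) w2u.
- by rewrite a4.
- by rewrite b4.
Qed.

End Contraction.

(** * Induction on the number of vertices *)

Section Fogelsanger.
Variables (R : realFieldType) (T : finType).
Implicit Types (S : {set {set T}}).

(** All pieces contain [u] and [v], so two pieces that share a third vertex have the same trivial
    solution. Fix the solution [c0] of one piece: the triangles on which [q] agrees with [c0] form a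
    nonempty subcycle, which by minimality is everything. *)
Lemma glue_pieces S u v (p : T -> R * R) (q : T -> binq R) :
  mincycle S -> cedge S u v -> (forall a b, a != b -> p a != p b) ->
  (forall s, s \in noedge S u v ->
     exists c, forall a, a \in [set u; v] :|: s -> q a = triv c (p a)) ->
  exists c, forall a, a \in cover S -> q a = triv c (p a).
Proof.
move=> [cS S0 minS] Euv injp pieces.
case/cedgeP: (Euv) => uv [s1 s1S /andP[us1 vs1]].
have S3 := card3 cS.
(* By parity the edge [uw] of a triangle [uvw] lies in a second triangle, and that one cannot
   contain [v]. *)
have [s0 s0n] : exists s, s \in noedge S u v.
  have /eqP/cards1P[w s1w] : #|s1 :\ u :\ v| = 1%N.
    by apply/eqP; have := S3 _ s1S; rewrite (cardsD1 u) us1 (cardsD1 v) !inE eq_sym uv vs1 !add1n => -[->].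
  have : w \in s1 :\ u :\ v by rewrite s1w inE.
  rewrite !inE => /and3P[wv wu ws1].
  have : ~~ odd (degc S [set u; w]) by move/cyclebP: cS => [_]; apply; rewrite cards2 eq_sym wu.
  rewrite /degc (cardsD1 s1) !inE set2_sub s1S us1 ws1 /= negbK => od.
  have /card_gt0P[s] : (0 < #|[set s in S | [set u; w] \subset s] :\ s1|)%N by case: #|_| od.
  rewrite !inE set2_sub => /and3P[ss1 sS /andP[us ws]]; exists s; rewrite inE sS /=.
  apply: contraNN ss1; rewrite set2_sub us /= => vs.
  have E t : t \in S -> u \in t -> v \in t -> w \in t -> t = [set u; v; w].
    move=> tS ut vt wt; apply/esym/eqP; rewrite eqEcard (S3 _ tS) !subUset !sub1set ut vt wt /=.
    by rewrite setUC cardsU1 !inE negb_or wu wv cards2 uv.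
  by rewrite (E s) // (E s1).
have [c0 Hc0] := pieces _ s0n.
pose good a := q a == triv c0 (p a).
have gu : good u by apply/eqP/Hc0; rewrite !inE eqxx.
have gv : good v by apply/eqP/Hc0; rewrite !inE eqxx orbT.
have key s x : s \in noedge S u v -> x \in s -> x != u -> x != v -> good x -> forall a, a \in s -> good a.
  move=> sn xs xu xv gx a asx; have [c Hc] := pieces _ sn.
  have trivB c' z : triv (c - c') z = triv c z - triv c' z.
    case: c c' {Hc} => [[[? ?] ?] [[? ?] ?]] [[[? ?] ?] [[? ?] ?]].
    by rewrite /triv /=; congr (_, _, _) => /=; ring.
  have z y : good y -> y \in [set u; v] :|: s -> triv (c - c0) (p y) = 0.
    by move=> /eqP gy /Hc; rewrite gy trivB => ->; rewrite subrr.
  have /eqP : c - c0 = (0, 0, 0, (0, 0, 0)).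
    apply: (@triv_eq0 _ _ (p u) (p v) (p x)); rewrite ?injp // 1?eq_sym //.
    - by apply: z => //; rewrite !inE eqxx.
    - by apply: z => //; rewrite !inE eqxx orbT.
    - by apply: z => //; rewrite !inE xs orbT.
  by rewrite subr_eq0 /good => /eqP <-; apply/eqP/Hc; rewrite !inE asx orbT.
pose A := [set s in S | [forall a in s, good a]].
have AS : A \subset S by apply/subsetP => s; rewrite inE => /andP[].
(* An edge other than [uv] has a vertex [x] outside [{u, v}]. If both its ends are good, every
   triangle around it is good; otherwise none is. Its degree in [A] is thus its degree in [S] or
   zero. *)
have cA : cycleb A.
  apply: (cycle_except uv) => [s /(subsetP AS)/S3 //|e e2 euv].
  have [/forall_inP ge|] := boolP [forall a in e, good a]; last first.
    rewrite negb_forall_in => /exists_inP[a ae ga]; rewrite /degc eq_card0 // => s.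
    rewrite !inE; apply/negP => /andP[/andP[_ /forall_inP gs] /subsetP/(_ _ ae)/gs].
    exact/negP.
  suff -> : degc A e = degc S e by move/cyclebP: cS => [_]; apply.
  apply: eq_card => s; rewrite !inE; case: (boolP (s \in S)) => //= sS.
  have [es|] := boolP (e \subset s); rewrite ?andbF // andbT; apply/forall_inP.
  have [x xe /andP[xu xv]] : exists2 x, x \in e & (x != u) && (x != v).
    have [/exists_inP[x]|/exists_inPn H] := boolP [exists x in e, (x != u) && (x != v)]; first by exists x.
    exfalso; move/negP: euv; apply; rewrite eqEcard cards2 uv e2 andbT; apply/subsetP => x /H.
    by rewrite !inE negb_and !negbK.
  have [uvs|nuvs] := boolP ([set u; v] \subset s); last first.
    by move=> a; apply: (key s x); rewrite ?inE ?sS ?(subsetP es) // ge.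
  move: uvs; rewrite set2_sub => /andP[us vs] a asx.
  have E : [set u; v; x] = s.
    apply/eqP; rewrite eqEcard (S3 _ sS) !subUset !sub1set us vs (subsetP es) //=.
    by rewrite setUC cardsU1 !inE negb_or xu xv cards2 uv.
  by move: asx; rewrite -E !inE => /orP[/orP[]|] /eqP -> //; exact: ge.
have A0 : A != set0.
  apply/set0Pn; exists s0; rewrite inE; case/in_noedge: (s0n) => -> _ /=.
  by apply/forall_inP => a as0; apply/eqP/Hc0; rewrite !inE as0 orbT.
have AE := minS _ AS cA A0.
exists c0 => a /bigcupP[s]; rewrite -AE inE => /andP[_ /forall_inP gs] asx.
exact/eqP/gs.
Qed.

Theorem mincycle_rigid S : mincycle S -> generic (@rigid R T (cedge S) (cover S)).
Proof.
have [k] := ubnP #|cover S|; elim: k S => // k IH S /ltnSE leS mS.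
have [cS S0 minS] := mS.
have S3 := card3 cS.
have [s1 s1S] := set0Pn _ S0.
have [u us1] : exists u, u \in s1 by apply/set0Pn; rewrite -card_gt0 S3.
have [v] : exists v, v \in s1 :\ u.
  by apply/set0Pn; rewrite -card_gt0; have := S3 _ s1S; rewrite (cardsD1 u) us1; case: #|_|.
rewrite !inE => /andP[vu vs1].
have uv : u != v by rewrite eq_sym.
have Euv : cedge S u v by apply/cedgeP; split=> //; exists s1; rewrite ?us1.
pose Er (U : {set T}) : rel T := fun a b => [&& cedge S a b, a \in U & b \in U].
have ErU (U : {set T}) a b : Er U a b -> (a \in U) && (b \in U) by case/and3P => _ -> ->.
have piece s : s \in noedge S u v ->
    generic (fun p => forall q : T -> binq R,
      (forall a b, cedge S a b -> bev (q a) (pdir p a b) = bev (q b) (pdir p a b)) ->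
      exists c, forall a, a \in [set u; v] :|: s -> q a = triv c (p a)).
  move=> sn.
  have fin (U : {set T}) : [set u; v] :|: s \subset U -> generic (@rigid R T (Er U) U) ->
    generic (fun p => forall q : T -> binq R,
      (forall a b, cedge S a b -> bev (q a) (pdir p a b) = bev (q b) (pdir p a b)) ->
      exists c, forall a, a \in [set u; v] :|: s -> q a = triv c (p a)).
    move=> /subsetP sU; apply: generic_weaken => p rig q Hq.
    have [a b /and3P[/Hq //]|c Hc] := rig q.
    by exists c => a /sU /Hc.
  (* If the image of [s] survives, it lies in a minimal cycle [M] of the contraction, which has
     fewer vertices because [v] is gone. The induction hypothesis applies to [M], and the two common
     neighbours allow [v] to be split off again. *)
  have [cs|cs] := boolP (contract u v s \in contraction S u v).
    have [M MS [mM sM]] := mincycle_exists (contraction_cycle uv cS) cs.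
    have [cM _ _] := mM.
    have [w1 [w2 [w12 /and3P[w1M w2M uM] /and4P[uw1 uw2 vw1 vw2] /andP[E1 E2] /andP[E3 E4]]]] :=
      common_neighbours uv cS mS Euv MS cM sM.
    have vM : v \notin cover M.
      apply/bigcupP => -[s' /(subsetP MS)/contraction_lift[t _ <-]].
      exact/negP/notin_contract.
    have subM : cover M \subset cover S.
      apply/subsetP => a /bigcupP[s' /(subsetP MS)/contraction_lift[t /in_noedge[tS _] <-]].
      have [-> _|au] := eqVneq a u; first by apply/bigcupP; exists s1.
      have [->|av] := eqVneq a v; first by rewrite (negPf (notin_contract uv t)).
      by rewrite mem_contract // => at'; apply/bigcupP; exists t.
    have ltM : (#|cover M| < k)%N.
      apply: leq_trans leS; apply: proper_card; rewrite properE subM /=; apply/subsetPn; exists v => //.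
      by apply/bigcupP; exists s1.
    apply: (fin (v |: cover M)).
      rewrite !subUset !sub1set !inE uM eqxx orbT /=; apply/subsetP => a asx; rewrite !inE.
      have [//|av] := eqVneq a v; have [->|au] := eqVneq a u; first by rewrite uM.
      by apply/bigcupP; exists (contract u v s); rewrite ?mem_contract.
    have inE' a b : cedge M a b -> [/\ a \in cover M, b \in cover M & exists2 t, t \in noedge S u v & (a \in contract u v t) && (b \in contract u v t)].
      case/cedgeP => _ [s' s'M /andP[as' bs']]; split; try by apply/bigcupP; exists s'.
      by have [t tn E] := contraction_lift (subsetP MS _ s'M); exists t => //; rewrite E as'.
    have toS t x y : t \in noedge S u v -> x \in t -> y \in t -> x != y -> cedge S x y.
      by move=> /in_noedge[tS _] xt yt xy; apply/cedgeP; split=> //; exists t; rewrite ?xt.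
    have uadj b : cedge M u b -> Er (v |: cover M) u b || Er (v |: cover M) v b.
      move=> Eub; have [_ bM [t tn /andP[]]] := inE' _ _ Eub.
      have ub : u != b by case/cedgeP: Eub.
      have bv : b != v by apply: contraNneq vM => <-.
      have bu : b != u by rewrite eq_sym.
      rewrite u_contract mem_contract // => /orP[] xt bt; rewrite /Er !inE eqxx uM bM !orbT /= !andbT.
        by rewrite (toS t).
      by rewrite (toS t v) ?orbT // eq_sym.
    apply: (@rigid_split _ _ (cedge M) _ (cover M) u v w1 w2) => //; try exact: ErU.
    - by rewrite /Er Euv !inE uM eqxx orbT.
    - by rewrite /Er E1 !inE uM w1M !orbT.
    - by rewrite /Er E2 !inE eqxx w1M orbT.
    - by rewrite /Er E3 !inE uM w2M !orbT.
    - by rewrite /Er E4 !inE eqxx w2M orbT.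
    - by move=> a b /inE'[-> ->].
    - move=> a b Eab au bu; have [aM bM [t tn /andP[]]] := inE' _ _ Eab.
      have av : a != v by apply: contraNneq vM => <-.
      have bv : b != v by apply: contraNneq vM => <-.
      rewrite !mem_contract // /Er !inE aM bM !orbT !andbT => ta tb.
      by apply: (toS t) => //; case/cedgeP: Eab.
    - by move=> a; rewrite cedge_sym; exact: uadj.
    - exact: IH.
  (* If the image of [s] cancels, a second triangle [t] has the same image. One of the two contains
     [v], the other [u], and they share the remaining vertices [x], [y]; the piece is then obtained
     by splitting a single triangle [uxy]. *)
  have [t tn [ts ct]] : exists2 t, t \in noedge S u v & t != s /\ contract u v t = contract u v s.
    have : ~~ odd #|[set t in noedge S u v | contract u v t == contract u v s]| by move: cs; rewrite in_set.
    rewrite (cardsD1 s) inE sn eqxx /= negbK => od.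
    have /card_gt0P[t] : (0 < #|[set t in noedge S u v | contract u v t == contract u v s] :\ s|)%N by case: #|_| od.
    by rewrite in_setD1 in_set => /andP[ts /andP[tn /eqP E]]; exists t.
  have main r r' : r \in noedge S u v -> r' \in noedge S u v -> v \in r -> v \notin r' ->
      contract u v r = contract u v r' -> [set u; v] :|: s \subset v |: r' ->
      generic (fun p => forall q : T -> binq R,
      (forall a b, cedge S a b -> bev (q a) (pdir p a b) = bev (q b) (pdir p a b)) ->
      exists c, forall a, a \in [set u; v] :|: s -> q a = triv c (p a)).
    move=> /in_noedge[rS nr] /in_noedge[r'S _] vr vr' cr sub.
    have ur : u \notin r by apply/negP => ur; apply: nr.
    have r'E : r' = u |: (r :\ v) by move: cr; rewrite /contract vr (negPf vr').
    have /eqP/cards2P[x [y [xy rE]]] : #|r :\ v| = 2%N by apply/eqP; have := S3 _ rS; rewrite (cardsD1 v) vr add1n => -[->].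
    have [xr yr] : x \in r :\ v /\ y \in r :\ v by rewrite rE !inE !eqxx orbT.
    move: xr yr; rewrite !inE => /andP[xv xr] /andP[yv yr].
    have ux : u != x by apply: contraNneq ur => ->.
    have uy : u != y by apply: contraNneq ur => ->.
    have r'E' : r' = [set u; x; y] by rewrite r'E rE setUA.
    have toS t' a b : t' \in S -> a \in t' -> b \in t' -> a != b -> cedge S a b.
      by move=> t'S at' bt' ab; apply/cedgeP; split=> //; exists t'; rewrite ?at'.
    have r'u : u \in r' by rewrite r'E' !inE eqxx.
    have r'x : x \in r' by rewrite r'E' !inE eqxx orbT.
    have r'y : y \in r' by rewrite r'E' !inE eqxx orbT.
    apply: (fin (v |: r') sub).
    have ErI a b : cedge S a b -> a \in v |: r' -> b \in v |: r' -> Er (v |: r') a b by rewrite /Er => -> -> ->.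
    apply: (@rigid_split _ _ (fun a b => [&& a != b, a \in r' & b \in r']) _ r' u v x y) => //; try exact: ErU.
    - by apply: ErI => //; rewrite !inE ?r'u ?eqxx ?orbT.
    - by apply: ErI; rewrite ?inE ?r'u ?r'x ?orbT // (toS r').
    - by apply: ErI; rewrite ?inE ?eqxx ?r'x ?orbT // (toS r) // eq_sym.
    - by apply: ErI; rewrite ?inE ?r'u ?r'y ?orbT // (toS r').
    - by apply: ErI; rewrite ?inE ?eqxx ?r'y ?orbT // (toS r) // eq_sym.
    - by move=> a b /and3P[_ -> ->].
    - move=> a b /and3P[ab ar br] au bu; apply: ErI; rewrite ?inE ?ar ?br ?orbT //.
      exact: (toS r').
    - move=> b /and3P[ab ar br]; rewrite ErI ?inE ?ar ?br ?orbT // (toS r') //.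
    - move=> b /and3P[ab ar br]; rewrite ErI ?inE ?ar ?br ?orbT // (toS r') // eq_sym //.
    - by rewrite r'E'; exact: rigid_triangle.
  have sub_contr r : u \in contract u v r -> r \subset v |: contract u v r.
    move=> ucr; apply/subsetP => a ar; rewrite !inE; have [//|av] := eqVneq a v.
    by have [->|au] := eqVneq a u; rewrite ?ucr // mem_contract // ar.
  have [vs|vs] := boolP (v \in s); have [vt|vt] := boolP (v \in t).
  - exfalso; move/negP: ts; apply; move: ct; rewrite /contract vs vt => E; apply/eqP.
    have [_ nt] := in_noedge tn; have [_ ns] := in_noedge sn.
    have ut : u \notin t by apply/negP => ut; apply: nt.
    have us : u \notin s by apply/negP => us; apply: ns.
    have : (u |: t :\ v) :\ u = (u |: s :\ v) :\ u by rewrite E.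
    rewrite !setU1K ?inE ?(negPf ut) ?(negPf us) ?andbF // => E'.
    by rewrite -(setD1K vt) -(setD1K vs) E'.
  - apply: (main s t) => //.
    have tE : t = contract u v s by rewrite -ct /contract (negPf vt).
    have ut : u \in t by rewrite tE u_contract vs orbT.
    rewrite !subUset !sub1set !inE ut eqxx orbT /= tE; apply: sub_contr; by rewrite -tE.
  - apply: (main t s) => //.
    have sE : s = contract u v t by rewrite ct /contract (negPf vs).
    have us : u \in s by rewrite sE u_contract vt orbT.
    by rewrite !subUset !sub1set !inE us eqxx orbT /= subsetUr.
  - by move: ct ts; rewrite /contract (negPf vs) (negPf vt) => ->; rewrite eqxx.
have g1 : generic (fun p : T -> R * R => forall ab : T * T, ab \in enum [set ab : T * T | ab.1 != ab.2] -> p ab.1 != p ab.2).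
  by apply: generic_forall => ab; rewrite mem_enum inE => nab; exact: generic_neq.
have g2 := generic_forall (s := enum (noedge S u v)) (fun s => piece s \o (etrans (esym (mem_enum _ _)))).
apply: generic_weaken (generic_and g1 g2) => p [injp pcs] q Hq.
apply: (@glue_pieces S u v) => //.
- by move=> a b ab; apply: (injp (a, b)); rewrite mem_enum inE.
- by move=> s sn; apply: pcs Hq; rewrite mem_enum.
Qed.

End Fogelsanger.

(** * Monodromy on simply connected sets *)

Section Intervals.
Variable R : realType.

(** Real induction in place of a subdivision argument: the supremum of the points reachable from [a]
    is itself reachable and can be passed unless it is [b]. *)
Lemma interval_chain (a b : R) (P : R -> R -> Prop) : a <= b ->
  (forall t, a <= t <= b -> exists2 d, 0 < d &
     forall s s', a <= s -> s <= s' -> s' <= b -> `|t - s| < d -> `|t - s'| < d -> P s s') ->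
  (forall x y z, a <= x -> x <= y -> y <= z -> z <= b -> P x y -> P y z -> P x z) ->
  P a b.
Proof.
move=> ab loc add.
pose A : classical_sets.set R := fun t => a <= t <= b /\ P a t.
have Aa : A a.
  split; first by rewrite lexx.
  have [d d0 H] := loc a (introT andP (conj (lexx a) ab)).
  by apply: H; rewrite ?lexx // subrr normr0.
have supA : classical_sets.has_sup A by split; [exists a | exists b => t [/andP[]]].
set x := sup A.
have ax : a <= x by apply: sup_upper_bound.
have xb : x <= b by apply: ge_sup => [|t [/andP[]]]; first by exists a.
have [d d0 H] := loc x (introT andP (conj ax xb)).
have [t At xt] := sup_adherent d0 supA; rewrite -/x in xt.
have tx : t <= x by apply: sup_upper_bound.
case: (At) => /andP[a_t tb] Pat.
have [bx|xb'] := lerP b (x + d / 2).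
  apply: (add a t b) => //; apply: H => //; rewrite ltr_norml; apply/andP; split; lra.
have : A (x + d / 2).
  split; first by apply/andP; split; lra.
  apply: (add a t) => //; try lra.
  by apply: H => //; try lra; rewrite ltr_norml; apply/andP; split; lra.
move=> /(sup_upper_bound supA); rewrite -/x; lra.
Qed.

Lemma locally_constant (a b : R) (f : R -> R) : a <= b ->
  (forall t, a <= t <= b -> exists2 d, 0 < d &
     forall t', a <= t' <= b -> `|t - t'| < d -> f t' = f t) ->
  forall t, a <= t <= b -> f t = f a.
Proof.
move=> ab loc t /andP[a_t tb]; apply/esym.
apply: (@interval_chain a t (fun s s' => f s = f s')) => // [s /andP[sa st]|x y z _ _ _ _ -> //].
have [|d d0 H] := loc s; first by rewrite sa (le_trans st).
exists d => // r r' ar rr' r't dr dr'.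
by rewrite (H r) ?(H r') //; apply/andP; split; lra.
Qed.

Section Lifts.
Variables (L : Type) (m : L -> L -> R).

(** A function on the rectangle whose increments are prescribed by [m], but only between each point
    and its neighbours: [m] is additive only locally, so this is a lift to a covering rather than a
    global potential. *)
Definition rect_lift (lab : R -> R -> L) (a a' b b' : R) : Prop :=
  exists u : R -> R -> R, forall s t, a <= s <= a' -> b <= t <= b' ->
    exists2 d, 0 < d & forall s' t', a <= s' <= a' -> b <= t' <= b' ->
      `|s - s'| < d -> `|t - t'| < d -> u s' t' - u s t = m (lab s t) (lab s' t').

Lemma rect_lift_swap lab a a' b b' :
  rect_lift lab a a' b b' -> rect_lift (fun s t => lab t s) b b' a a'.
Proof.
move=> [u Hu]; exists (fun s t => u t s) => s t hs ht.
by have [d d0 H] := Hu t s ht hs; exists d => // s' t' hs' ht' ds dt; apply: H.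
Qed.

(** Along the common side the two lifts differ by a locally constant function, hence by a constant,
    and shifting one of them by it makes them match. *)
Lemma rect_lift_glue lab a a' b c d : a <= a' -> b <= c -> c <= d ->
  rect_lift lab a a' b c -> rect_lift lab a a' c d -> rect_lift lab a a' b d.
Proof.
move=> aa' bc cd [u1 H1] [u2 H2].
have cbc : b <= c <= c by rewrite bc lexx.
have ccd : c <= c <= d by rewrite cd lexx.
pose k := u1 a c - u2 a c.
have Hk s : a <= s <= a' -> u1 s c = u2 s c + k.
  move=> hs; rewrite /k.
  have := @locally_constant a a' (fun s => u1 s c - u2 s c) aa' _ s hs.
  move=> /= E; rewrite -E; first by rewrite addrC subrK.
  move=> t ht; have [d1 d10 K1] := H1 t c ht cbc; have [d2 d20 K2] := H2 t c ht ccd.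
  exists (Num.min d1 d2) => [|t' ht']; first by rewrite lt_min d10.
  rewrite lt_min => /andP[l1 l2].
  have := K1 t' c ht' cbc l1; have := K2 t' c ht' ccd l2; rewrite subrr normr0.
  by move=> /(_ d20) e2 /(_ d10) e1; lra.
exists (fun s t => if t <= c then u1 s t else u2 s t + k) => s t hs /andP[bt td].
have [tc|ct|tc] := ltgtP t c.
- have [|d1 d10 K1] := H1 s t hs; first by rewrite bt ltW.
  exists (Num.min d1 (c - t)) => [|s' t' hs' /andP[bt' t'd]]; first by rewrite lt_min d10 subr_gt0.
  rewrite !lt_min => /andP[l1 _] /andP[l2]; rewrite ltr_norml => /andP[l3 l4].
  have t'c : t' <= c by lra.
  by rewrite t'c; apply: K1 => //; rewrite bt'.
- have [|d2 d20 K2] := H2 s t hs; first by rewrite td ltW.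
  exists (Num.min d2 (t - c)) => [|s' t' hs' /andP[bt' t'd]]; first by rewrite lt_min d20 subr_gt0.
  rewrite !lt_min => /andP[l1 _] /andP[l2]; rewrite ltr_norml => /andP[l3 l4].
  have t'c : c < t' by lra.
  rewrite leNgt t'c /= -K2 //; first by lra.
  by rewrite t'd ltW.
- rewrite tc {t tc bt td}.
  have [d1 d10 K1] := H1 s c hs cbc; have [d2 d20 K2] := H2 s c hs ccd.
  exists (Num.min d1 d2) => [|s' t' hs' /andP[bt' t'd]]; first by rewrite lt_min d10.
  rewrite !lt_min => /andP[l1 l2] /andP[l3 l4].
  have [t'c|ct'] := lerP t' c; first by apply: K1 => //; rewrite bt'.
  rewrite Hk // -K2 //; first by lra.
  by rewrite t'd ltW.
Qed.

Lemma square_lift (lab : R -> R -> L) :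
  (forall s t, unit_int s -> unit_int t -> exists2 d, 0 < d & exists psi : L -> R,
     forall s1 t1 s2 t2, unit_int s1 -> unit_int t1 -> unit_int s2 -> unit_int t2 ->
       `|s - s1| < d -> `|t - t1| < d -> `|s - s2| < d -> `|t - t2| < d ->
       m (lab s1 t1) (lab s2 t2) = psi (lab s2 t2) - psi (lab s1 t1)) ->
  rect_lift lab 0 1 0 1.
Proof.
move=> loc.
apply: (@interval_chain 0 1 (fun s s' => rect_lift lab s s' 0 1)) => // [s hs|x y z x0 xy yz z1 l1 l2].
  suff [d d0 H] : exists2 d, 0 < d & forall s1 s2, 0 <= s1 -> s1 <= s2 -> s2 <= 1 ->
      `|s - s1| < d -> `|s - s2| < d -> rect_lift lab s1 s2 0 1 by exists d.
  (* The width of the strip around [s] belongs to the statement being chained, since each gluing in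
     the second direction may shrink it. *)
  apply: (@interval_chain 0 1 (fun t t' => exists2 d, 0 < d & forall s1 s2, 0 <= s1 -> s1 <= s2 -> s2 <= 1 ->
      `|s - s1| < d -> `|s - s2| < d -> rect_lift lab s1 s2 t t')) => // [t ht|x y z x0 xy yz z1].
    have [d d0 [psi H]] := loc s t hs ht.
    exists d => // t1 t2 t10 t12 t21 l1 l2; exists d => // s1 s2 s10 s12 s21 k1 k2.
    exists (fun s t => psi (lab s t)) => s' t' /andP[hs1 hs2] /andP[ht1 ht2]; exists 1 => //.
    move=> s'' t'' /andP[hs3 hs4] /andP[ht3 ht4] _ _.
    have btw (x x1 x2 y : R) : `|x - x1| < d -> `|x - x2| < d -> x1 <= y -> y <= x2 -> `|x - y| < d.
      by rewrite !ltr_norml => /andP[? ?] /andP[? ?] ? ?; apply/andP; split; lra.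
    rewrite -H // /unit_int; try (by apply/andP; split; lra);
      by first [exact: (btw _ _ _ _ k1 k2) | exact: (btw _ _ _ _ l1 l2)].
  move=> [d1 d10 H1] [d2 d20 H2]; exists (Num.min d1 d2) => [|s1 s2 s10 s12 s21]; first by rewrite lt_min d10.
  rewrite !lt_min => /andP[l1 l2] /andP[l3 l4].
  by apply: (@rect_lift_glue _ _ _ _ y) => //; [exact: H1|exact: H2].
apply: (@rect_lift_swap (fun s t => lab t s)).
by apply: (@rect_lift_glue _ _ _ _ y) => //; apply: rect_lift_swap.
Qed.

End Lifts.
End Intervals.

(** * Transport along paths *)

Section Transport.
Variables (R : realType) (X : 'rV[R]_3 -> Prop) (L : Type) (lab : 'rV[R]_3 -> L) (m : L -> L -> R).
Hypothesis local_potential : forall x, X x -> exists2 e, 0 < e & exists psi : L -> R,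
  forall y z, X y -> X z -> sqdist x y < e -> sqdist x z < e ->
    m (lab y) (lab z) = psi (lab z) - psi (lab y).
Hypothesis scX : simply_connected X.

Definition locally (Q : R -> R -> Prop) : Prop := forall t, unit_int t ->
  exists2 d, 0 < d & forall t', unit_int t' -> `|t - t'| < d -> Q t t'.

Definition path_lift (f : R -> 'rV[R]_3) (u : R -> R) : Prop :=
  locally (fun t t' => u t' - u t = m (lab (f t)) (lab (f t'))).

Lemma unit0 : @unit_int R 0. Proof. by rewrite /unit_int lexx ler01. Qed.
Lemma unit1 : @unit_int R 1. Proof. by rewrite /unit_int lexx ler01. Qed.

Lemma sqdist0 (x : 'rV[R]_3) : sqdist x x = 0.
Proof. by rewrite /sqdist big1 // => k _; rewrite subrr expr0n. Qed.

Lemma jump_self x : X x -> m (lab x) (lab x) = 0.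
Proof.
move=> Xx; have [e e0 [psi H]] := local_potential Xx.
by rewrite H ?subrr // sqdist0.
Qed.

Lemma path_lift_exists f : path_in X f -> exists u, path_lift f u.
Proof.
move=> [cf Xf].
(* A path is treated as a square that is constant in the first variable. *)
have [s t hs ht|u Hu] := @square_lift R L m (fun s t => lab (f t)).
  have [e e0 [psi H]] := local_potential (Xf _ ht).
  have [d d0 K] := cf t ht e e0.
  exists d => //; exists psi => s1 t1 s2 t2 _ h1 _ h2 _ l1 _ l2.
  by apply: H; first [exact: Xf | exact: K].
exists (u 0) => t ht; have [d d0 H] := Hu 0 t unit0 ht.
by exists d => // t' ht' l; apply: H => //; rewrite ?unit0 // subrr normr0.
Qed.

Lemma lift_diff f u u' : path_lift f u -> path_lift f u' -> u 1 - u 0 = u' 1 - u' 0.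
Proof.
move=> Hu Hu'.
have := @locally_constant R 0 1 (fun t => u t - u' t) ler01 _ 1 unit1.
move=> /= E; suff : u 1 - u' 1 = u 0 - u' 0 by lra.
apply: E => t ht; have [d d0 H] := Hu t ht; have [d' d0' H'] := Hu' t ht.
exists (Num.min d d') => [|t' ht']; first by rewrite lt_min d0.
by rewrite lt_min => /andP[/(H _ ht') e1 /(H' _ ht') e2]; lra.
Qed.

(** Lift a contracting homotopy. Three sides of the square are mapped to the base point, and the
    lift is constant there; so it has equal values at the two ends of the fourth side, where it is a
    lift of [f] and differs from [u] by a constant. *)
Lemma loop_lift f u : path_in X f -> f 0 = f 1 -> path_lift f u -> u 0 = u 1.
Proof.
move=> pf f01 Hu; have [_ [_ /(_ f pf f01) [H [cH [XH [H01 Hs]]]]]] := scX.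
have [s t hs ht|U HU] := @square_lift R L m (fun s t => lab (H s t)).
  have [e e0 [psi K]] := local_potential (XH _ _ hs ht).
  have [d d0 C] := cH s t hs ht e e0.
  by exists d => //; exists psi => s1 t1 s2 t2 *; apply: K; first [exact: XH | exact: C].
have X0 : X (f 0) by case: pf => _; apply; exact: unit0.
have lc (g : R -> R) : (forall t, unit_int t -> exists2 d, 0 < d & forall t', unit_int t' -> `|t - t'| < d ->
   g t' - g t = m (lab (f 0)) (lab (f 0))) -> g 1 = g 0.
  move=> Hg; apply: (@locally_constant R 0 1 g ler01 _ 1 unit1) => t ht.
  have [d d0 K] := Hg t ht; exists d => // t' ht' l.
  by have := K t' ht' l; rewrite jump_self // => /eqP; rewrite subr_eq0 => /eqP.
have e1 : U 1 0 = U 0 0.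
  apply: (lc (fun s => U s 0)) => s hs; have [d d0 K] := HU s 0 hs unit0; exists d => // s' hs' l.
  by rewrite (K s' 0) ?unit0 ?subrr ?normr0 //; case: (Hs _ hs) => -> _; case: (Hs _ hs') => ->.
have e2 : U 1 1 = U 0 1.
  apply: (lc (fun s => U s 1)) => s hs; have [d d0 K] := HU s 1 hs unit1; exists d => // s' hs' l.
  by rewrite (K s' 1) ?unit1 ?subrr ?normr0 //; case: (Hs _ hs) => _ ->; case: (Hs _ hs') => _ ->.
have e3 : U 1 1 = U 1 0.
  apply: (lc (fun t => U 1 t)) => t ht; have [d d0 K] := HU 1 t unit1 ht; exists d => // t' ht' l.
  by rewrite (K 1 t') ?unit1 ?subrr ?normr0 //; case: (H01 _ ht) => _ ->; case: (H01 _ ht') => _ ->.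
have HU0 : path_lift f (U 0).
  move=> t ht; have [d d0 K] := HU 0 t unit0 ht; exists d => // t' ht' l.
  by rewrite (K 0 t') ?unit0 ?subrr ?normr0 //; case: (H01 _ ht) => -> _; case: (H01 _ ht') => ->.
by have := lift_diff Hu HU0; lra.
Qed.

Definition transport x y r : Prop := exists f u,
  [/\ path_in X f, f 0 = x, f 1 = y, path_lift f u & u 1 - u 0 = r].

Lemma transport_exists x y : X x -> X y -> exists r, transport x y r.
Proof.
move=> Xx Xy; have [_ [/(_ x y Xx Xy) [f [pf [f0 f1]]] _]] := scX.
by have [u Hu] := path_lift_exists pf; exists (u 1 - u 0), f, u.
Qed.

(** Stated for arbitrary relations so that continuity of a concatenated path and the lifting
    property of its potential are both instances. *)
Lemma locally_cat (Q1 Q2 Q : R -> R -> Prop) : locally Q1 -> locally Q2 ->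
  (forall t t', t <= 1/2 -> t' <= 1/2 -> Q1 (2 * t) (2 * t') -> Q t t') ->
  (forall t t', 1/2 <= t -> 1/2 <= t' -> Q2 (2 * t - 1) (2 * t' - 1) -> Q t t') ->
  locally Q.
Proof.
move=> l1 l2 h1 h2 t /andP[t0 t1].
have [d1 d10 K1] : exists2 d, 0 < d & t <= 1/2 -> forall t', unit_int t' -> t' <= 1/2 -> `|t - t'| < d -> Q t t'.
  have [th|th] := lerP t (1/2); last by exists 1.
  have [|d d0 H] := l1 (2 * t); first by apply/andP; split; lra.
  exists (d / 2) => [|_ t' /andP[t'0 t'1] t'h]; first by lra.
  rewrite ltr_norml => /andP[k1 k2]; apply: h1 => //; apply: H; first by apply/andP; split; lra.
  by rewrite ltr_norml; apply/andP; split; lra.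
have [d2 d20 K2] : exists2 d, 0 < d & 1/2 <= t -> forall t', unit_int t' -> 1/2 <= t' -> `|t - t'| < d -> Q t t'.
  have [th|th] := lerP (1/2) t; last by exists 1.
  have [|d d0 H] := l2 (2 * t - 1); first by apply/andP; split; lra.
  exists (d / 2) => [|_ t' /andP[t'0 t'1] t'h]; first by lra.
  rewrite ltr_norml => /andP[k1 k2]; apply: h2 => //; apply: H; first by apply/andP; split; lra.
  by rewrite ltr_norml; apply/andP; split; lra.
have [d3 d30 K3] : exists2 d, 0 < d & forall t', `|t - t'| < d -> (t <= 1/2 /\ t' <= 1/2) \/ (1/2 <= t /\ 1/2 <= t').
  have [th|th|th] := ltgtP t (1/2).
  - exists (1/2 - t) => [|t']; first by lra.
    by rewrite ltr_norml => /andP[k1 k2]; left; lra.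
  - exists (t - 1/2) => [|t']; first by lra.
    by rewrite ltr_norml => /andP[k1 k2]; right; lra.
  - by exists 1 => // t' _; have [?|?] := lerP t' (1/2); [left|right]; split=> //; lra.
exists (Num.min (Num.min d1 d2) d3) => [|t' ht']; first by rewrite !lt_min d10 d20.
rewrite !lt_min => /andP[/andP[k1 k2] k3].
by have [[a b]|[a b]] := K3 _ k3; [apply: K1|apply: K2].
Qed.

Lemma transport_cat x y z r r' : transport x y r -> transport y z r' -> transport x z (r + r').
Proof.
move=> [f [u [[cf Xf] f0 f1 Hu ur]]] [g [w [[cg Xg] g0 g1 Hw wr]]].
pose h t := if t <= 1/2 then f (2 * t) else g (2 * t - 1).
pose v t := if t <= 1/2 then u (2 * t) else w (2 * t - 1) + (u 1 - w 0).
have hf t : t <= 1/2 -> h t = f (2 * t) by rewrite /h => ->.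
have hg t : 1/2 <= t -> h t = g (2 * t - 1).
  rewrite /h le_eqVlt => /orP[/eqP <-|]; last by rewrite ltNge => /negPf ->.
  by rewrite lexx (_ : 2 * (1/2) = 1) ?subrr ?f1 ?g0 //; lra.
have vu t : t <= 1/2 -> v t = u (2 * t) by rewrite /v => ->.
have vw t : 1/2 <= t -> v t = w (2 * t - 1) + (u 1 - w 0).
  rewrite /v le_eqVlt => /orP[/eqP <-|]; last by rewrite ltNge => /negPf ->.
  by rewrite lexx (_ : 2 * (1/2) = 1) ?subrr; lra.
have h12 : (1/2 : R) <= 1 by lra.
have h02 : (0 : R) <= 1/2 by lra.
exists h, v; split.
- split.
    have := @locally_cat; move=> cat t ht e e0; move: t ht.
    apply: (cat _ _ (fun t t' => sqdist (h t) (h t') < e) (fun t ht => cf t ht e e0) (fun t ht => cg t ht e e0)).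
      by move=> t t' l l'; rewrite !hf.
    by move=> t t' l l'; rewrite !hg.
  move=> t /andP[t0 t1]; have [l|l] := lerP t (1/2).
    by rewrite hf //; apply: Xf; apply/andP; split; lra.
  by rewrite hg ?ltW //; apply: Xg; apply/andP; split; lra.
- by rewrite hf // mulr0.
- by rewrite hg // (_ : 2 * 1 - 1 = 1) //; lra.
- apply: (locally_cat Hu Hw) => t t' l l'; first by rewrite !hf // !vu.
  by rewrite !hg // !vw // => <-; lra.
- rewrite (vu 0) // (vw 1) // mulr0 (_ : 2 * 1 - 1 = 1); lra.
Qed.

Lemma locally_rev (Q : R -> R -> Prop) : locally Q -> locally (fun t t' => Q (1 - t) (1 - t')).
Proof.
move=> H t /andP[t0 t1]; have [|d d0 K] := H (1 - t); first by apply/andP; split; lra.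
exists d => // t' /andP[t'0 t'1] l; apply: K; first by apply/andP; split; lra.
by rewrite (_ : _ - _ = - (t - t')) ?normrN //; lra.
Qed.

Lemma transport_rev x y r : transport x y r -> transport y x (- r).
Proof.
move=> [f [u [[cf Xf] f0 f1 Hu ur]]]; exists (fun t => f (1 - t)), (fun t => u (1 - t)); split.
- split; last by move=> t /andP[t0 t1]; apply: Xf; apply/andP; split; lra.
  move=> t ht e e0; move: t ht; exact: (locally_rev (fun t ht => cf t ht e e0)).
- by rewrite subr0.
- by rewrite subrr.
- exact: (locally_rev Hu).
- rewrite subr0 subrr; lra.
Qed.

Lemma transport_unique x y r r' : transport x y r -> transport x y r' -> r = r'.
Proof.
move=> t1 /transport_rev t2; have [f [u [pf f0 f1 Hu ur]]] := transport_cat t1 t2.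
by have := loop_lift pf (etrans f0 (esym f1)) Hu; lra.
Qed.

End Transport.

(** * Geometry of simplicial fans *)

Section Det3.
Definition k0 : 'I_3 := ord0.
Definition k1 : 'I_3 := lift ord0 ord0.
Definition k2 : 'I_3 := lift ord0 (lift ord0 ord0).

Definition det3 (A : comNzRingType) (f g h : 'I_3 -> A) : A :=
  f k0 * (g k1 * h k2 - g k2 * h k1) - f k1 * (g k0 * h k2 - g k2 * h k0)
  + f k2 * (g k0 * h k1 - g k1 * h k0).

Lemma sum3 (A : zmodType) (F : 'I_3 -> A) : \sum_k F k = F k0 + F k1 + F k2.
Proof. by rewrite !big_ord_recl big_ord0 addr0 addrA. Qed.

Lemma ord3P (P : 'I_3 -> Prop) : P k0 -> P k1 -> P k2 -> forall k, P k.
Proof.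
move=> h0 h1 h2 [[|[|[|//]]] i].
- by rewrite (_ : Ordinal i = k0) //; exact: val_inj.
- by rewrite (_ : Ordinal i = k1) //; exact: val_inj.
- by rewrite (_ : Ordinal i = k2) //; exact: val_inj.
Qed.

Lemma det_mx33 (A : comNzRingType) (f g h : 'I_3 -> A) :
  \det (\matrix_(r < 3, k < 3)
    (if r == 0 :> nat then f k else if r == 1%N :> nat then g k else h k)) = det3 f g h.
Proof.
rewrite (expand_det_row _ ord0) !big_ord_recl big_ord0 /= /cofactor.
rewrite !(expand_det_row _ ord0) !big_ord_recl !big_ord0 /= /cofactor !det_mx11 !mxE /=.
rewrite !addr0 !expr0 /= -[0%R]/ord0 -/k2 -/k1.
rewrite (_ : lift ord0 (lift (lift ord0 ord0) ord0) = k1); last exact: val_inj.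
rewrite (_ : lift k1 ord0 = k0); last exact: val_inj.
rewrite (_ : lift k1 (lift ord0 ord0) = k2); last exact: val_inj.
rewrite (_ : lift k1 (lift (lift ord0 ord0) ord0) = k0); last exact: val_inj.
rewrite (_ : lift k2 ord0 = k0); last exact: val_inj.
rewrite (_ : lift k2 (lift ord0 ord0) = k1); last exact: val_inj.
rewrite (_ : lift k2 (lift (lift ord0 ord0) ord0) = k0); last exact: val_inj.
by rewrite /det3 /bump /= !add0n !expr1 expr2; ring.
Qed.

End Det3.

Section FanGeometry.
Variables (R : realType) (n : nat) (V : 'M[R]_(n, 3)) (F : {set {set 'I_n}}).
Implicit Types (a b c d : 'I_n) (s t A B : {set 'I_n}) (x y : 'rV[R]_3).

Definition vdet a b c : R := det3 (V a) (V b) (V c).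

Lemma vdet_swap12 a b c : vdet b a c = - vdet a b c. Proof. rewrite /vdet /det3; ring. Qed.
Lemma vdet_swap23 a b c : vdet a c b = - vdet a b c. Proof. rewrite /vdet /det3; ring. Qed.

Lemma card3_set s : #|s| = 3%N ->
  exists a b c, [/\ a != b, a != c, b != c & s = [set a; b; c]].
Proof.
move=> s3; have [a sa] : exists a, a \in s by apply/set0Pn; rewrite -card_gt0 s3.
have /eqP/cards2P[b [c [bc sE]]] : #|s :\ a| = 2%N.
  by apply/eqP; move: s3; rewrite (cardsD1 a) sa add1n => -[->].
have : b \in s :\ a by rewrite sE !inE eqxx.
have : c \in s :\ a by rewrite sE !inE eqxx orbT.
rewrite !inE => /andP[ca _] /andP[ba _].
by exists a, b, c; split; [rewrite eq_sym|rewrite eq_sym| |rewrite -(setD1K sa) sE setUA].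
Qed.

Lemma sum_set3 (M : zmodType) (f : 'I_n -> M) a b c : a != b -> a != c -> b != c ->
  (forall i, i \notin [set a; b; c] -> f i = 0) -> \sum_i f i = f a + f b + f c.
Proof.
move=> ab ac bc f0; rewrite (bigD1 a) //= (bigD1 b) 1?eq_sym //= (bigD1 c) /=; last by rewrite !(eq_sym c) ac bc.
rewrite big1 ?addr0 ?addrA // => i /andP[/andP[ia ib] ic]; apply: f0.
by rewrite !inE (negPf ia) (negPf ib) (negPf ic).
Qed.

Lemma pos_hull3 a b c x : a != b -> a != c -> b != c ->
  pos_hull V [set a; b; c] x <-> exists al be ga,
    [/\ 0 <= al, 0 <= be, 0 <= ga & x = al *: row a V + be *: row b V + ga *: row c V].
Proof.
move=> ab ac bc; split=> [[f [f0 [fz ->]]]|[al [be [ga [h1 h2 h3 ->]]]]].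
  exists (f a), (f b), (f c); split=> //; apply: sum_set3 => // i /fz ->.
  by rewrite scale0r.
exists (fun i => if i == a then al else if i == b then be else if i == c then ga else 0); split.
  by move=> i; do 3!case: ifP => // _.
split.
  by move=> i; rewrite !inE !negb_or => /andP[/andP[/negPf -> /negPf ->] /negPf ->].
rewrite (@sum_set3 _ _ a b c) // ?eqxx 1?(eq_sym b) ?(negPf ab) ?(eq_sym c) ?(negPf ac) ?(negPf bc) //.
by move=> i; rewrite !inE !negb_or => /andP[/andP[/negPf -> /negPf ->] /negPf ->]; rewrite scale0r.
Qed.

Lemma cramer a b c x : vdet a b c *: x =
  det3 (x 0) (V b) (V c) *: row a V + det3 (V a) (x 0) (V c) *: row b V + det3 (V a) (V b) (x 0) *: row c V.
Proof.
apply/rowP; elim/ord3P; rewrite !mxE /vdet /det3; ring.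
Qed.

Lemma indep_det a b c : a != b -> a != c -> b != c -> lin_indep V [set a; b; c] -> vdet a b c != 0.
Proof.
move=> ab ac bc indep; apply/negP => /eqP D0.
pose M : 'M[R]_3 := \matrix_(r < 3, k < 3)
    (if r == 0 :> nat then V a k else if r == 1%N :> nat then V b k else V c k).
have /eqP/det0P[v v0 vM] : \det M = 0 by rewrite det_mx33.
pose f i := if i == a then v 0 k0 else if i == b then v 0 k1 else if i == c then v 0 k2 else 0.
have fz i : i \notin [set a; b; c] -> f i = 0.
  by rewrite /f !inE !negb_or => /andP[/andP[/negPf -> /negPf ->] /negPf ->].
have fa : f a = v 0 k0 by rewrite /f eqxx.
have fb : f b = v 0 k1 by rewrite /f eq_sym (negPf ab) eqxx.
have fc : f c = v 0 k2 by rewrite /f eq_sym (negPf ac) eq_sym (negPf bc) eqxx.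
have f0 : forall i, f i = 0.
  apply: indep => //; rewrite (@sum_set3 _ _ a b c) // => [|i /fz ->]; last by rewrite scale0r.
  apply/rowP => k; move/rowP: vM => /(_ k); rewrite !mxE sum3 !mxE /= => <-.
  by rewrite fa fb fc.
move/negP: v0; apply; apply/eqP/rowP; elim/ord3P; rewrite mxE; by [rewrite -fa|rewrite -fb|rewrite -fc].
Qed.

Hypothesis fanF : is_simplicial_fan3 V F.

Lemma facet_cone s : s \in F -> is_cone F s.
Proof. by move=> sF; apply/exists_inP; exists s. Qed.

Lemma facetP s : s \in F -> exists a b c,
  [/\ a != b, a != c, b != c, s = [set a; b; c] & vdet a b c != 0].
Proof.
move=> sF; have [/(_ s sF) [s3 ind] _] := fanF.
have [a [b [c [ab ac bc sE]]]] := card3_set s3; exists a, b, c; split=> //.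
by apply: indep_det => //; rewrite -sE.
Qed.

Lemma facet_det a b c : [set a; b; c] \in F -> a != b -> a != c -> b != c -> vdet a b c != 0.
Proof. by move=> sF ab ac bc; apply: indep_det => //; have [/(_ _ sF) []] := fanF. Qed.

Lemma facet_split s a b : s \in F -> a \in s -> b \in s -> a != b ->
  exists c, [/\ a != c, b != c, s = [set a; b; c] & vdet a b c != 0].
Proof.
move=> sF sa sb ab; have [/(_ s sF) [s3 ind] _] := fanF.
have /eqP/cards1P[c sc] : #|s :\ a :\ b| = 1%N.
  by apply/eqP; move: s3; rewrite (cardsD1 a) sa (cardsD1 b) !inE eq_sym ab sb !add1n => -[->].
have : c \in s :\ a :\ b by rewrite sc inE.
rewrite !inE => /and3P[cb ca _].
have sE : s = [set a; b; c].
  by rewrite -setUA -sc setD1K ?setD1K // !inE eq_sym ab.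
have ac : a != c by rewrite eq_sym.
have bc : b != c by rewrite eq_sym.
by exists c; split=> //; apply: facet_det; rewrite -?sE.
Qed.

Lemma set3_inj a b c d : c != a -> c != b -> [set a; b; c] = [set a; b; d] -> c = d.
Proof.
move=> ca cb /setP/(_ c); rewrite !inE eqxx orbT (negPf ca) (negPf cb) /=.
by move/esym/eqP.
Qed.

(** If [c] and [d] were on the same side of the plane through [a] and [b], a small push from
    [v_a + v_b] towards [v_c] would stay in both cones. By the fan property the resulting point
    would lie in the intersection, where the coefficient of [c] is zero, against independence. *)
Lemma opposite_sides a b c d : [set a; b; c] \in F -> [set a; b; d] \in F ->
  a != b -> a != c -> b != c -> a != d -> b != d -> c != d -> vdet a b c * vdet a b d < 0.
Proof.
move=> s1F s2F ab ac bc ad bd cd.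
have D1 := facet_det s1F ab ac bc; have D2 := facet_det s2F ab ad bd.
rewrite ltNge; apply/negP => pos.
have {}pos : 0 < vdet a b c * vdet a b d by rewrite lt_neqAle pos eq_sym mulf_neq0.
pose D := vdet a b d.
pose al := det3 (V c) (V b) (V d) / D; pose be := det3 (V a) (V c) (V d) / D; pose ga := vdet a b c / D.
have ga0 : 0 < ga.
  rewrite /ga /D; have -> : vdet a b c / vdet a b d = vdet a b c * vdet a b d * (vdet a b d)^-1 ^+ 2.
    by field.
  by rewrite mulr_gt0 // exprn_even_gt0 // invr_eq0.
have cE : row c V = al *: row a V + be *: row b V + ga *: row d V.
  have := cramer a b d (row c V); rewrite -/D => E.
  have E' : row c V = D^-1 *: (D *: row c V) by rewrite scalerA mulVf ?scale1r.
  rewrite E' E !scalerDr !scalerA /al /be /ga.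
  have -> : det3 ((row c V) 0) (V b) (V d) = det3 (V c) (V b) (V d) by rewrite /det3 !mxE.
  have -> : det3 (V a) ((row c V) 0) (V d) = det3 (V a) (V c) (V d) by rewrite /det3 !mxE.
  have -> : det3 (V a) (V b) ((row c V) 0) = vdet a b c by rewrite /vdet /det3 !mxE.
  by rewrite !(mulrC D^-1).
(* Small enough that [1 + e * al] and [1 + e * be] remain nonnegative. *)
pose e := (1 + `|al| + `|be|)^-1.
have K0 : 0 < 1 + `|al| + `|be| by have := normr_ge0 al; have := normr_ge0 be; lra.
have e0 : 0 < e by rewrite invr_gt0.
have eK : e * (1 + `|al| + `|be|) = 1 by rewrite mulVf // gt_eqF.
have bnd (z : R) : `|z| <= `|al| + `|be| -> 0 <= 1 + e * z.
  move=> zl; have : - (e * `|z|) <= e * z by rewrite -mulrN ler_pM2l //; have := ler_norm (- z); rewrite normrN; lra.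
  have : e * `|z| <= e * (`|al| + `|be|) by rewrite ler_pM2l.
  by move: eK; nra.
pose x := row a V + row b V + e *: row c V.
have x1 : pos_hull V [set a; b; c] x.
  by apply/pos_hull3 => //; exists 1, 1, e; split; rewrite ?scale1r // ltW.
have x2 : pos_hull V [set a; b; d] x.
  apply/pos_hull3 => //; exists (1 + e * al), (1 + e * be), (e * ga); split.
  - by apply: bnd; have := normr_ge0 be; lra.
  - by apply: bnd; have := normr_ge0 al; lra.
  - by rewrite mulr_ge0 // ltW.
  rewrite /x cE; apply/rowP => k; rewrite !mxE; ring.
have [_ /(_ _ _ (facet_cone s1F) (facet_cone s2F) x)[+ _]] := fanF.
move=> /(_ (conj x1 x2)) [f [f0 [fz xE]]].
have [/(_ _ s1F)[_ ind] _] := fanF.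
pose h i := (if i == a then 1 else if i == b then 1 else if i == c then e else 0) - f i.
have fc : f c = 0.
  apply: fz; rewrite !inE eqxx orbT /= (eq_sym c a) (negPf ac) (eq_sym c b) (negPf bc) /= //.
have hz i : i \notin [set a; b; c] -> h i = 0.
  move=> ni; rewrite /h fz; last by rewrite inE (negPf ni).
  by move: ni; rewrite !inE !negb_or => /andP[/andP[/negPf -> /negPf ->] /negPf ->]; rewrite subrr.
have : h c = 0.
  apply: ind => //; rewrite (@sum_set3 _ _ a b c) // => [|i /hz ->]; last by rewrite scale0r.
  have : x - \sum_i f i *: row i V = 0 by rewrite xE subrr.
  rewrite (@sum_set3 _ _ a b c) // => [<-|i ni]; last by rewrite fz ?scale0r // inE (negPf ni).
  rewrite /h eqxx (eq_sym b) (negPf ab) eqxx (eq_sym c a) (negPf ac) (eq_sym c b) (negPf bc) eqxx /x.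
  by apply/rowP => k; rewrite !mxE; ring.
rewrite /h (eq_sym c a) (negPf ac) (eq_sym c b) (negPf bc) eqxx fc subr0 => ez.
by rewrite ez ltxx in e0.
Qed.

End FanGeometry.

(** * Potentials on the facets of a fan *)

Section Continuity.
Variable R : realType.

Definition cont1 (h : R -> R) : Prop := forall t, unit_int t -> forall e, 0 < e ->
  exists2 d, 0 < d & forall t', unit_int t' -> `|t - t'| < d -> `|h t - h t'| < e.

Lemma cont1_cst (c : R) : cont1 (fun _ => c).
Proof. by move=> t ht e e0; exists 1 => // t' _ _; rewrite subrr normr0. Qed.

Lemma cont1_id : cont1 id.
Proof. by move=> t ht e e0; exists e. Qed.

Lemma cont1_add h g : cont1 h -> cont1 g -> cont1 (fun t => h t + g t).
Proof.
move=> ch cg t ht e e0; have e20 : 0 < e / 2 by lra.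
have [d1 d10 H1] := ch t ht _ e20; have [d2 d20 H2] := cg t ht _ e20.
exists (Num.min d1 d2) => [|t' ht']; first by rewrite lt_min d10.
rewrite lt_min => /andP[/(H1 _ ht') l1 /(H2 _ ht') l2].
rewrite (_ : _ - _ = (h t - h t') + (g t - g t')); last by ring.
by apply: le_lt_trans (ler_normD _ _) _; lra.
Qed.

Lemma cont1_mul h g : cont1 h -> cont1 g -> cont1 (fun t => h t * g t).
Proof.
move=> ch cg t ht e e0.
have hn := normr_ge0 (h t); have gn := normr_ge0 (g t).
set K := `|h t| + `|g t| + 1.
have K0 : 0 < K by rewrite /K; lra.
pose eta := Num.min 1 (e / K).
have eta0 : 0 < eta by rewrite lt_min ltr01 divr_gt0.
have etae : eta * K <= e by rewrite -ler_pdivlMr // ge_min lexx orbT.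
have eta1 : eta <= 1 by rewrite ge_min lexx.
have [d1 d10 H1] := ch t ht _ eta0; have [d2 d20 H2] := cg t ht _ eta0.
exists (Num.min d1 d2) => [|t' ht']; first by rewrite lt_min d10.
rewrite lt_min => /andP[/(H1 _ ht') l1 /(H2 _ ht') l2].
rewrite (_ : _ - _ = h t * (g t - g t') + g t' * (h t - h t')); last by ring.
apply: le_lt_trans (ler_normD _ _) _; rewrite !normrM.
have g't : `|g t'| <= `|g t| + 1.
  rewrite (_ : g t' = g t - (g t - g t')); last by ring.
  by apply: le_trans (ler_normB _ _) _; lra.
have := normr_ge0 (h t - h t'); have := normr_ge0 (g t - g t'); have := normr_ge0 (g t').
move: l1 l2 etae; rewrite /K; set A := `|h t - _|; set B := `|g t - _|; move=> *.
have : `|h t| * B <= `|h t| * eta by apply: ler_wpM2l => //; lra.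
have : `|g t'| * A <= (`|g t| + 1) * A by apply: ler_wpM2r.
have : (`|g t| + 1) * A < (`|g t| + 1) * eta by rewrite ltr_pM2l //; lra.
by lra.
Qed.

Lemma cont1_inv h : cont1 h -> (forall t, unit_int t -> 0 < h t) -> cont1 (fun t => (h t)^-1).
Proof.
move=> ch h0 t ht e e0; have hp := h0 t ht.
pose eta := Num.min (h t / 2) (e * h t ^+ 2 / 2).
have eta0 : 0 < eta by rewrite lt_min !divr_gt0 // mulr_gt0 // exprn_gt0.
have [d d0 H] := ch t ht _ eta0; exists d => // t' ht' /(H _ ht').
rewrite lt_min => /andP[l1 l2]; have hp' := h0 t' ht'.
have h2 : h t / 2 < h t' by move: l1; rewrite ltr_norml => /andP[]; lra.
rewrite (_ : _ - _ = (h t' - h t) / (h t * h t')); last by field; rewrite !gt_eqF.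
rewrite normrM normfV (ger0_norm (ltW (mulr_gt0 hp hp'))) ltr_pdivrMr ?mulr_gt0 // distrC.
apply: lt_le_trans l2 _; rewrite expr2 -!mulrA ler_pM2l // ler_pM2l //; lra.
Qed.

Lemma cont1_sqrt h : cont1 h -> (forall t, unit_int t -> 0 < h t) -> cont1 (fun t => Num.sqrt (h t)).
Proof.
move=> ch h0 t ht e e0; have hp := h0 t ht.
have sp : 0 < Num.sqrt (h t) by rewrite sqrtr_gt0.
have es0 : 0 < e * Num.sqrt (h t) by rewrite mulr_gt0.
have [d d0 H] := ch t ht _ es0; exists d => // t' ht' /(H _ ht') l; have hp' := h0 t' ht'.
have sp' : 0 < Num.sqrt (h t') by rewrite sqrtr_gt0.
rewrite -(ltr_pM2r (_ : 0 < Num.sqrt (h t) + Num.sqrt (h t'))); last by rewrite addr_gt0.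
rewrite -{1}(ger0_norm (ltW (addr_gt0 sp sp'))) -normrM.
rewrite (_ : _ * _ = h t - h t'); last first.
  by rewrite -subr_sqr !sqr_sqrtr // ltW.
apply: lt_le_trans l _; rewrite ler_pM2l //; lra.
Qed.

Lemma cont_path_coord (f : R -> 'rV[R]_3) : (forall k, cont1 (fun t => f t ord0 k)) -> cont_path f.
Proof.
move=> cf t ht e e0.
pose eta := Num.min 1 (e / 4).
have eta0 : 0 < eta by rewrite lt_min ltr01 divr_gt0.
have eta1 : eta <= 1 by rewrite ge_min lexx.
have etae : eta <= e / 4 by rewrite ge_min lexx orbT.
have [d0 d00 H0] := cf k0 t ht _ eta0; have [d1 d10 H1] := cf k1 t ht _ eta0.
have [d2 d20 H2] := cf k2 t ht _ eta0.
exists (Num.min (Num.min d0 d1) d2) => [|t' ht']; first by rewrite !lt_min d00 d10.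
rewrite !lt_min => /andP[/andP[/(H0 _ ht') l0 /(H1 _ ht') l1] /(H2 _ ht') l2].
have sq (z : R) : `|z| < eta -> z ^+ 2 <= eta.
  move=> lz; rewrite -real_normK ?num_real // expr2; have := normr_ge0 z.
  by move=> z0; apply: le_trans (ler_pM z0 z0 (ltW lz) (ltW lz)) _; rewrite -[leRHS]mulr1 ler_pM2l.
rewrite /sqdist sum3; have := sq _ l0; have := sq _ l1; have := sq _ l2; lra.
Qed.

End Continuity.

(** * Orientation signs and potentials around one ray *)

Section Orientation.
Variables (R : realType) (n : nat) (V : 'M[R]_(n, 3)) (F : {set {set 'I_n}}).
Implicit Types (a b c d : 'I_n) (s t : {set 'I_n}).

(** The incidence number of the facet [s] with the oriented edge from [a] to [b]. For a facet
    through [a] and [b] the sum has a single term, its third ray; writing a sum avoids choosing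
    it. *)
Definition orient a b s : R := \sum_(c in s :\ a :\ b) Num.sg (vdet V a b c).

Lemma orient3 a b c : a != c -> b != c -> orient a b [set a; b; c] = Num.sg (vdet V a b c).
Proof.
move=> ac bc; rewrite /orient (_ : _ :\ a :\ b = [set c]) ?big_set1 //.
apply/setP => i; rewrite !inE; case: (eqVneq i b) => [->|ib] /=; first by rewrite (negPf bc).
by case: (eqVneq i a) => [->|ia] /=; rewrite ?(negPf ac).
Qed.

Lemma orient_antisym a b s : orient b a s = - orient a b s.
Proof.
rewrite /orient -sumrN; apply: eq_big => [c|c _]; first by rewrite !inE andbCA.
by rewrite vdet_swap12 sgrN.
Qed.

Lemma orient_cycle a b c : a != b -> a != c -> b != c ->
  orient a b [set a; b; c] = - orient a c [set a; b; c].
Proof.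
move=> ab ac bc; rewrite orient3 // setUAC orient3 //; last by rewrite eq_sym.
by rewrite (vdet_swap23 V a b c) sgrN opprK.
Qed.

Hypothesis fanF : is_simplicial_fan3 V F.

Lemma orient_sqr s a b : s \in F -> a \in s -> b \in s -> a != b -> orient a b s ^+ 2 = 1.
Proof.
move=> sF sa sb ab; have [c [ac bc -> D]] := facet_split fanF sF sa sb ab.
by rewrite orient3 // sqr_sg D.
Qed.

Lemma two_facets_int s s' a b : s \in F -> s' \in F -> s != s' -> a != b ->
  a \in s -> b \in s -> a \in s' -> b \in s' -> int_2face F [set a; b].
Proof.
move=> sF s'F ss' ab sa sb s'a s'b; rewrite /int_2face /bd_2face.
have -> : is_cone F [set a; b] by apply/exists_inP; exists s; rewrite // set2_sub sa.
rewrite cards2 ab /= /nfacets; apply/negP => /cards1P[r /setP E].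
have := E s; have := E s'; rewrite !inE sF s'F !set2_sub sa sb s'a s'b /= => /esym/eqP e1 /esym/eqP e2.
by rewrite e1 e2 eqxx in ss'.
Qed.

(** A cone on two rays that is not on the boundary has at least two facets. Third rays of distinct
    facets lie on opposite sides of its plane, so a third facet is impossible and the two signs are
    opposite. *)
Lemma int_edge a b : int_2face F [set a; b] -> a != b /\ exists s1 s2,
  [/\ [/\ s1 \in F, a \in s1 & b \in s1], [/\ s2 \in F, a \in s2 & b \in s2], s1 != s2,
      (forall s, s \in F -> a \in s -> b \in s -> s = s1 \/ s = s2) &
      orient a b s2 = - orient a b s1 /\ orient a b s1 ^+ 2 = 1].
Proof.
case/andP => /andP[cone c2] nbd.
have ab : a != b by move: c2; rewrite cards2; case: (a != b).
split=> //; move: nbd; rewrite /bd_2face cone c2 /= => n1.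
case/exists_inP: cone => s1 s1F; rewrite set2_sub => /andP[s1a s1b].
have [s2 [s2F s12 s2a s2b]] : exists s2, [/\ s2 \in F, s1 != s2, a \in s2 & b \in s2].
  have : (0 < #|[set s in F | [set a; b] \subset s] :\ s1|)%N.
    rewrite lt0n; apply: contra n1 => /eqP c0.
    by rewrite /nfacets (cardsD1 s1) c0 inE s1F set2_sub s1a s1b.
  case/card_gt0P => s2; rewrite !inE set2_sub eq_sym => /and3P[s12 s2F /andP[s2a s2b]].
  by exists s2.
have [c [ac bc s1E D1]] := facet_split fanF s1F s1a s1b ab.
have opp s : s \in F -> a \in s -> b \in s -> s != s1 -> exists d, s = [set a; b; d] /\ vdet V a b c * vdet V a b d < 0.
  move=> sF sa sb ss1; have [d [ad bd sE D]] := facet_split fanF sF sa sb ab.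
  exists d; split=> //; apply: (opposite_sides fanF) => //; rewrite -?s1E -?sE //.
  by apply: contraNneq ss1 => cd; rewrite sE s1E cd.
have [d [s2E D12]] := opp _ s2F s2a s2b (contra_neq esym s12).
exists s1, s2; split=> //.
  move=> s sF sa sb; have [->|ss1] := eqVneq s s1; [by left|right].
  have [e [sE D1e]] := opp _ sF sa sb ss1.
  have [//|ss2] := eqVneq s s2; exfalso.
  have ade : [/\ a != d, b != d, a != e & b != e].
    have [d' [ad' bd' E' _]] := facet_split fanF s2F s2a s2b ab.
    have [e' [ae' be' E'' _]] := facet_split fanF sF sa sb ab.
    have -> : d = d' by apply/esym/(@set3_inj _ a b); rewrite -?E' // eq_sym.
    by have -> : e = e' by apply/esym/(@set3_inj _ a b); rewrite -?E'' // eq_sym.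
  case: ade => ad bd ae be.
  have : vdet V a b d * vdet V a b e < 0.
    apply: (opposite_sides fanF) => //; rewrite -?s2E -?sE //.
    by apply: contraNneq ss2 => de; rewrite sE s2E de.
  have : 0 < vdet V a b c ^+ 2 by rewrite exprn_even_gt0.
  by move: D12 D1e; set x := vdet V a b c; set y := vdet V a b d; set z := vdet V a b e; nra.
split; last exact: orient_sqr.
have [d' [ad bd E' D2]] := facet_split fanF s2F s2a s2b ab.
have dd' : d = d' by apply/esym/(@set3_inj _ a b); rewrite -?E' // eq_sym.
rewrite s1E s2E !orient3 // ?dd' //; move: D12; rewrite dd'.
have [p|m|//] := ltrgtP 0 (vdet V a b c); last by move=> z; rewrite -z eqxx in D1.
  by rewrite pmulr_rlt0 // => m; rewrite (gtr0_sg p) (ltr0_sg m).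
by rewrite nmulr_rlt0 // => p; rewrite (ltr0_sg m) (gtr0_sg p) opprK.
Qed.

Lemma sum_int_edge (M : lmodType R) a b s1 s2 (f : {set 'I_n} -> M) :
  s1 \in F -> a \in s1 -> b \in s1 -> s2 \in F -> a \in s2 -> b \in s2 -> s1 != s2 ->
  (forall s, s \in F -> a \in s -> b \in s -> s = s1 \/ s = s2) -> orient a b s2 = - orient a b s1 ->
  \sum_(s in F | (a \in s) && (b \in s)) orient a b s *: f s = orient a b s1 *: (f s1 - f s2).
Proof.
move=> s1F s1a s1b s2F s2a s2b s12 only o2.
rewrite (bigD1 s1) /=; last by rewrite s1F s1a s1b.
rewrite (bigD1 s2) /=; last by rewrite s2F s2a s2b eq_sym.
rewrite big1 ?addr0; first by rewrite o2 scaleNr scalerBr.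
move=> s /andP[/andP[/andP[sF /andP[sa sb]] n1] n2].
by case: (only s sF sa sb) => E; move: n1 n2; rewrite E eqxx.
Qed.

Hypothesis herF : hereditary F.

Lemma star_constant (K : eqType) (psi : {set 'I_n}) (f : {set 'I_n} -> K) s s' :
  is_cone F psi -> s \in F -> s' \in F -> psi \subset s -> psi \subset s' ->
  (forall r r', r \in F -> r' \in F -> psi \subset r -> psi \subset r' -> #|r :&: r'| = 2%N -> f r = f r') ->
  f s = f s'.
Proof.
move=> cpsi sF s'F ps ps' adj.
case/connectP: (herF cpsi sF s'F ps ps') => p; elim: p s sF ps => [|r p IH] s sF ps /=; first by move=> _ ->.
case/andP => /and5P[_ rF _ pr /eqP c2] pth lst.
by rewrite (adj s r) // IH.
Qed.

Definition interior_ray a : bool := is_cone F [set a] && ~~ in_boundary F [set a].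

Lemma facet_edge_interior a b s : interior_ray a -> s \in F -> a \in s -> b \in s -> a != b ->
  int_2face F [set a; b].
Proof.
case/andP => _ nb sF sa sb ab; rewrite /int_2face cards2 ab /=.
rewrite andbT; apply/andP; split; first by apply/exists_inP; exists s; rewrite // set2_sub sa.
apply: contra nb => bd; apply/existsP; exists [set a; b]; rewrite bd sub1set !inE eqxx //.
Qed.

(* By duality it suffices to test against the functions on the edges at [a] that are orthogonal to
   all coboundaries; these are constant around [a], and zero if [a] lies on the boundary. *)
Lemma ray_potential (G : 'I_n -> R) a :
  (interior_ray a -> \sum_(b | int_2face F [set a; b]) G b = 0) ->
  exists f : {set 'I_n} -> R, forall b, int_2face F [set a; b] ->
    \sum_(s in F | (a \in s) && (b \in s)) orient a b s * f s = G b.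
Proof.
move=> Gint.
pose A s b : R := if [&& s \in F, a \in s, b \in s & int_2face F [set a; b]] then orient a b s else 0.
have [c Ac|f Hf] := @linear_duality R {set 'I_n} 'I_n A (fun b => if int_2face F [set a; b] then G b else 0); last first.
  exists f => b ib; have := Hf b; rewrite ib => ->; rewrite big_mkcond /=.
  by apply: eq_bigr => s _; rewrite /A ib andbT; case: ifP; rewrite ?mulr0 // mulrC.
pose ct b := if int_2face F [set a; b] then c b else 0.
(* Orthogonality to the coboundary of the indicator of [s] compares the two edges of [s] at [a],
   whose signs are opposite. *)
have fac s b d : s \in F -> a \in s -> b \in s -> d \in s -> b != a -> d != a -> ct b = ct d.
  move=> sF sa sb sd ba da; have [->//|bd] := eqVneq b d.
  have ab : a != b by rewrite eq_sym.
  have [e [ae be sE D]] := facet_split fanF sF sa sb ab.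
  have de : d = e by move: sd; rewrite sE !inE (negPf da) eq_sym (negPf bd) => /eqP.
  subst e; have := Ac s; rewrite (@sum_set3 _ _ _ a b d) //; last first.
    by move=> i; rewrite -sE /A => /negPf ->; rewrite !andbF mul0r.
  have -> : A s a = 0.
    by rewrite /A; case: ifP => // /and4P[_ _ _ /andP[/andP[_]]]; rewrite setUid cards1.
  have As i : i \in s -> A s i * c i = orient a i s * ct i.
    by move=> si; rewrite /A /ct sF sa si /=; case: ifP; rewrite ?mul0r ?mulr0.
  rewrite mul0r add0r !As // sE orient_cycle -?sE // => E.
  have o2 := orient_sqr sF sa sd ae.
  have o0 : orient a d s != 0 by apply: contra_eq_neq o2 => ->; rewrite expr0n eq_sym oner_eq0.
  apply/esym/(mulfI o0); lra.
have ctE : \sum_b (if int_2face F [set a; b] then G b else 0) * c b = \sum_(b | int_2face F [set a; b]) G b * ct b.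
  by rewrite [RHS]big_mkcond; apply: eq_bigr => b _; rewrite /ct; case: ifP; rewrite ?mul0r.
rewrite ctE.
pose f s := if [pick b in s :\ a] is Some b then ct b else 0.
have fE s b : s \in F -> a \in s -> b \in s -> b != a -> f s = ct b.
  move=> sF sa sb ba; rewrite /f; case: pickP => [d|/(_ b)]; last by rewrite !inE ba sb.
  by rewrite !inE => /andP[da sd]; exact: (fac s).
have fconst s s' : s \in F -> s' \in F -> a \in s -> a \in s' -> f s = f s'.
  move=> sF s'F sa s'a; apply: (@star_constant _ [set a]); rewrite ?sub1set //.
    by apply/exists_inP; exists s; rewrite // sub1set.
  move=> r r' rF r'F; rewrite !sub1set => ra r'a c2.
  have /card_gt0P[b] : (0 < #|(r :&: r') :\ a|)%N.
    by move: c2; rewrite (cardsD1 a) inE ra r'a add1n => -[->].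
  by rewrite !inE => /and3P[ba rb r'b]; rewrite (fE r b) // (fE r' b).
have [/exists_inP[s sF sa]|/exists_inPn nos] := boolP [exists s in F, a \in s]; last first.
  rewrite big_pred0 // => b; apply/negP => /andP[/andP[/exists_inP[s sF]]].
  by rewrite set2_sub => /andP[sa]; have := nos s sF; rewrite sa.
have ctf b : int_2face F [set a; b] -> ct b = f s.
  case/int_edge => ab [s1 [s2 [[s1F s1a s1b] _ _ _ _]]].
  by rewrite (fconst s s1) // (fE s1 b) // eq_sym.
have [ia|nia] := boolP (interior_ray a).
  rewrite (eq_bigr (fun b => G b * f s)); last by move=> b /ctf ->.
  by rewrite -mulr_suml Gint // mul0r.
rewrite big1 // => b /ctf ->.
(* A boundary edge at [a] carries the value zero by the definition of [ct], and constancy around [a]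
   spreads it. *)
have : in_boundary F [set a].
  move: nia; rewrite /interior_ray negb_and negbK => /orP[|//].
  by move=> /negP[]; apply/exists_inP; exists s; rewrite // sub1set.
case/existsP => t /andP[bd]; rewrite sub1set => at'.
case/andP: (bd) => /andP[/exists_inP[s1 s1F ts1] t2] _.
have /card_gt0P[d] : (0 < #|t :\ a|)%N by move/eqP: t2; rewrite (cardsD1 a) at' add1n => -[->].
rewrite !inE => /andP[da td].
have tE : t = [set a; d].
  by apply/eqP; rewrite eq_sym eqEcard set2_sub at' td (eqP t2) cards2 eq_sym da.
rewrite (fconst s s1) ?(subsetP ts1) // (fE s1 d) ?(subsetP ts1) //.
by rewrite /ct /int_2face -tE bd andbF mulr0.
Qed.

End Orientation.

(** * From stars of rays to the whole fan *)

Section GlobalPotential.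
Variables (R : realType) (n : nat) (V : 'M[R]_(n, 3)) (F : {set {set 'I_n}}).
Hypotheses (fanF : is_simplicial_fan3 V F) (herF : hereditary F).
Hypothesis scF : simply_connected (link_set V F).
Implicit Types (a b c d : 'I_n) (s : {set 'I_n}) (x y : 'rV[R]_3).

(** The cone is cut out by three linear inequalities [phi j], the coordinates in its generators; an
    inequality violated at [x] is violated nearby, with a radius depending on its coefficients. *)
Lemma facet_closed s x : s \in F -> ~ pos_hull V s x ->
  exists2 e, 0 < e & forall y, sqdist x y < e -> ~ pos_hull V s y.
Proof.
move=> sF nx; have [a [b [c [ab ac bc sE D]]]] := facetP fanF sF.
pose phi (j : 'I_3) (z : 'rV[R]_3) : R := (vdet V a b c)^-1 *
  (if j == k0 then det3 (z 0) (V b) (V c) else if j == k1 then det3 (V a) (z 0) (V c) else det3 (V a) (V b) (z 0)).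
have hullE z : pos_hull V s z <-> forall j, 0 <= phi j z.
  rewrite sE; split=> [/pos_hull3 [//|//|//|al [be [ga [h1 h2 h3 ->]]]] j|h].
    suff -> : phi j (al *: row a V + be *: row b V + ga *: row c V) = if j == k0 then al else if j == k1 then be else ga.
      by case: (j == k0) => //; case: (j == k1).
    by rewrite /phi; case: (j == k0); last case: (j == k1); rewrite /det3 !mxE -/(det3 (V a) (V b) (V c)); rewrite /vdet /det3 in D *; field.
  apply/pos_hull3 => //; exists (phi k0 z), (phi k1 z), (phi k2 z); split=> //.
  transitivity ((vdet V a b c)^-1 *: (vdet V a b c *: z)); first by rewrite scalerA mulVf ?scale1r.
  by rewrite cramer !scalerDr !scalerA.
have [j xj] : exists j, phi j x < 0.
  apply: Classical_Prop.NNPP => H; apply: nx; apply/hullE => j; rewrite leNgt; apply/negP => l.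
  by apply: H; exists j.
have [w wE] : exists w : 'I_3 -> R, forall z, phi j z = w k0 * z 0 k0 + w k1 * z 0 k1 + w k2 * z 0 k2.
  pose e (i : 'I_3) : 'rV[R]_3 := \row_k (k == i)%:R.
  exists (fun i => phi j (e i)) => z; rewrite /phi; case: (j == k0); last case: (j == k1); rewrite /det3 !mxE /=; ring.
pose K := 1 + `|w k0| + `|w k1| + `|w k2|.
have w0 := normr_ge0 (w k0); have w1 := normr_ge0 (w k1); have w2 := normr_ge0 (w k2).
have K0 : 0 < K by rewrite /K; lra.
pose eta := - phi j x / K.
have eta0 : 0 < eta by rewrite divr_gt0 // oppr_gt0.
have etaK : eta * K = - phi j x by rewrite divfK // gt_eqF.
exists (eta ^+ 2); first by rewrite exprn_gt0.
move=> y ly /hullE/(_ j); apply/negP; rewrite -ltNge.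
have cl k : `|x 0 k - y 0 k| < eta.
  rewrite -(ltr_pXn2r (n := 2)) ?nnegrE ?normr_ge0 ?(ltW eta0) // real_normK ?num_real //.
  apply: le_lt_trans ly; rewrite /sqdist sum3; move: k.
  have q k : 0 <= (x ord0 k - y ord0 k) ^+ 2 by rewrite sqr_ge0.
  have := q k0; have := q k1; have := q k2 => q2 q1 q0.
  by elim/ord3P; lra.
have st (u z : R) : `|z| < eta -> - (u * z) <= `|u| * eta.
  move=> lz; apply: le_trans (ler_norm _) _; rewrite normrN normrM; apply: ler_wpM2l => //.
  exact: ltW.
have := st (w k0) _ (cl k0); have := st (w k1) _ (cl k1); have := st (w k2) _ (cl k2).
by move: etaK; rewrite /K !wE; lra.
Qed.

(** Take a ray with nonzero coefficient in the expression of [x]. By independence that expression is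
    unique, and by the fan property it already lives on the intersection with any other facet
    through [x]. *)
Lemma common_ray x s : s \in F -> pos_hull V s x -> x != 0 ->
  exists a, a \in s /\ forall s', s' \in F -> pos_hull V s' x -> a \in s'.
Proof.
move=> sF hx x0; have [f [f0 [fz xE]]] := hx.
have [a fa] : exists a, f a != 0.
  apply: Classical_Prop.NNPP => H; move/negP: x0; apply; rewrite xE; apply/eqP/big1 => i _.
  have [->|fi] := eqVneq (f i) 0; first by rewrite scale0r.
  by exfalso; apply: H; exists i.
have amem (r : {set 'I_n}) : a \notin r -> r \subset s -> pos_hull V r x -> False.
  move=> ar /subsetP rs [g [_ [gz xE']]]; have [/(_ s sF)[_ ind] _] := fanF.
  have : f a - g a = 0.
    apply: (ind (fun i => f i - g i)) => [i si|].
      by rewrite fz ?gz ?subrr //; apply: contra si; exact: rs.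
    under eq_bigr => i _ do rewrite scalerBl.
    by rewrite sumrB -xE -xE' subrr.
  by rewrite gz // subr0 => E; rewrite E eqxx in fa.
have sa : a \in s by apply/negPn/negP => ns; apply: (amem s).
exists a; split=> // s' s'F hx'; apply/negPn/negP => ns'.
apply: (amem (s :&: s')); rewrite ?subsetIl ?inE ?(negPf ns') ?andbF //.
by have [_ H] := fanF; apply/(H s s' (facet_cone sF) (facet_cone s'F)).
Qed.

Lemma link_neq0 x : link_set V F x -> x != 0.
Proof.
case=> nx _; apply: contra_eq_neq nx => ->; rewrite big1 1?eq_sym ?oner_eq0 //.
by move=> k _; rewrite mxE expr0n.
Qed.

(** An arbitrary facet through each point of the link. It varies discontinuously; only the jumps
    between labels matter. *)
Definition label x : {set 'I_n} := epsilon (inhabits set0) (fun s => s \in F /\ pos_hull V s x).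

Lemma labelP x : link_set V F x -> label x \in F /\ pos_hull V (label x) x.
Proof.
by case=> _ [s sF hx]; apply: (epsilon_spec _ (fun s => s \in F /\ pos_hull V s x)); exists s.
Qed.

(** The segment from [x] to [y], normalized. It avoids the origin because the generators of [s] are
    independent and both endpoints have nonnegative coefficients. *)
Lemma cone_path s x y : s \in F -> pos_hull V s x -> pos_hull V s y -> link_set V F x -> link_set V F y ->
  exists f, [/\ path_in (link_set V F) f, f 0 = x, f 1 = y & forall t, unit_int t -> pos_hull V s (f t)].
Proof.
move=> sF hx hy lx ly.
pose w (t : R) : 'rV[R]_3 := (1 - t) *: x + t *: y.
pose N (t : R) := \sum_k w t 0 k ^+ 2.
have hw t (c : R) : 0 <= c -> unit_int t -> pos_hull V s (c *: w t).
  move=> c0 /andP[t0 t1]; have [f [f0 [fz fE]]] := hx; have [g [g0 [gz gE]]] := hy.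
  exists (fun i => c * ((1 - t) * f i + t * g i)); split.
    by move=> i; rewrite mulr_ge0 // addr_ge0 // mulr_ge0 // subr_ge0.
  split; first by move=> i si; rewrite fz ?gz // !mulr0 addr0 mulr0.
  rewrite /w {1}fE {1}gE !scaler_sumr -big_split /= scaler_sumr; apply: eq_bigr => i _.
  by rewrite !scalerA -scalerDl scalerA.
have w0 t : unit_int t -> w t != 0.
  move=> /andP[t0 t1]; apply/negP => /eqP wt0.
  have [f [f0 [fz fE]]] := hx; have [g [g0 [gz gE]]] := hy.
  have [/(_ s sF)[_ ind] _] := fanF.
  have z i : (1 - t) * f i + t * g i = 0.
    apply: (ind (fun i => (1 - t) * f i + t * g i)) => [j sj|]; first by rewrite fz ?gz // !mulr0 addr0.
    rewrite -[RHS]wt0 /w {1}fE {1}gE !scaler_sumr -big_split /=; apply: eq_bigr => j _.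
    by rewrite !scalerA -scalerDl.
  have [t1'|t1'] := eqVneq t 1.
    have yE : w t = y by rewrite t1' /w subrr scale0r scale1r add0r.
    by have := link_neq0 ly; rewrite -yE wt0 eqxx.
  move/negP: (link_neq0 lx); apply; rewrite fE; apply/eqP/big1 => i _.
  have p1 : 0 <= (1 - t) * f i by rewrite mulr_ge0 // subr_ge0.
  have p2 : 0 <= t * g i by rewrite mulr_ge0.
  have /eqP : (1 - t) * f i = 0 by have := z i; lra.
  by rewrite mulf_eq0 subr_eq0 eq_sym (negPf t1') => /eqP ->; rewrite scale0r.
have N0 t : unit_int t -> 0 < N t.
  move=> ht; rewrite lt_neqAle sumr_ge0 ?andbT; last by move=> k _; rewrite sqr_ge0.
  rewrite eq_sym; apply: contra (w0 t ht) => /eqP Nt; apply/eqP/rowP => k; rewrite [RHS]mxE.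
  have := @psumr_eq0P R 'I_3 predT (fun k => w t 0 k ^+ 2) (fun k _ => sqr_ge0 _) Nt k isT.
  by move/eqP; rewrite expf_eq0 /= => /eqP.
pose f t := (Num.sqrt (N t))^-1 *: w t.
have cw k : cont1 (fun t => w t 0 k).
  have H := cont1_add (cont1_mul (cont1_add (@cont1_cst R 1) (cont1_mul (@cont1_cst R (-1)) (@cont1_id R))) (@cont1_cst R (x 0 k))) (cont1_mul (@cont1_id R) (@cont1_cst R (y 0 k))).
  by move=> t ht e e0; have [d d0 K] := H t ht e e0; exists d => // t' ht' l; have := K t' ht' l; rewrite /w !mxE /= !mulN1r.
have cN : cont1 N.
  have H := cont1_add (cont1_add (cont1_mul (cw k0) (cw k0)) (cont1_mul (cw k1) (cw k1))) (cont1_mul (cw k2) (cw k2)).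
  by move=> t ht e e0; have [d d0 K] := H t ht e e0; exists d => // t' ht' l; have := K t' ht' l; rewrite /N !sum3 !expr2.
have sN0 t : unit_int t -> 0 < Num.sqrt (N t) by move=> ht; rewrite sqrtr_gt0 N0.
have hf t : unit_int t -> pos_hull V s (f t).
  by move=> ht; apply: hw => //; rewrite invr_ge0 ltW // sN0.
have nf t : unit_int t -> \sum_k f t ord0 k ^+ 2 = 1.
  move=> ht; rewrite (eq_bigr (fun k => (N t)^-1 * (w t 0 k ^+ 2))).
    by rewrite -mulr_sumr mulVf // gt_eqF // N0.
  by move=> k _; rewrite mxE exprMn exprVn sqr_sqrtr // ltW // N0.
have e0 z : link_set V F z -> (Num.sqrt (\sum_k z 0 k ^+ 2))^-1 *: z = z by case=> -> _; rewrite sqrtr1 invr1 scale1r.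
exists f; split=> //.
- split; last by move=> t ht; split; [exact: nf | exists s => //; exact: hf].
  apply: cont_path_coord => k.
  have H := cont1_mul (cont1_inv (cont1_sqrt cN N0) sN0) (cw k).
  by move=> t ht e e0'; have [d d0 K] := H t ht e e0'; exists d => // t' ht' l; have := K t' ht' l; rewrite !mxE.
- by rewrite /f /N (_ : w 0 = x) ?e0 // /w subr0 scale1r scale0r addr0.
- by rewrite /f /N (_ : w 1 = y) ?e0 // /w subrr scale1r scale0r add0r.
Qed.

Section Glue.
Variable psi : 'I_n -> {set 'I_n} -> R.
Hypothesis psi_compat : forall a b s s', s \in F -> s' \in F -> a \in s -> a \in s' -> b \in s -> b \in s' ->
  psi a s' - psi a s = psi b s' - psi b s.

(** The change of the star potentials between two facets, computed at any shared ray; [psi_compat]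
    makes the choice irrelevant. The value zero for facets without a common ray is a default. *)
Definition jump s s' : R := if [pick a in s :&: s'] is Some a then psi a s' - psi a s else 0.

Lemma jumpE a s s' : s \in F -> s' \in F -> a \in s -> a \in s' -> jump s s' = psi a s' - psi a s.
Proof.
move=> sF s'F sa s'a; rewrite /jump; case: pickP => [b|/(_ a)]; last by rewrite inE sa s'a.
by rewrite inE => /andP[sb s'b]; exact: psi_compat.
Qed.

(** The finitely many facets that miss [x] stay away from a small ball. Every facet meeting the ball
    thus contains [x] and the common ray of the facets through [x]. *)
Lemma near_common_ray x : link_set V F x -> exists2 e, 0 < e & exists a,
  (forall s, s \in F -> pos_hull V s x -> a \in s) /\
  forall y s, s \in F -> pos_hull V s y -> sqdist x y < e -> a \in s.
Proof.
move=> lx; have [_ [s sF hx]] := lx; have [a [sa Ha]] := common_ray sF hx (link_neq0 lx).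
have [e e0 He] : exists2 e, 0 < e & forall r, r \in enum F -> ~ pos_hull V r x -> forall y, sqdist x y < e -> ~ pos_hull V r y.
  have : forall r, r \in enum F -> r \in F by move=> r; rewrite mem_enum.
  elim: (enum F) => [|r l IH] sub; first by exists 1.
  have [|e e0 He] := IH; first by move=> r' rl; apply: sub; rewrite inE rl orbT.
  have [hr|hr] := Classical_Prop.classic (pos_hull V r x).
    by exists e => // r'; rewrite inE => /orP[/eqP -> /(_ hr) []|/He].
  have [e' e0' He'] := facet_closed (sub r (mem_head _ _)) hr.
  exists (Num.min e e') => [|r']; first by rewrite lt_min e0.
  rewrite inE => /orP[/eqP -> _ y|r'l nr' y]; rewrite lt_min => /andP[l1 l2]; first exact: He'.
  exact: (He r').
exists e => //; exists a; split=> [r rF hr|y r rF hr ly]; first exact: Ha.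
apply: Ha => //; apply: Classical_Prop.NNPP => nr.
by apply: (He r _ nr y) => //; rewrite mem_enum.
Qed.

(** The value at [s] is the transport of the jumps from a base point to a point of [s], corrected
    from the label of that point to [s] itself. Simple connectivity makes the transport independent
    of the path. *)
Lemma glue_potential : exists f : {set 'I_n} -> R, forall a s s',
  s \in F -> s' \in F -> a \in s -> a \in s' -> f s' - f s = psi a s' - psi a s.
Proof.
pose X := link_set V F.
have lp x : X x -> exists2 e, 0 < e & exists phi : {set 'I_n} -> R,
    forall y z, X y -> X z -> sqdist x y < e -> sqdist x z < e ->
    jump (label y) (label z) = phi (label z) - phi (label y).
  move=> lx; have [e e0 [a [_ Ha]]] := near_common_ray lx; exists e => //; exists (psi a) => y z ly lz dy dz.
  have [yF hy] := labelP ly; have [zF hz] := labelP lz.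
  by apply: jumpE => //; [exact: (Ha y)|exact: (Ha z)].
have jump_add x s1 s2 s3 : x != 0 -> s1 \in F -> s2 \in F -> s3 \in F ->
    pos_hull V s1 x -> pos_hull V s2 x -> pos_hull V s3 x -> jump s1 s3 - jump s1 s2 = jump s2 s3.
  move=> x0 s1F s2F s3F h1 h2 h3; have [a [a1 Ha]] := common_ray s1F h1 x0.
  by rewrite !(@jumpE a) // ?Ha //; ring.
(* Inside one cone all labels share rays with [s], so the jump from [s] is a lift along the path and
   transport is explicit. *)
have tr_cone s x y : s \in F -> pos_hull V s x -> pos_hull V s y -> X x -> X y ->
    transport X label jump x y (jump s (label y) - jump s (label x)).
  move=> sF hx hy lx ly; have [f [pf f0 f1 hf]] := cone_path sF hx hy lx ly.
  exists f, (fun t => jump s (label (f t))); split=> //; last by rewrite f0 f1.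
  move=> t ht; have Xt : X (f t) by case: pf => _; apply.
  have [e e0 [a [Ha Ha']]] := near_common_ray Xt.
  have [d d0 K] := (proj1 pf) t ht e e0; exists d => // t' ht' l.
  have Xt' : X (f t') by case: pf => _; apply.
  have [F1 h1] := labelP Xt; have [F2 h2] := labelP Xt'.
  have sa : a \in s by apply: Ha => //; exact: hf.
  have a1 : a \in label (f t) by exact: Ha.
  have a2 : a \in label (f t') by apply: (Ha' (f t')) => //; exact: K.
  by rewrite !(@jumpE a) //; ring.
have [[x0 Xx0] _] := scF.
(* The unit vector on the ray [a] lies in all facets through [a], so their values can be compared
   there. *)
have ptF s : s \in F -> forall a, a \in s -> exists2 x, X x & pos_hull V s x /\ forall s', s' \in F -> a \in s' -> pos_hull V s' x.
  move=> sF a sa.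
  have [b [c [ab ac sE D]]] : exists b c, [/\ a != b, a != c, s = [set a; b; c] & vdet V a b c != 0].
    have [/(_ s sF)[s3 _] _] := fanF.
    have /card_gt0P[b] : (0 < #|s :\ a|)%N by move: s3; rewrite (cardsD1 a) sa add1n => -[->].
    rewrite !inE => /andP[ba sb]; have ab : a != b by rewrite eq_sym.
    by have [c [ac bc sE D]] := facet_split fanF sF sa sb ab; exists b, c.
  pose N := \sum_k V a k ^+ 2.
  have N0 : 0 < N.
    rewrite lt_neqAle sumr_ge0 ?andbT; last by move=> k _; rewrite sqr_ge0.
    rewrite eq_sym; apply: contra D => /eqP Nt.
    have z k : V a k = 0.
      have := @psumr_eq0P R 'I_3 predT (fun k => V a k ^+ 2) (fun k _ => sqr_ge0 _) Nt k isT.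
      by move/eqP; rewrite expf_eq0 /= => /eqP.
    by rewrite /vdet /det3 !z; apply/eqP; ring.
  pose x := (Num.sqrt N)^-1 *: row a V.
  have hx s' : s' \in F -> a \in s' -> pos_hull V s' x.
    move=> s'F s'a; exists (fun i => if i == a then (Num.sqrt N)^-1 else 0); split.
      by move=> i; case: ifP => // _; rewrite invr_ge0 sqrtr_ge0.
    split; first by move=> i; case: eqP => // -> /negP.
    by rewrite (bigD1 a) //= eqxx big1 ?addr0 // => i /negPf ->; rewrite scale0r.
  exists x; last by split=> //; exact: hx.
  split; last by exists s => //; exact: hx.
  rewrite (eq_bigr (fun k => N^-1 * (V a k ^+ 2))); first by rewrite -mulr_sumr mulVf // gt_eqF.
  by move=> k _; rewrite !mxE exprMn exprVn sqr_sqrtr // ltW.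
pose pt s : 'rV[R]_3 := epsilon (inhabits 0) (fun x => X x /\ pos_hull V s x).
have ptP s : s \in F -> X (pt s) /\ pos_hull V s (pt s).
  move=> sF; apply: (epsilon_spec _ (fun x => X x /\ pos_hull V s x)); have [a [b [c [_ _ _ sE _]]]] := facetP fanF sF.
  have sa : a \in s by rewrite sE !inE eqxx.
  by have [x Xx [hx _]] := ptF s sF a sa; exists x.
pose r x : R := epsilon (inhabits 0) (transport X label jump x0 x).
have rP x : X x -> transport X label jump x0 x (r x).
  by move=> Xx; apply: (epsilon_spec _ (transport X label jump x0 x)); exact: (transport_exists lp scF).
exists (fun s => r (pt s) - jump s (label (pt s))) => a s s' sF s'F sa s'a.
have [y Xy [hy hy']] := ptF s sF a sa.
have key s1 : s1 \in F -> a \in s1 -> r y = r (pt s1) - jump s1 (label (pt s1)) + jump s1 (label y).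
  move=> s1F s1a; have [X1 h1] := ptP s1 s1F.
  have := transport_cat (rP _ X1) (tr_cone s1 _ _ s1F h1 (hy' s1 s1F s1a) X1 Xy).
  by move=> /(transport_unique lp scF (rP y Xy)) ->; ring.
have [lF ly] := labelP Xy.
have := jump_add y s s' (label y) (link_neq0 Xy) sF s'F lF hy (hy' _ s'F s'a) ly.
have := key s sF sa; have := key s' s'F s'a; rewrite -(@jumpE a s s') //; lra.
Qed.

End Glue.

Theorem global_potential (G : 'I_n -> 'I_n -> R) :
  (forall a b, G b a = - G a b) ->
  (forall a, interior_ray F a -> \sum_(b | int_2face F [set a; b]) G a b = 0) ->
  exists f : {set 'I_n} -> R, forall a b, int_2face F [set a; b] ->
    \sum_(s in F | (a \in s) && (b \in s)) orient V a b s * f s = G a b.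
Proof.
move=> Gas Gint.
pose psi a : {set 'I_n} -> R := epsilon (inhabits (fun=> 0)) (fun f => forall b, int_2face F [set a; b] ->
    \sum_(s in F | (a \in s) && (b \in s)) orient V a b s * f s = G a b).
have psiP a b : int_2face F [set a; b] -> \sum_(s in F | (a \in s) && (b \in s)) orient V a b s * psi a s = G a b.
  by apply: (epsilon_spec (inhabits (fun=> 0)) _ (ray_potential fanF herF (Gint a))).
have sumE a b s1 s2 (f : {set 'I_n} -> R) := @sum_int_edge R n V F R^o a b s1 s2 f.
have compat a b s s' : s \in F -> s' \in F -> a \in s -> a \in s' -> b \in s -> b \in s' ->
    psi a s' - psi a s = psi b s' - psi b s.
  move=> sF s'F sa s'a sb s'b; have [->//|ab] := eqVneq a b.
  (* Across the edge [ab] both potentials have the jump prescribed by [G a b], up to signs that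
     agree, so their difference is constant on the star of the edge. *)
  suff : psi a s - psi b s = psi a s' - psi b s' by lra.
  apply: (@star_constant _ F herF _ [set a; b] (fun s => psi a s - psi b s)); rewrite ?set2_sub ?sa ?s'a //.
    by apply/exists_inP; exists s; rewrite // set2_sub sa.
  move=> r r' rF r'F; rewrite !set2_sub => /andP[ra rb] /andP[r'a r'b] c2.
  have rr' : r != r'.
    apply: contra_eq_neq c2 => <-; rewrite setIid; have [/(_ r rF)[-> _] _] := fanF; by [].
  have iab := two_facets_int rF r'F rr' ab ra rb r'a r'b.
  have [_ [s1 [s2 [[s1F s1a s1b] [s2F s2a s2b] s12 only [o2 o1]]]]] := int_edge fanF iab.
  have e1 := psiP a b iab; have iba : int_2face F [set b; a] by rewrite setUC.
  have e2 := psiP b a iba; rewrite (sumE a b s1 s2) // in e1.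
  have o2' : orient V b a s2 = - orient V b a s1 by rewrite !(orient_antisym V a b) o2.
  rewrite (sumE b a s1 s2) // in e2; last by move=> u uF ub ua; exact: only.
  have o0 : orient V a b s1 != 0 by apply: contra_eq_neq o1 => ->; rewrite expr0n eq_sym oner_eq0.
  have E : psi a s1 - psi b s1 = psi a s2 - psi b s2.
    suff : psi a s1 - psi a s2 = psi b s1 - psi b s2 by lra.
    apply: (mulfI o0); move: e1 e2; rewrite (orient_antisym V a b) Gas /GRing.scale /= mulNr => e1 e2.
    by rewrite e1 -[LHS]opprK -e2 !opprK.
  by case: (only r rF ra rb) => ->; case: (only r' r'F r'a r'b) => ->.
have [f Hf] := glue_potential compat.
exists f => a b iab.
have [ab [s1 [s2 [[s1F s1a s1b] [s2F s2a s2b] s12 only [o2 o1]]]]] := int_edge fanF iab.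
rewrite -(psiP a b iab) (sumE a b s1 s2 f) // (sumE a b s1 s2 (psi a)) //.
by have -> : f s1 - f s2 = psi a s1 - psi a s2 by have := Hf a s1 s2 s1F s2F s1a s2a; lra.
Qed.

End GlobalPotential.

(** * Generic rigidity of fans *)

Section ClosedUp.
Variables (R : realType) (n : nat) (V : 'M[R]_(n, 3)) (F : {set {set 'I_n}}).
Hypotheses (fanF : is_simplicial_fan3 V F) (herF : hereditary F).
Implicit Types (a b : 'I_n) (s t r : {set 'I_n}).

Definition emb (A : {set 'I_n}) : {set option 'I_n} := Some @: A.

Definition capped : {set {set option 'I_n}} :=
  [set emb s | s in F] :|: [set None |: emb t | t in [set t | bd_2face F t]].

Lemma emb_mem A a : (Some a \in emb A) = (a \in A).
Proof. by rewrite mem_imset //; exact: Some_inj. Qed.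

Lemma emb_None A : (None \in emb A) = false.
Proof. by apply/imsetP => -[]. Qed.

Lemma emb_card A : #|emb A| = #|A|.
Proof. by rewrite card_imset //; exact: Some_inj. Qed.

Lemma emb_sub A B : (emb A \subset emb B) = (A \subset B).
Proof.
apply/subsetP/subsetP => H => [a|[a|]]; rewrite ?emb_None //.
  by move=> aA; have := H (Some a); rewrite !emb_mem; apply.
by rewrite !emb_mem; exact: H.
Qed.

Lemma emb_subU A B : (emb A \subset None |: emb B) = (A \subset B).
Proof.
rewrite -emb_sub; apply/idP/idP => [/subsetP H|]; last by move/subset_trans; apply; exact: subsetUr.
by apply/subsetP => -[a|] aA; have := H _ aA; rewrite !inE // emb_None in aA *.
Qed.

Lemma emb_inj : injective emb.
Proof. exact/imset_inj/Some_inj. Qed.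

Lemma cappedP x : x \in capped ->
  (exists2 s, s \in F & x = emb s) \/ (exists2 t, bd_2face F t & x = None |: emb t).
Proof.
by case/setUP => /imsetP[s sF ->]; [left; exists s|right; exists s => //; rewrite inE in sF].
Qed.

Lemma facet_capped s : s \in F -> emb s \in capped.
Proof. by move=> sF; apply/setUP; left; apply/imsetP; exists s. Qed.

Lemma bd_capped t : bd_2face F t -> None |: emb t \in capped.
Proof. by move=> bd; apply/setUP; right; apply/imsetP; exists t; rewrite ?inE. Qed.

Lemma facet3 s : s \in F -> #|s| = 3%N.
Proof. by move=> sF; have [/(_ s sF)[]] := fanF. Qed.

Lemma bd_card t : bd_2face F t -> #|t| = 2%N.
Proof. by case/andP => /andP[_ /eqP]. Qed.

Lemma capped3 x : x \in capped -> #|x| = 3%N.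
Proof.
case/cappedP => [[s sF ->]|[t bd ->]]; first by rewrite emb_card facet3.
by rewrite cardsU1 emb_None emb_card bd_card.
Qed.

Lemma sub_card_eq (A B : {set 'I_n}) : A \subset B -> #|A| = #|B| -> A = B.
Proof. by move=> AB c; apply/eqP; rewrite eqEcard AB c leqnn. Qed.

Lemma capped_bd t x : bd_2face F t -> x \in capped -> emb t \subset x ->
  x = None |: emb t \/ exists2 s, s \in F & t \subset s /\ x = emb s.
Proof.
move=> bd /cappedP[[s sF ->]|[t' bd' ->]]; first by rewrite emb_sub; right; exists s.
rewrite emb_subU => tt'; left; congr (_ |: emb _); apply/esym/sub_card_eq => //.
by rewrite !bd_card.
Qed.

Lemma bd_facet t : bd_2face F t -> exists s, [/\ s \in F, t \subset s &
  forall s', s' \in F -> t \subset s' -> s' = s].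
Proof.
case/andP => _ /cards1P[s /setP E]; exists s.
have := E s; rewrite !inE eqxx => /andP[sF ts]; split=> // s' s'F ts'.
by have := E s'; rewrite !inE s'F ts' => /esym/eqP.
Qed.

Lemma not_bd_int t s : #|t| = 2%N -> s \in F -> t \subset s -> ~~ bd_2face F t -> int_2face F t.
Proof.
by move=> t2 sF ts nb; rewrite /int_2face nb t2 eqxx !andbT; apply/exists_inP; exists s.
Qed.

Lemma capped_int t x : int_2face F t -> x \in capped -> emb t \subset x ->
  exists2 s, s \in F & t \subset s /\ x = emb s.
Proof.
case/andP => /andP[_ /eqP t2] nbd /cappedP[[s sF ->]|[t' bd' ->]]; first by rewrite emb_sub; exists s.
rewrite emb_subU => tt'; case/negP: nbd.
by rewrite (sub_card_eq tt') // t2 bd_card.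
Qed.

(** An edge that lies in only two triangles of the ambient complex passes membership in a cycle from
    one to the other. *)
Lemma cycle_pair (Z S : {set {set option 'I_n}}) (e x1 x2 : {set option 'I_n}) : cycleb S -> S \subset Z ->
  #|e| = 2%N -> e \subset x1 ->
  (forall x, x \in Z -> e \subset x -> x = x1 \/ x = x2) -> x1 \in S -> x2 \in S.
Proof.
move=> /cyclebP[_ ev] /subsetP SZ e2 ex1 only x1S; apply/negPn/negP => x2S.
have := ev e e2; rewrite /degc (_ : [set _ in _ | _] = [set x1]) ?cards1 //.
apply/setP => x; rewrite !inE; apply/andP/eqP => [[xS ex]|->]; last by rewrite x1S.
by case: (only x (SZ _ xS) ex) => // E; rewrite E (negPf x2S) in xS.
Qed.

Lemma even_edge t : #|t| = 2%N -> ~~ odd (degc capped (emb t)).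
Proof.
move=> t2; have [bd|nbd] := boolP (bd_2face F t).
  have [s [sF ts only]] := bd_facet bd.
  rewrite /degc (_ : [set _ in _ | _] = [set emb s; None |: emb t]).
    rewrite cards2; suff -> : emb s != None |: emb t by [].
    by apply/eqP => /setP/(_ None); rewrite emb_None !inE.
  apply/setP => x; rewrite in_set in_set2; apply/andP/orP => [[xZ tx]|[] /eqP ->].
  - by case: (capped_bd bd xZ tx) => [->|[s' s'F [ts' ->]]]; [right|left; rewrite (only s')].
  - by rewrite facet_capped // emb_sub.
  - by rewrite bd_capped // emb_subU.
have [/existsP[s /andP[sF ts]]|/existsPn nos] := boolP [exists s, (s \in F) && (t \subset s)].
  have it := not_bd_int t2 sF ts nbd.
  have /cards2P[a [b [ab tE]]] := introT eqP t2.
  rewrite tE in it; have [_ [s1 [s2 [[s1F s1a s1b] [s2F s2a s2b] s12 only _]]]] := int_edge fanF it.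
  rewrite -tE in it.
  rewrite /degc (_ : [set _ in _ | _] = [set emb s1; emb s2]).
    by rewrite cards2 (inj_eq emb_inj) s12.
  apply/setP => x; rewrite in_set in_set2; apply/andP/orP => [[xZ tx]|[] /eqP ->].
  - have [r rF [tr ->]] := capped_int it xZ tx; rewrite tE set2_sub in tr; case/andP: tr => ra rb.
    by case: (only r rF ra rb) => ->; [left|right].
  - by rewrite facet_capped // emb_sub tE set2_sub s1a.
  - by rewrite facet_capped // emb_sub tE set2_sub s2a.
rewrite /degc (_ : [set _ in _ | _] = set0) ?cards0 //.
apply/setP => x; rewrite [RHS]in_set0 [LHS]in_set; apply/negP => /andP[/cappedP[[s sF ->]|[t' bd ->]]].
  by rewrite emb_sub => ts; have := nos s; rewrite sF ts.
rewrite emb_subU => tt'; case/negP: nbd.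
by rewrite (sub_card_eq tt') // t2 bd_card.
Qed.

Lemma capped_cycle : cycleb capped.
Proof.
apply/cyclebP; split; first exact: capped3.
(* The edges from [Some b] to the other rays are already even, so the handshake at [Some b] settles
   the edge to the coning point. *)
have even_None b : ~~ odd (degc capped [set Some b; None]).
  have := congr1 odd (handshake (Some b) capped3); rewrite odd_double (bigD1 None) //= oddD.
  rewrite odd_sum big1; first by rewrite addbF => ->.
  move=> [c|] // /andP[cb _]; apply/negbTE.
  have -> : [set Some b; Some c] = emb [set b; c] by rewrite /emb imsetU1 imset_set1.
  have bc : b != c by apply: contraNneq cb => ->.
  by apply: even_edge; rewrite cards2 bc.
move=> e /eqP/cards2P[[a|] [[b|] [ab ->]]] //.
- have -> : [set Some a; Some b] = emb [set a; b] by rewrite /emb imsetU1 imset_set1.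
  have ab' : a != b by apply: contraNneq ab => ->.
  by apply: even_edge; rewrite cards2 ab'.
- by rewrite setUC.
Qed.

(** Membership in a subcycle crosses interior edges, hence by [hereditary] at the empty face it is
    the same for all facets; a boundary edge ties its coned triangle to its only facet. *)
Lemma capped_mincycle : F != set0 -> mincycle capped.
Proof.
case/set0Pn => s0 s0F; split; first exact: capped_cycle.
  by apply/set0Pn; exists (emb s0); exact: facet_capped.
move=> S SZ cS /set0Pn[x0 x0S].
have same s s' : s \in F -> s' \in F -> (emb s \in S) = (emb s' \in S).
  move=> sF s'F; apply: (@star_constant _ F herF _ set0 (fun s => emb s \in S)); rewrite ?sub0set //.
    by apply/exists_inP; exists s; rewrite ?sub0set.
  have main r r' : r \in F -> r' \in F -> #|r :&: r'| = 2%N -> emb r \in S -> emb r' \in S.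
    move=> rF r'F c2; apply: (@cycle_pair capped S (emb (r :&: r')) (emb r) (emb r')) => //.
    - by rewrite emb_card.
    - by rewrite emb_sub subsetIl.
    have /cards2P[a [b [ab tE]]] := introT eqP c2.
    have [ra r'a] : a \in r /\ a \in r' by apply/andP; have := set21 a b; rewrite -tE inE.
    have [rb r'b] : b \in r /\ b \in r' by apply/andP; have := set22 a b; rewrite -tE inE.
    have rr' : r != r' by apply: contra_eq_neq c2 => <-; rewrite setIid facet3.
    have iab := two_facets_int rF r'F rr' ab ra rb r'a r'b.
    have [_ [s1 [s2 [_ _ _ only _]]]] := int_edge fanF iab.
    move=> x xZ; rewrite tE => tx; have [u uF []] := capped_int iab xZ tx.
    rewrite set2_sub => /andP[ua ub] ->.
    case: (only _ rF ra rb) rr' => ->; case: (only _ r'F r'a r'b) => ->; case: (only _ uF ua ub) => ->; rewrite ?eqxx //; by [left|right].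
  move=> r r' rF r'F _ _ c2; apply/idP/idP; apply: main => //.
  by rewrite setIC.
have [inS|ninS] := boolP (emb s0 \in S).
  apply/eqP; rewrite eqEsubset SZ; apply/subsetP => x /cappedP[[s sF ->]|[t bd ->]].
    by rewrite -(same s0).
  have [s [sF ts only]] := bd_facet bd.
  apply: (@cycle_pair capped S (emb t) (emb s)); rewrite ?emb_card ?emb_sub ?bd_card //; last by rewrite -(same s0).
  move=> y yZ ty; case: (capped_bd bd yZ ty) => [->|[s' s'F [ts' ->]]]; first by right.
  by left; rewrite (only s').
exfalso; case/cappedP: (subsetP SZ _ x0S) => [[s sF xE]|[t bd xE]].
  by move: x0S; rewrite xE -(same s0) // (negPf ninS).
have [s [sF ts only]] := bd_facet bd.
have : emb s \in S.
  apply: (@cycle_pair capped S (emb t) (None |: emb t)); rewrite ?emb_card ?emb_subU ?bd_card // -?xE //.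
  move=> x xZ tx; case: (capped_bd bd xZ tx) => [->|[s' s'F [ts' ->]]]; first by left.
  by right; rewrite (only s').
by rewrite -(same s0) // (negPf ninS).
Qed.

End ClosedUp.

(** * From planar placements to ray coordinates *)

Section GenericFan.
Variables (R : realType) (n : nat) (F : {set {set 'I_n}}).

Definition mcoord (f : 'M[R]_(n, 3) -> R) : Prop := exists i k, f = (fun V : 'M[R]_(n, 3) => V i k).

Lemma polyfun_mpoly f : polyfun mcoord f -> exists p : {mpoly R[n * 3]}, forall V, eval_coords p V = f V.
Proof.
rewrite /eval_coords; elim=> {f}.
- by move=> f [i [k ->]]; exists 'X_(mxvec_index i k) => V; rewrite mevalXU mxvecE.
- by move=> c; exists c%:MP => V; rewrite mevalC.
- by move=> f g _ [p Hp] _ [q Hq]; exists (p + q) => V; rewrite mevalD Hp Hq.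
- by move=> f g _ [p Hp] _ [q Hq]; exists (p * q) => V; rewrite mevalM Hp Hq.
- by move=> f g fg _ [p Hp]; exists p => V; rewrite Hp fg.
Qed.

(* The affine chart [z = 1]; the coning point [None] sits at a fixed position. *)
Definition chart (z0 : R * R) (V : 'M[R]_(n, 3)) (o : option 'I_n) : R * R :=
  if o is Some i then (V i k0 / V i k2, V i k1 / V i k2) else z0.

(** A power of the product of all last coordinates clears the denominators of the chart. *)
Lemma homogenize z0 f : polyfun (@pcoord R (option 'I_n)) f ->
  exists N (g : 'M[R]_(n, 3) -> R), polyfun mcoord g /\
    forall V : 'M[R]_(n, 3), (forall i, V i k2 != 0) -> g V = (\prod_i V i k2) ^+ N * f (chart z0 V).
Proof.
have pc i k : polyfun mcoord (fun V : 'M[R]_(n, 3) => V i k) by apply: PolyCoord; exists i, k.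
have pW N : polyfun mcoord (fun V : 'M[R]_(n, 3) => (\prod_i V i k2) ^+ N).
  elim: N => [|N IH]; first by apply: PolyExt (PolyCst _ 1) => V; rewrite expr0.
  apply: PolyExt (PolyMul (@polyfun_prod R _ mcoord _ (index_enum 'I_n) predT (fun i (V : 'M[R]_(n, 3)) => V i k2) (fun i _ => pc i k2)) IH).
  by move=> V; rewrite exprS.
have pfrac i k : exists N (g : 'M[R]_(n, 3) -> R), polyfun mcoord g /\
    forall V : 'M[R]_(n, 3), (forall i, V i k2 != 0) -> g V = (\prod_i V i k2) ^+ N * (V i k / V i k2).
  exists 1%N, (fun V : 'M[R]_(n, 3) => (\prod_(j | j != i) V j k2) * V i k); split.
    by apply: PolyMul; [apply: polyfun_prod => j _|].
  by move=> V V0; rewrite expr1 [in RHS](bigD1 i) //=; field; exact: V0.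
elim=> {f}.
- have pcst (c : R) : exists N (g : 'M[R]_(n, 3) -> R), polyfun mcoord g /\
      forall V : 'M[R]_(n, 3), (forall i, V i k2 != 0) -> g V = (\prod_i V i k2) ^+ N * c.
    by exists 0%N, (fun=> c); split; [exact: PolyCst|move=> V _; rewrite expr0 mul1r].
  by move=> f [[i|] [] ->]; [exact: pfrac|exact: pfrac|exact: pcst|exact: pcst].
- by move=> c; exists 0%N, (fun=> c); split; [exact: PolyCst|move=> V _; rewrite expr0 mul1r].
- move=> f1 f2 _ [N1 [g1 [p1 H1]]] _ [N2 [g2 [p2 H2]]].
  exists (N1 + N2)%N, (fun V : 'M[R]_(n, 3) => g1 V * (\prod_i V i k2) ^+ N2 + g2 V * (\prod_i V i k2) ^+ N1); split.
    by apply: PolyAdd; apply: PolyMul.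
  by move=> V V0; rewrite H1 // H2 // exprD; ring.
- move=> f1 f2 _ [N1 [g1 [p1 H1]]] _ [N2 [g2 [p2 H2]]].
  exists (N1 + N2)%N, (fun V : 'M[R]_(n, 3) => g1 V * g2 V); split; first exact: PolyMul.
  by move=> V V0; rewrite H1 // H2 // exprD; ring.
- move=> f1 f2 eqf _ [N [g [p H]]]; exists N, g; split=> // V V0.
  by rewrite H // eqf.
Qed.

(** The coning point is no ray of the fan, so it is frozen at its position in a placement where the
    polynomial does not vanish. The rays of that placement, with last coordinate one, show that the
    resulting polynomial is nonzero; the extra product forces all rays into the chart. *)
Lemma generic_chart (P : (option 'I_n -> R * R) -> Prop) : generic P ->
  exists z0, exists2 p : {mpoly R[n * 3]}, p != 0 &
    forall V : 'M[R]_(n, 3), eval_coords p V != 0 -> (forall i, V i k2 != 0) /\ P (chart z0 V).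
Proof.
move=> [f pf [[p0 fp0] fP]]; exists (p0 None).
have [N [g [pg Hg]]] := homogenize (p0 None) pf.
have pW : polyfun mcoord (fun V : 'M[R]_(n, 3) => \prod_i V i k2).
  by apply: polyfun_prod => i _; apply: PolyCoord; exists i, k2.
have [p Hp] := polyfun_mpoly (PolyMul pW pg).
exists p.
  pose V0 : 'M[R]_(n, 3) := \matrix_(i, k) (if k == k0 then (p0 (Some i)).1 else if k == k1 then (p0 (Some i)).2 else 1).
  have V01 i : V0 i k2 = 1 by rewrite mxE.
  have : eval_coords p V0 != 0.
    rewrite Hp Hg => [|i]; last by rewrite V01 oner_eq0.
    rewrite big1 => [|i _]; last by rewrite V01.
    rewrite expr1n !mul1r.
    suff E h : polyfun (@pcoord R (option 'I_n)) h -> h (chart (p0 None) V0) = h p0 by rewrite E.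
    elim=> {h} //; first by move=> h [[i|] [] -> //=]; rewrite !mxE divr1.
    - by move=> h1 h2 _ -> _ ->.
    - by move=> h1 h2 _ -> _ ->.
    - by move=> h1 h2 e _; rewrite !e.
  by apply: contraNneq => ->; rewrite /eval_coords meval0.
move=> V; rewrite Hp mulf_eq0 negb_or => /andP[W0 g0].
have V0 i : V i k2 != 0 by have /prodf_neq0/(_ i isT) := W0.
split=> //; apply: fP; apply: contraNneq g0 => f0; by rewrite Hg // f0 mulr0.
Qed.

Definition planar (V : 'M[R]_(n, 3)) (i : 'I_n) : R * R := (V i k0 / V i k2, V i k1 / V i k2).

Record good_fan (V : 'M[R]_(n, 3)) : Prop := GoodFan {
  good_chart : forall i, V i k2 != 0;
  good_vdet : forall a b c, a != b -> a != c -> b != c -> vdet V a b c != 0;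
  good_rigid : forall q : 'I_n -> binq R,
    (forall a, ~~ interior_ray F a -> q a = 0) ->
    (forall a b, int_2face F [set a; b] ->
       bev (q a) (pdir (planar V) a b) = bev (q b) (pdir (planar V) a b)) ->
    exists c, (forall a, interior_ray F a -> q a = triv c (planar V a)) /\
      forall t, bd_2face F t -> c = (0, 0, 0, (0, 0, 0)) }.

(** The given fan [V0] serves to show that [capped F] is a minimal cycle, a statement about [F]
    alone; the polynomial obtained then applies to every [V]. *)
Lemma good_fan_generic : hereditary F -> F != set0 -> (exists V : 'M[R]_(n, 3), is_simplicial_fan3 V F) ->
  exists2 p : {mpoly R[n * 3]}, p != 0 & forall V, eval_coords p V != 0 -> good_fan V.
Proof.
move=> herF F0 [V0 fanF].
have mc := capped_mincycle fanF herF F0.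
have g1 := @mincycle_rigid R _ _ mc.
have g2 : generic (fun p : option 'I_n -> R * R => forall ab : option 'I_n * option 'I_n,
    ab \in enum [set ab : option 'I_n * option 'I_n | ab.1 != ab.2] -> p ab.1 != p ab.2).
  by apply: generic_forall => ab; rewrite mem_enum inE => nab; exact: generic_neq.
have g3 : generic (fun p : option 'I_n -> R * R => forall abc : 'I_n * 'I_n * 'I_n,
    abc \in enum [set abc : 'I_n * 'I_n * 'I_n | [&& abc.1.1 != abc.1.2, abc.1.1 != abc.2 & abc.1.2 != abc.2]] ->
    area p (Some abc.1.1) (Some abc.1.2) (Some abc.2) != 0).
  apply: generic_forall => abc; rewrite mem_enum inE => /and3P[ab ac bc].
  by apply: generic_area; rewrite (inj_eq (@Some_inj _)).
have [z0 [p p0 Hp]] := generic_chart (generic_and g1 (generic_and g2 g3)).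
exists p => // V /Hp [V2 [rig [inj ar]]]; split=> //.
  move=> a b c ab ac bc; have := ar (a, b, c); rewrite mem_enum inE /= ab ac bc => /(_ isT).
  apply: contraNneq => D; rewrite /area /pdir /=.
  have [a2 b2 c2] := And3 (V2 a) (V2 b) (V2 c).
  apply/eqP; transitivity (vdet V a b c / (V a k2 * V b k2 * V c k2)); last by rewrite D mul0r.
  by rewrite /vdet /det3; field; rewrite a2 b2 c2.
move=> q qbd qint.
(* Extended by zero to the coning point. Rays on the boundary carry zero too, so the edges of the
   coned triangles impose nothing new. *)
pose q' (o : option 'I_n) : binq R := if o is Some a then q a else 0.
have bd0 t a : bd_2face F t -> a \in t -> q a = 0.
  move=> bd at'; apply: qbd; rewrite /interior_ray negb_and negbK; apply/orP; right.
  by apply/existsP; exists t; rewrite bd sub1set.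
have [o o' /cedgeP[oo' [x xZ /andP[ox o'x]]]|c Hc] := rig q'.
  case/cappedP: xZ ox o'x => [[s sF ->]|[t bd ->]].
    case: o o' oo' => [a|] [b|] oo'; rewrite ?emb_None // !emb_mem => sa sb.
    have ab : a != b by apply: contraNneq oo' => ->.
    have [bd|nbd] := boolP (bd_2face F [set a; b]).
      by rewrite /= !(bd0 _ _ bd) // !inE eqxx ?orbT.
    apply: qint; apply: (not_bd_int _ sF) => //; first by rewrite cards2 ab.
    by rewrite set2_sub sa.
  have z u : u \in None |: emb t -> q' u = 0.
    by case: u => [a|] //; rewrite !inE /= emb_mem => ta; exact: (bd0 t).
  by move=> /z -> /z ->.
exists c; split.
  move=> a /andP[/exists_inP[s sF]]; rewrite sub1set => sa _.
  by apply: (Hc (Some a)); apply/bigcupP; exists (emb s); rewrite ?emb_mem // facet_capped.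
move=> t bd; have /cards2P[a [b [ab tE]]] := introT eqP (bd_card bd).
have cov o : o \in None |: emb t -> o \in cover (capped F).
  by move=> ot; apply/bigcupP; exists (None |: emb t) => //; exact: bd_capped.
have z o : o \in None |: emb t -> triv c (chart z0 V o) = 0.
  move=> ot; rewrite -Hc ?cov //; case: o ot => [i|] //=; rewrite !inE /= emb_mem => it.
  exact: (bd0 t).
have ne (o o' : option 'I_n) : o != o' -> chart z0 V o != chart z0 V o'.
  by move=> oo'; apply: (inj (o, o')); rewrite mem_enum inE.
(* The trivial solution vanishes at the three distinct points of a coned boundary edge. *)
apply: (@triv_eq0 _ _ (chart z0 V None) (chart z0 V (Some a)) (chart z0 V (Some b))); rewrite ?ne //.
- by apply: z; rewrite !inE.
- by apply: z; rewrite !inE emb_mem tE !inE eqxx.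
- by apply: z; rewrite !inE emb_mem tE !inE eqxx orbT.
Qed.

End GenericFan.

(** * Squares of the edge forms *)

Section EdgeForms.
Variables (R : realType) (n : nat) (V : 'M[R]_(n, 3)) (F : {set {set 'I_n}}).
Implicit Types (a b : 'I_n) (w u : 'I_3 -> R).
Local Notation S := {mpoly R[3]}.

Definition lin w : S := (w k0)%:MP * 'X_k0 + (w k1)%:MP * 'X_k1 + (w k2)%:MP * 'X_k2.

Definition crossv a b (k : 'I_3) : R :=
  if k == k0 then V a k1 * V b k2 - V a k2 * V b k1
  else if k == k1 then V a k2 * V b k0 - V a k0 * V b k2
  else V a k0 * V b k1 - V a k1 * V b k0.

Definition vanish a w : Prop := w k0 * V a k0 + w k1 * V a k1 + w k2 * V a k2 = 0.

Lemma vanish_crossl a b : vanish a (crossv a b).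
Proof. rewrite /vanish /crossv /=; ring. Qed.

Lemma vanish_crossr a b : vanish b (crossv a b).
Proof. rewrite /vanish /crossv /=; ring. Qed.

Definition lsq a b : S := lform V [set a; b] ^+ 2.

Lemma lsq_sym a b : lsq a b = lsq b a.
Proof. by rewrite /lsq setUC. Qed.

(** [lform] takes the two rays in enumeration order; squaring removes the sign ambiguity. *)
Lemma lsqE a b : a != b -> lsq a b = lin (crossv a b) * lin (crossv a b).
Proof.
move=> ab; rewrite /lsq /lform -expr2.
have : perm_eq (enum [set a; b]) [:: a; b].
  apply: uniq_perm; rewrite ?enum_uniq //= ?inE ?ab // => i.
  by rewrite mem_enum !inE.
have detE i j : \det (\matrix_(r < 3, k < 3)
    (if r == 0 :> nat then (V i k)%:MP else if r == 1%N :> nat then (V j k)%:MP else 'X_k) : 'M[S]_3)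
    = lin (crossv i j).
  by rewrite det_mx33 /det3 /lin /crossv /=; ring.
case E : (enum _) => [|x [|y [|z r]]] P; try by move/perm_size: P.
rewrite detE; have xa := perm_mem P x; have ya := perm_mem P y; have ba := perm_mem P b; have aa := perm_mem P a.
move: xa ya aa ba; rewrite !inE !eqxx ?orbT /= => /esym/orP[] /eqP -> /esym/orP[] /eqP -> //.
- by rewrite !(eq_sym b) (negPf ab).
- by move=> _ _; rewrite /lin /crossv /=; ring.
- by rewrite (negPf ab).
Qed.

Definition ray_s a : S := 'X_k0 - (planar V a).1%:MP * 'X_k2.
Definition ray_t a : S := 'X_k1 - (planar V a).2%:MP * 'X_k2.

(** The sign convention matches [bev]: a linear form with direction [(dx, dy)] at the ray is
    [dx * t - dy * s], so its square has coefficient triple [(dx^2, 2 dx dy, dy^2)]. *)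
Definition ray_quad a (g : binq R) : S :=
  g.1.1%:MP * ray_t a ^+ 2 - g.1.2%:MP * (ray_s a * ray_t a) + g.2%:MP * ray_s a ^+ 2.

Lemma ray_quad0 a : ray_quad a 0 = 0.
Proof. by rewrite /ray_quad /= mpolyC0 !mul0r subr0 addr0. Qed.

Lemma ray_quad_is_additive a g g' : ray_quad a (g + g') = ray_quad a g + ray_quad a g'.
Proof. rewrite /ray_quad /=; ring. Qed.

Lemma ray_quad_sum a (I : Type) (r : seq I) (P : pred I) (f : I -> binq R) :
  ray_quad a (\sum_(i <- r | P i) f i) = \sum_(i <- r | P i) ray_quad a (f i).
Proof. by apply: big_morph; [exact: ray_quad_is_additive|exact: ray_quad0]. Qed.

Definition quad_of w u : binq R := (w k1 * u k1, - (w k0 * u k1 + w k1 * u k0), w k0 * u k0).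

Lemma lin_mul a w u : V a k2 != 0 -> vanish a w -> vanish a u -> lin w * lin u = ray_quad a (quad_of w u).
Proof.
move=> z0 va vu.
have E v : vanish a v -> v k2 = - (v k0 * (planar V a).1 + v k1 * (planar V a).2).
  move=> vv; apply: (mulIf z0); rewrite /planar /=.
  transitivity (- (v k0 * V a k0 + v k1 * V a k1)); last by field.
  by move: vv; rewrite /vanish; lra.
rewrite /lin (E w) // (E u) // /ray_quad /quad_of /ray_s /ray_t /=; ring.
Qed.

Hypothesis good : good_fan F V.

Lemma edge_quad a b : a != b -> lsq a b =
  ((V a k2 * V b k2) ^+ 2)%:MP *
  ray_quad a ((pdir (planar V) a b).1 ^+ 2, 2 * (pdir (planar V) a b).1 * (pdir (planar V) a b).2,
              (pdir (planar V) a b).2 ^+ 2).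
Proof.
move=> ab; rewrite lsqE // (lin_mul (good_chart good a) (vanish_crossl a b) (vanish_crossl a b)).
have E : quad_of (crossv a b) (crossv a b) = let c := (V a k2 * V b k2) ^+ 2 in
   (c * (pdir (planar V) a b).1 ^+ 2, c * (2 * (pdir (planar V) a b).1 * (pdir (planar V) a b).2),
              c * (pdir (planar V) a b).2 ^+ 2).
  have za := good_chart good a; have zb := good_chart good b.
  by rewrite /quad_of /crossv /pdir /planar /=; congr (_, _, _); field; rewrite za zb.
by rewrite E /ray_quad /=; ring.
Qed.

Lemma ray_quad_eval a g (v : 'I_3 -> R) : (ray_quad a g).@[v] =
  g.1.1 * (v k1 - (planar V a).2 * v k2) ^+ 2
  - g.1.2 * ((v k0 - (planar V a).1 * v k2) * (v k1 - (planar V a).2 * v k2))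
  + g.2 * (v k0 - (planar V a).1 * v k2) ^+ 2.
Proof.
by rewrite /ray_quad /ray_s /ray_t !expr2 !(mevalD, mevalN, mevalM, mevalC, mevalXU).
Qed.

(* A trivial solution is a linear functional on ternary quadratic forms, so it annihilates families
   of total zero; rigidity says that these are all the functionals to be tested. *)
Lemma rigid_quads (g : 'I_n -> binq R) : (forall a, ~~ interior_ray F a -> g a = 0) ->
  ((exists t, bd_2face F t) \/ \sum_a ray_quad a (g a) = 0) ->
  exists c : 'I_n -> 'I_n -> R, (forall a b, c b a = - c a b) /\
    forall a, interior_ray F a -> ray_quad a (g a) = \sum_(b | int_2face F [set a; b]) (c a b)%:MP * lsq a b.
Proof.
move=> g0 gtot.
pose J := ('I_n + 'I_n + 'I_n)%type.
pose vert (j : J) : 'I_n := match j with inl (inl a) => a | inl (inr a) => a | inr a => a end.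
pose mono (j : J) (d : R * R) : R :=
  match j with inl (inl _) => d.1 ^+ 2 | inl (inr _) => 2 * d.1 * d.2 | inr _ => d.2 ^+ 2 end.
pose dr (x : 'I_n * 'I_n) := pdir (planar V) x.1 x.2.
pose A (x : 'I_n * 'I_n) (j : J) : R :=
  if int_2face F [set x.1; x.2] && interior_ray F (vert j)
  then ((vert j == x.1)%:R - (vert j == x.2)%:R) * mono j (dr x) else 0.
pose gJ (j : J) : R := match j with inl (inl a) => (g a).1.1 | inl (inr a) => (g a).1.2 | inr a => (g a).2 end.
have sumJ (f : J -> R) : \sum_j f j = \sum_a (f (inl (inl a)) + f (inl (inr a)) + f (inr a)).
  by rewrite /J !big_sumType /= !big_split.
have [k Ak|f Hf] := @linear_duality R _ J A gJ.
  (* The middle coefficient of an edge square is [2 dx dy], while [bev] uses [dx dy]; the factor 2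
     here, and the division by 2 in [pr], account for this. *)
  pose q a : binq R := if interior_ray F a then (k (inl (inl a)), 2 * k (inl (inr a)), k (inr a)) else 0.
  have [|a b iab|c [qc cbd]] := good_rigid good (q := q).
  - by move=> a /negPf na; rewrite /q na.
  - have := Ak (a, b); rewrite sumJ /A /= iab /=.
    pose Q x := bev (q x) (dr (a, b)).
    rewrite (eq_bigr (fun x => ((x == a)%:R - (x == b)%:R) * Q x)); last first.
      by move=> x _; rewrite /Q /q /bev /=; case: ifP => _ /=; ring.
    under eq_bigr => x _ do rewrite mulrBl.
    rewrite sumrB.
    have D (z : 'I_n) : \sum_x (x == z)%:R * Q x = Q z.
      by rewrite (bigD1 z) //= eqxx mul1r big1 ?addr0 // => x /negPf ->; rewrite mul0r.
    by rewrite !D => /eqP; rewrite subr_eq0 => /eqP.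
  rewrite sumJ.
  pose pr (q g : binq R) : R := q.1.1 * g.1.1 + q.1.2 * g.1.2 / 2 + q.2 * g.2.
  rewrite (eq_bigr (fun a => pr (triv c (planar V a)) (g a))); last first.
    move=> a _; rewrite /gJ; have [ia|na] := boolP (interior_ray F a); last by rewrite g0 // /pr /=; ring.
    by rewrite -qc // /q ia /pr /=; field.
  case: gtot => [[t /cbd ->]|tot0].
    by rewrite big1 // => a _; rewrite /pr /triv /=; ring.
  (* A ternary quadratic form is determined by its values at the basis vectors and at their pairwise
     sums. [prE] writes the pairing with a trivial solution through these six values, and those of
     the total are zero. *)
  pose pt (x y z : R) (i : 'I_3) : R := if i == k0 then x else if i == k1 then y else z.
  have ev0 v : \sum_a (ray_quad a (g a)).@[v] = 0.
    by rewrite -(raddf_sum (meval v)) tot0 /= meval0.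
  case: c {qc cbd} => [[[c1 c2] c3] [[c4 c5] c6]].
  pose W (v : 'I_3 -> R) a := (ray_quad a (g a)).@[v].
  have prE a : pr (triv (c1, c2, c3, (c4, c5, c6)) (planar V a)) (g a) =
      (c3 + c2 / 2 + c4 / 2) * W (pt 1 0 0) a + (c1 + c2 / 2 - c5 / 2) * W (pt 0 1 0) a
      + (c6 + c4 / 2 - c5 / 2) * W (pt 0 0 1) a + (- c2 / 2) * W (pt 1 1 0) a
      + (- c4 / 2) * W (pt 1 0 1) a + (c5 / 2) * W (pt 0 1 1) a.
    by rewrite /W !ray_quad_eval /pr /triv /pt /=; lra.
  rewrite (eq_bigr _ (fun a _ => prE a)) !big_split /= -!mulr_sumr !ev0 !mulr0 !addr0 //.
(* Both orders of an edge occur among the equations, so the multipliers are antisymmetrized; the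
   divisor is the scalar of [edge_quad], due to normalizing last coordinates. *)
exists (fun a b => (f (a, b) - f (b, a)) / (V a k2 * V b k2) ^+ 2); split.
  move=> a b; rewrite (mulrC (V b k2)); ring.
move=> a ia.
have E m (d : R * R -> R) : (forall x, d (dr (x, a)) = d (dr (a, x))) ->
   (forall x, A x m = if int_2face F [set x.1; x.2] then ((a == x.1)%:R - (a == x.2)%:R) * d (dr x) else 0) ->
   gJ m = \sum_(b | int_2face F [set a; b]) (f (a, b) - f (b, a)) * d (dr (a, b)).
  move=> dsym Am; rewrite Hf.
  rewrite (eq_bigr (fun x : 'I_n * 'I_n => (a == x.1)%:R * (if int_2face F [set x.1; x.2] then f x * d (dr x) else 0)
     - (a == x.2)%:R * (if int_2face F [set x.1; x.2] then f x * d (dr x) else 0))); last first.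
    by move=> x _; rewrite Am; case: ifP => _; ring.
  have P1 (G : 'I_n * 'I_n -> R) : \sum_x (a == x.1)%:R * G x = \sum_b G (a, b).
    transitivity (\sum_i \sum_j (a == i)%:R * G (i, j)); first by rewrite pair_bigA; apply: eq_bigr => -[].
    rewrite (bigD1 a) //= [X in _ + X]big1 ?addr0 => [|i /negPf ina]; first by apply: eq_bigr => j _; rewrite eqxx mul1r.
    by rewrite big1 // => j _; rewrite eq_sym ina mul0r.
  have P2 (G : 'I_n * 'I_n -> R) : \sum_x (a == x.2)%:R * G x = \sum_b G (b, a).
    transitivity (\sum_i \sum_j (a == j)%:R * G (i, j)); first by rewrite pair_bigA; apply: eq_bigr => -[].
    apply: eq_bigr => i _; rewrite (bigD1 a) //= eqxx mul1r big1 ?addr0 // => j /negPf ja.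
    by rewrite eq_sym ja mul0r.
  rewrite sumrB P1 P2 -sumrB [RHS]big_mkcond; apply: eq_bigr => b _ /=.
  by rewrite (setUC [set b]); case: ifP => _; rewrite ?dsym ?subrr // mulrBl.
have gE : g a = \sum_(b | int_2face F [set a; b]) (let c := f (a, b) - f (b, a) in
   (c * (pdir (planar V) a b).1 ^+ 2, c * (2 * (pdir (planar V) a b).1 * (pdir (planar V) a b).2),
    c * (pdir (planar V) a b).2 ^+ 2) : binq R).
  have sumP (I : Type) (r : seq I) (P : pred I) (x y z : I -> R) :
      \sum_(i <- r | P i) (x i, y i, z i) = (\sum_(i <- r | P i) x i, \sum_(i <- r | P i) y i, \sum_(i <- r | P i) z i).
    by elim: r => [|i r IH]; rewrite ?big_nil // !big_cons IH; case: (P i).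
  rewrite sumP -(E (inl (inl a)) (fun d => d.1 ^+ 2)) -?(E (inl (inr a)) (fun d => 2 * d.1 * d.2)) -?(E (inr a) (fun d => d.2 ^+ 2)).
  all: try by move=> x; rewrite /A /= ia andbT.
  all: try by move=> x; rewrite /dr /pdir /=; ring.
  by rewrite /=; case: (g a) => -[].
rewrite gE ray_quad_sum; apply: eq_bigr => b iab.
have [ab _] : a != b /\ True by split=> //; case/andP: iab => /andP[_]; rewrite cards2; case: (a != b).
rewrite edge_quad // /ray_quad /=; set c := f _ - f _.
have c0 : (V a k2 * V b k2) ^+ 2 != 0 by rewrite expf_eq0 /= mulf_neq0 // (good_chart good).
have cE : c = c / (V a k2 * V b k2) ^+ 2 * (V a k2 * V b k2) ^+ 2 by rewrite divfK.
rewrite {1 2 3}cE; ring.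
Qed.

End EdgeForms.

(** * Local syzygies *)

Section Syzygies.
Variables (R : realType) (n : nat) (V : 'M[R]_(n, 3)) (F : {set {set 'I_n}}).
Implicit Types (a b : 'I_n) (w u v : 'I_3 -> R).
Local Notation S := {mpoly R[3]}.
Implicit Types (r : 'I_n -> S) (p : S).

(** The families at the rays that come from antisymmetric edge data with values in the edge ideals;
    only interior rays are compared. *)
Definition edge_boundary r : Prop := exists k : 'I_n -> 'I_n -> S,
  (forall a b, k b a = - k a b) /\
  forall a, interior_ray F a -> r a = \sum_(b | int_2face F [set a; b]) k a b * lsq V a b.

Lemma eb_ext r r' : (forall a, interior_ray F a -> r a = r' a) -> edge_boundary r -> edge_boundary r'.
Proof. by move=> e [k [ks kE]]; exists k; split=> // a ia; rewrite -e // kE. Qed.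

Lemma eb0 : edge_boundary (fun=> 0).
Proof.
exists (fun _ _ => 0); split=> [a b|a _]; first by rewrite oppr0.
by rewrite big1 // => b _; rewrite mul0r.
Qed.

Lemma eb_add r r' : edge_boundary r -> edge_boundary r' -> edge_boundary (fun a => r a + r' a).
Proof.
move=> [k [ks kE]] [k' [ks' kE']]; exists (fun a b => k a b + k' a b); split=> [a b|a ia].
  by rewrite ks ks' opprD.
by rewrite kE // kE' // -big_split; apply: eq_bigr => b _; rewrite mulrDl.
Qed.

Lemma eb_mul p r : edge_boundary r -> edge_boundary (fun a => p * r a).
Proof.
move=> [k [ks kE]]; exists (fun a b => p * k a b); split=> [a b|a ia]; first by rewrite ks mulrN.
by rewrite kE // mulr_sumr; apply: eq_bigr => b _; rewrite mulrA.
Qed.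

Lemma eb_sub r r' : edge_boundary r -> edge_boundary r' -> edge_boundary (fun a => r a - r' a).
Proof.
move=> br br'; apply: eb_ext (eb_add br (eb_mul (-1) br')) => a _.
by rewrite mulN1r.
Qed.

Lemma eb_sum (I : Type) (s : seq I) (P : pred I) (f : I -> 'I_n -> S) :
  (forall i, P i -> edge_boundary (f i)) -> edge_boundary (fun a => \sum_(i <- s | P i) f i a).
Proof.
move=> bf; elim: s => [|i s IH]; first by apply: eb_ext eb0 => a _; rewrite big_nil.
have [Pi|Pi] := boolP (P i); last by apply: eb_ext IH => a _; rewrite big_cons (negPf Pi).
by apply: eb_ext (eb_add (bf i Pi) IH) => a _; rewrite big_cons Pi.
Qed.

Definition at_ray a p : 'I_n -> S := fun x => if x == a then p else 0.

Lemma int_edge_neq a b : int_2face F [set a; b] -> a != b.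
Proof. by case/andP => /andP[_]; rewrite cards2; case: (a != b). Qed.

Lemma sum_edges_at (M : zmodType) a (f : {set 'I_n} -> M) :
  \sum_(t | int_2face F t && ([set a] \subset t)) f t = \sum_(b | int_2face F [set a; b]) f [set a; b].
Proof.
rewrite (reindex_onto (fun b => [set a; b]) (fun t => odflt a [pick b in t :\ a])) /=; last first.
  move=> t /andP[/andP[/andP[_ /eqP t2] _]]; rewrite sub1set => ta.
  case: pickP => [b|/(_ _)]; last first.
    move=> E; have /card_gt0P[b bt] : (0 < #|t :\ a|)%N by move: t2; rewrite (cardsD1 a t) ta add1n => -[->].
    by have := E b; rewrite bt.
  rewrite !inE => /andP[ba bt] /=; apply/eqP; rewrite eqEcard set2_sub ta bt t2 cards2 eq_sym ba //.
apply: eq_bigl => b; rewrite sub1set !inE eqxx /= andbT.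
have [iab|//] := boolP (int_2face F [set a; b]); have ab := int_edge_neq iab.
case: pickP => [c|/(_ b)]; last by rewrite !inE eqxx orbT andbT eq_sym ab.
by rewrite !inE => /andP[/negPf -> /= /eqP ->]; rewrite eqxx.
Qed.

Lemma in_J_ray a p : in_J V F [set a] p ->
  exists h : 'I_n -> S, p = \sum_(b | int_2face F [set a; b]) lsq V a b * h b.
Proof.
move=> [h ->]; exists (fun b => h [set a; b]).
exact: (sum_edges_at a (fun t => lform V t ^+ 2 * h t)).
Qed.

Lemma sum_at_ray a p : \sum_x at_ray a p x = p.
Proof. by rewrite (bigD1 a) //= /at_ray eqxx big1 ?addr0 // => x /negPf ->. Qed.

Lemma family_decomp r : (forall a, interior_ray F a -> in_J V F [set a] (r a)) ->
  exists h : 'I_n -> 'I_n -> S, forall x, interior_ray F x ->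
    r x = \sum_(a | interior_ray F a) \sum_(b | int_2face F [set a; b]) h a b * at_ray a (lsq V a b) x.
Proof.
move=> rJ.
pose h a : 'I_n -> S := epsilon (inhabits (fun=> 0))
  (fun h => r a = \sum_(b | int_2face F [set a; b]) lsq V a b * h b).
have hP a : interior_ray F a -> r a = \sum_(b | int_2face F [set a; b]) lsq V a b * h a b.
  by move=> ia; apply: (epsilon_spec _ (fun h => r a = \sum_(b | int_2face F [set a; b]) lsq V a b * h b)); exact: in_J_ray (rJ a ia).
exists h => x ix; rewrite (bigD1 x) //= [X in _ + X]big1 ?addr0.
  by rewrite hP //; apply: eq_bigr => b _; rewrite /at_ray eqxx mulrC.
move=> a /andP[_ ax]; rewrite big1 // => b _; by rewrite /at_ray eq_sym (negPf ax) mulr0.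
Qed.

Hypothesis good : good_fan F V.

Lemma eb_quads (g : 'I_n -> binq R) : (forall a, ~~ interior_ray F a -> g a = 0) ->
  ((exists t, bd_2face F t) \/ \sum_a ray_quad V a (g a) = 0) ->
  edge_boundary (fun a => ray_quad V a (g a)).
Proof.
move=> g0 gt; have [c [cs cE]] := rigid_quads good g0 gt.
exists (fun a b => (c a b)%:MP); split=> // a b; by rewrite cs mpolyCN.
Qed.

Lemma lin_mul_good a w u : vanish V a w -> vanish V a u -> lin w * lin u = ray_quad V a (quad_of w u).
Proof. by apply: lin_mul; exact: (good_chart good). Qed.

(** With a boundary edge present, rigidity imposes no condition on the total, so one generator
    placed at a single ray is already a boundary; multiplying by polynomials reaches all degrees. *)
Lemma disc_syzygies r t : bd_2face F t -> (forall a, interior_ray F a -> in_J V F [set a] (r a)) ->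
  edge_boundary r.
Proof.
move=> bd /family_decomp[h rE].
have H : edge_boundary (fun x => \sum_(a | interior_ray F a) \sum_(b | int_2face F [set a; b]) h a b * at_ray a (lsq V a b) x).
  apply: eb_sum => a ia; apply: eb_sum => b iab; apply: eb_mul.
  pose g x : binq R := if x == a then quad_of (crossv V a b) (crossv V a b) else 0.
  have : edge_boundary (fun x => ray_quad V x (g x)).
    by apply: eb_quads; [move=> x; rewrite /g; case: eqP => // ->; rewrite ia|left; exists t].
  apply: eb_ext => x _; rewrite /g /at_ray; case: eqP => [->|_]; last exact: ray_quad0.
  by rewrite -lin_mul_good ?lsqE ?(int_edge_neq iab) //; exact: vanish_crossl.
by apply: eb_ext H => x ix; rewrite rE.
Qed.

(** * Complete fans: linear syzygies among totals *)

Section Complete.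
Hypothesis fanF : is_simplicial_fan3 V F.
Hypothesis nobd : forall t, ~~ bd_2face F t.

Lemma cone_interior s a : s \in F -> a \in s -> interior_ray F a.
Proof.
move=> sF sa; apply/andP; split; first by apply/exists_inP; exists s; rewrite ?sub1set.
by apply/existsP => -[t]; rewrite (negPf (nobd t)).
Qed.

Lemma edge_interior a b : int_2face F [set a; b] -> interior_ray F a /\ interior_ray F b.
Proof.
case/andP => /andP[/exists_inP[s sF]]; rewrite set2_sub => /andP[sa sb] _ _.
by split; apply: (cone_interior sF).
Qed.

Lemma eb_total r : edge_boundary r -> \sum_(a | interior_ray F a) r a = 0.
Proof.
move=> [k [ks kE]]; rewrite (eq_bigr _ (fun a ia => kE a ia)).
set X := \sum_(a | _) _.
have XE : X = \sum_a \sum_(b | int_2face F [set a; b]) k a b * lsq V a b.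
  rewrite /X big_mkcond; apply: eq_bigr => a _; case: (boolP (interior_ray F a)) => // na.
  by rewrite big_pred0 // => b; apply/negP => /edge_interior[ia _]; rewrite ia in na.
have : X = - X.
  rewrite {1}XE; under eq_bigr do rewrite big_mkcond.
  rewrite exchange_big /= XE -sumrN; apply: eq_bigr => a _; rewrite -sumrN [RHS]big_mkcond.
  by apply: eq_bigr => b _; rewrite setUC; case: ifP => // _; rewrite ks lsq_sym mulNr.
move=> /eqP; rewrite -addr_eq0 -mulr2n -scaler_nat scaler_eq0 pnatr_eq0 => /eqP //.
Qed.

Definition sc (c : R) (g : binq R) : binq R := (c * g.1.1, c * g.1.2, c * g.2).

Lemma sc0 c : sc c 0 = 0.
Proof. by rewrite /sc /= !mulr0. Qed.

Lemma ray_quad_sc a c g : ray_quad V a (sc c g) = c%:MP * ray_quad V a g.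
Proof. rewrite /ray_quad /sc /=; ring. Qed.

Definition lc3 (al be ga : R) (x y z : 'I_3 -> R) : 'I_3 -> R := fun k => al * x k + be * y k + ga * z k.

Lemma lin_lc3 al be ga x y z : lin (lc3 al be ga x y z) = al%:MP * lin x + be%:MP * lin y + ga%:MP * lin z.
Proof. rewrite /lin /lc3; ring. Qed.

Definition bvec (i : 'I_3) : 'I_3 -> R := fun k => (k == i)%:R.

Lemma lin_bvec i : lin (bvec i) = 'X_i.
Proof. by elim/ord3P: i; rewrite /lin /bvec /= ?mpolyC1 ?mpolyC0 !(mul0r, mul1r, add0r, addr0). Qed.

Section Theta.
Variables (a b c e : 'I_n).
Hypotheses (ab : a != b) (ac : a != c) (bc : b != c) (ae : a != e) (be : b != e) (ce : c != e).
Hypotheses (ia : interior_ray F a) (ib : interior_ray F b) (ic : interior_ray F c) (ie : interior_ray F e).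

Let x := crossv V b c.
Let y := crossv V c a.
Let z := crossv V a b.
Let D := vdet V a b c.

Lemma bvec_dual i k : bvec i k = lc3 (V a i / D) (V b i / D) (V c i / D) x y z k.
Proof.
have D0 : D != 0 by apply: (good_vdet good).
apply: (mulIf D0); rewrite /lc3.
have -> : (V a i / D * x k + V b i / D * y k + V c i / D * z k) * D = V a i * x k + V b i * y k + V c i * z k.
  by field.
by elim/ord3P: i; elim/ord3P: k; rewrite /bvec /D /vdet /det3 /x /y /z /crossv /=; ring.
Qed.

(** Up to the factor [D], the forms [x], [y], [z] are dual to the rays [a], [b], [c]. In every
    product of two of them both factors vanish at one of these rays, so each term of ['X_k * 'X_l]
    can be stored there. *)
Lemma theta_exists : exists g : 'I_3 -> 'I_3 -> 'I_n -> binq R,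
  (forall k l o, ~~ interior_ray F o -> g k l o = 0) /\
  forall k l, \sum_o ray_quad V o (g k l o) = 'X_k * 'X_l.
Proof.
pose A k := V a k / D; pose B k := V b k / D; pose C k := V c k / D.
pose g k l o : binq R :=
  if o == a then sc (C k * C l) (quad_of z z) + sc (B k * C l + C k * B l) (quad_of y z)
  else if o == b then sc (A k * A l) (quad_of x x) + sc (A k * C l + C k * A l) (quad_of x z)
  else if o == c then sc (B k * B l) (quad_of y y) + sc (A k * B l + B k * A l) (quad_of x y)
  else 0.
exists g; split=> [k l o no|k l].
  rewrite /g; case: eqP => [E|_]; first by rewrite E ia in no.
  case: eqP => [E|_]; first by rewrite E ib in no.
  by case: eqP => // E; rewrite E ic in no.
rewrite (@sum_set3 _ _ _ a b c) //; last first.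
  by move=> i; rewrite !inE !negb_or /g => /andP[/andP[/negPf -> /negPf ->] /negPf ->]; exact: ray_quad0.
rewrite /g eqxx (eq_sym b a) (negPf ab) eqxx !(eq_sym c) (negPf ac) (negPf bc) eqxx.
rewrite !ray_quad_is_additive !ray_quad_sc -!lin_mul_good; first last.
all: try by rewrite /x /y /z; first [exact: vanish_crossl | exact: vanish_crossr].
have E i : 'X_i = (A i)%:MP * lin x + (B i)%:MP * lin y + (C i)%:MP * lin z.
  rewrite -lin_lc3 -lin_bvec; rewrite /lin !bvec_dual //.
by rewrite !E; ring.
Qed.

Variable g : 'I_3 -> 'I_3 -> 'I_n -> binq R.
Hypotheses (g_supp : forall k l o, ~~ interior_ray F o -> g k l o = 0).
Hypotheses (g_tot : forall k l, \sum_o ray_quad V o (g k l o) = 'X_k * 'X_l).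

Definition theta k l : 'I_n -> S := fun o => ray_quad V o (g k l o).

(** The bilinear extension of [theta]: families with total [lin w * lin u], that is, preimages of
    products under the total map. *)
Definition Theta w u : 'I_n -> S := fun o =>
  (w k0 * u k0)%:MP * theta k0 k0 o + (w k0 * u k1)%:MP * theta k0 k1 o + (w k0 * u k2)%:MP * theta k0 k2 o
  + (w k1 * u k0)%:MP * theta k1 k0 o + (w k1 * u k1)%:MP * theta k1 k1 o + (w k1 * u k2)%:MP * theta k1 k2 o
  + (w k2 * u k0)%:MP * theta k2 k0 o + (w k2 * u k1)%:MP * theta k2 k1 o + (w k2 * u k2)%:MP * theta k2 k2 o.

Definition Thetag w u o : binq R :=
  sc (w k0 * u k0) (g k0 k0 o) + sc (w k0 * u k1) (g k0 k1 o) + sc (w k0 * u k2) (g k0 k2 o)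
  + sc (w k1 * u k0) (g k1 k0 o) + sc (w k1 * u k1) (g k1 k1 o) + sc (w k1 * u k2) (g k1 k2 o)
  + sc (w k2 * u k0) (g k2 k0 o) + sc (w k2 * u k1) (g k2 k1 o) + sc (w k2 * u k2) (g k2 k2 o).

Lemma ThetaE w u o : Theta w u o = ray_quad V o (Thetag w u o).
Proof. by rewrite /Theta /Thetag !ray_quad_is_additive !ray_quad_sc. Qed.

Lemma Thetag_supp w u o : ~~ interior_ray F o -> Thetag w u o = 0.
Proof.
by move=> no; rewrite /Thetag !g_supp // !sc0 !addr0.
Qed.

Lemma Theta_tot w u : \sum_o Theta w u o = lin w * lin u.
Proof. by rewrite /Theta !big_split /= -!mulr_sumr /theta !g_tot /lin; ring. Qed.

Lemma Theta_bvec k l o : Theta (bvec k) (bvec l) o = theta k l o.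
Proof.
by elim/ord3P: k; elim/ord3P: l; rewrite /Theta /bvec /= !(mulr1, mulr0, mpolyC1, mpolyC0) !(mul0r, mul1r, add0r, addr0).
Qed.

Lemma Theta_lc3l al bt ga w1 w2 w3 u o : Theta (lc3 al bt ga w1 w2 w3) u o =
  al%:MP * Theta w1 u o + bt%:MP * Theta w2 u o + ga%:MP * Theta w3 u o.
Proof. rewrite /Theta /lc3; ring. Qed.

Lemma Theta_lc3r al bt ga w1 w2 w3 u o : Theta u (lc3 al bt ga w1 w2 w3) o =
  al%:MP * Theta u w1 o + bt%:MP * Theta u w2 o + ga%:MP * Theta u w3 o.
Proof. rewrite /Theta /lc3; ring. Qed.

(** Both families have degree two and the same total, so rigidity applies to their difference. *)
Lemma Theta_ray o w u : interior_ray F o -> vanish V o w -> vanish V o u ->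
  edge_boundary (fun i => Theta w u i - at_ray o (lin w * lin u) i).
Proof.
move=> io vw vu.
pose h i : binq R := Thetag w u i + (if i == o then sc (-1) (quad_of w u) else 0).
have hE i : ray_quad V i (h i) = Theta w u i - at_ray o (lin w * lin u) i.
  rewrite /h ray_quad_is_additive -ThetaE /at_ray; case: eqP => [->|_].
    by rewrite ray_quad_sc -lin_mul_good // mpolyCN mpolyC1 mulN1r.
  by rewrite ray_quad0 subr0 addr0.
have : edge_boundary (fun i => ray_quad V i (h i)).
  apply: eb_quads.
    by move=> i ni; rewrite /h Thetag_supp // add0r; case: eqP => // E; rewrite E io in ni.
  by right; under eq_bigr do rewrite hE; rewrite sumrB Theta_tot sum_at_ray subrr.
by apply: eb_ext => i _; rewrite hE.
Qed.

Lemma Theta_sym w u : edge_boundary (fun i => Theta w u i - Theta u w i).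
Proof.
pose h i : binq R := Thetag w u i + sc (-1) (Thetag u w i).
have hE i : ray_quad V i (h i) = Theta w u i - Theta u w i.
  by rewrite /h ray_quad_is_additive ray_quad_sc -!ThetaE mpolyCN mpolyC1 mulN1r.
have : edge_boundary (fun i => ray_quad V i (h i)).
  apply: eb_quads; first by move=> i ni; rewrite /h !Thetag_supp // sc0 addr0.
  by right; under eq_bigr do rewrite hE; rewrite sumrB !Theta_tot mulrC subrr.
by apply: eb_ext => i _; rewrite hE.
Qed.

(** A cubic family of total zero, the obstruction to exchanging a coefficient [lin u] with the first
    argument of [Theta]. It lies one degree above the reach of rigidity. *)
Definition Tf u w v : 'I_n -> S := fun o => lin u * Theta w v o - lin w * Theta u v o.

(** When all three forms vanish at one ray, both terms reduce to the same product placed at that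
    ray. *)
Lemma Tf_ray o u w v : interior_ray F o -> vanish V o u -> vanish V o w -> vanish V o v ->
  edge_boundary (Tf u w v).
Proof.
move=> io vu vw vv.
have := eb_sub (eb_mul (lin u) (Theta_ray io vw vv)) (eb_mul (lin w) (Theta_ray io vu vv)).
apply: eb_ext => i _; rewrite /Tf /at_ray; case: ifP => _; ring.
Qed.

Lemma Tf_anti u w v : edge_boundary (Tf u w v) -> edge_boundary (Tf w u v).
Proof. by move=> H; apply: eb_ext (eb_mul (-1) H) => i _; rewrite /Tf; ring. Qed.

Lemma Tf_cyclic u w v : edge_boundary (fun i => Tf u w v i + Tf w v u i + Tf v u w i).
Proof.
have := eb_add (eb_add (eb_mul (lin u) (Theta_sym w v)) (eb_mul (lin w) (Theta_sym v u))) (eb_mul (lin v) (Theta_sym u w)).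
by apply: eb_ext => i _; rewrite /Tf; ring.
Qed.

Lemma eb_scale_inv (s : R) r : s != 0 -> edge_boundary (fun i => s%:MP * r i) -> edge_boundary r.
Proof.
move=> s0 H; apply: eb_ext (eb_mul (s^-1)%:MP H) => i _.
by rewrite mulrA -mpolyCM mulVf // mpolyC1 mul1r.
Qed.

(** Any two of [x], [y], [z] vanish at a common ray, all three do not, so a fourth ray [e] is
    brought in. Two combinations vanishing at [e] give [E1] and [E2]; removing the terms with a
    repeated form leaves the relations [H1] and [H2]. Together with the cyclic identity they yield
    three times [Tf z x y]. *)
Lemma Tf_xyz : [/\ edge_boundary (Tf x y z), edge_boundary (Tf y z x) & edge_boundary (Tf z x y)].
Proof.
have vs := (vanish_crossl V, vanish_crossr V).
have xb : vanish V b x by exact: vs.1.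
have xc : vanish V c x by exact: vs.2.
have yc : vanish V c y by exact: vs.1.
have ya : vanish V a y by exact: vs.2.
have za : vanish V a z by exact: vs.1.
have zb : vanish V b z by exact: vs.2.
pose at_e (w : 'I_3 -> R) := w k0 * V e k0 + w k1 * V e k1 + w k2 * V e k2.
(* The values of the three forms at [e]; they are determinants of three of the four rays, nonzero by
   general position. *)
pose p := at_e x; pose q := at_e y; pose s := at_e z.
have p0 : p != 0.
  have := good_vdet good (a := e) (b := b) (c := c); rewrite !(eq_sym e) be ce bc => /(_ isT isT isT).
  by apply: contraNneq => E; apply/eqP; rewrite -[RHS]E /p /at_e /x /crossv /vdet /det3 /=; ring.
have q0 : q != 0.
  have := good_vdet good (a := a) (b := e) (c := c); rewrite ae ac (eq_sym e) ce => /(_ isT isT isT).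
  by apply: contraNneq => E; apply/eqP; rewrite -[RHS]E /q /at_e /y /crossv /vdet /det3 /=; ring.
have s0 : s != 0.
  have := good_vdet good (a := a) (b := b) (c := e); rewrite ae ab be => /(_ isT isT isT).
  by apply: contraNneq => E; apply/eqP; rewrite -[RHS]E /s /at_e /z /crossv /vdet /det3 /=; ring.
pose w1 := lc3 q (- p) 0 x y z; pose w2 := lc3 0 s (- q) x y z.
have v1 : vanish V e w1 by rewrite /vanish /w1 /lc3 /p /q /at_e; ring.
have v2 : vanish V e w2 by rewrite /vanish /w2 /lc3 /q /s /at_e; ring.
have E1 := Tf_ray ie v1 v2 v1; have E2 := Tf_ray ie v1 v2 v2.
have xyx := Tf_ray ic xc yc xc; have xyy := Tf_ray ic xc yc yc.
have xzx := Tf_ray ib xb zb xb; have xzz := Tf_ray ib xb zb zb.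
have yzy := Tf_ray ia ya za ya; have yzz := Tf_ray ia ya za za.
have H1 : edge_boundary (fun i => Tf x z y i + Tf y z x i).
  apply: (@eb_scale_inv (q ^+ 2 * p)); first by rewrite mulf_neq0 // expf_eq0.
  have := eb_sub (eb_add (eb_add (eb_add E1 (eb_mul (- (q ^+ 2 * s))%:MP xyx)) (eb_mul (q * s * p)%:MP xyy))
     (eb_mul (q ^+ 3)%:MP xzx)) (eb_mul (- (p ^+ 2 * q))%:MP yzy).
  by apply: eb_ext => i _; rewrite /Tf /w1 /w2 !lin_lc3 !Theta_lc3l !Theta_lc3r; ring.
have H2 : edge_boundary (fun i => Tf x y z i + Tf x z y i).
  apply: (@eb_scale_inv (- (q ^+ 2 * s))); first by rewrite oppr_eq0 mulf_neq0 // expf_eq0.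
  have := eb_sub (eb_add (eb_add (eb_add E2 (eb_mul (- (q * s ^+ 2))%:MP xyy)) (eb_mul (- (q ^+ 3))%:MP xzz))
     (eb_mul (- (p * q * s))%:MP yzy)) (eb_mul (- (p * q ^+ 2))%:MP yzz).
  by apply: eb_ext => i _; rewrite /Tf /w1 /w2 !lin_lc3 !Theta_lc3l !Theta_lc3r; ring.
have cyc := Tf_cyclic x y z.
have P3 : edge_boundary (Tf z x y).
  apply: (@eb_scale_inv 3); first by rewrite pnatr_eq0.
  have := eb_sub (eb_sub cyc H1) H2.
  by apply: eb_ext => i _; rewrite /Tf; ring.
split=> //.
- by apply: eb_ext (eb_add H2 P3) => i _; rewrite /Tf; ring.
- by apply: eb_ext (eb_add H1 P3) => i _; rewrite /Tf; ring.
Qed.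

(** Trilinear expansion in [x], [y], [z]: triples with a repetition fall under [Tf_ray], the others
    under [Tf_xyz]. *)
Lemma Tf_all i j k : edge_boundary (Tf (bvec i) (bvec j) (bvec k)).
Proof.
have vs := (vanish_crossl V, vanish_crossr V).
have xb : vanish V b x by exact: vs.1.
have xc : vanish V c x by exact: vs.2.
have yc : vanish V c y by exact: vs.1.
have ya : vanish V a y by exact: vs.2.
have za : vanish V a z by exact: vs.1.
have zb : vanish V b z by exact: vs.2.
have [xyz yzx zxy] := Tf_xyz.
have T3 u w : (u = x \/ u = y \/ u = z) -> (w = x \/ w = y \/ w = z) ->
    [/\ edge_boundary (Tf u w x), edge_boundary (Tf u w y) & edge_boundary (Tf u w z)].
  have cl := Tf_ray ic; have bl := Tf_ray ib; have al := Tf_ray ia.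
  case=> [->|[->|->]] [->|[->|->]]; split; try exact: cl; try exact: bl; try exact: al; try done; by apply: Tf_anti.
have lc f1 f2 f3 al bt ga : edge_boundary f1 -> edge_boundary f2 -> edge_boundary f3 ->
    edge_boundary (fun o => al%:MP * f1 o + bt%:MP * f2 o + ga%:MP * f3 o).
  by move=> h1 h2 h3; apply: eb_add; [apply: eb_add|]; apply: eb_mul.
pose A k := V a k / D; pose B k := V b k / D; pose C k := V c k / D.
pose bv i := lc3 (A i) (B i) (C i) x y z.
have T2 u w m : (u = x \/ u = y \/ u = z) -> (w = x \/ w = y \/ w = z) -> edge_boundary (Tf u w (bv m)).
  move=> hu hw; have [t1 t2 t3] := T3 u w hu hw.
  by apply: eb_ext (lc _ _ _ (A m) (B m) (C m) t1 t2 t3) => o _; rewrite /Tf /bv !Theta_lc3r; ring.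
have T1 u l m : (u = x \/ u = y \/ u = z) -> edge_boundary (Tf u (bv l) (bv m)).
  move=> hu.
  have := lc _ _ _ (A l) (B l) (C l) (T2 u x m hu (or_introl erefl)) (T2 u y m hu (or_intror (or_introl erefl))) (T2 u z m hu (or_intror (or_intror erefl))).
  by apply: eb_ext => o _; rewrite /Tf {2 5}/bv !lin_lc3 !Theta_lc3l; ring.
have := lc _ _ _ (A i) (B i) (C i) (T1 x j k (or_introl erefl)) (T1 y j k (or_intror (or_introl erefl))) (T1 z j k (or_intror (or_intror erefl))).
apply: eb_ext => o _.
have linE m : lin (bvec m) = lin (bv m) by rewrite /lin !bvec_dual.
have ThE m m' o' : Theta (bvec m) (bvec m') o' = Theta (bv m) (bv m') o' by rewrite /Theta !bvec_dual.
have e1 : lin (bv i) = (A i)%:MP * lin x + (B i)%:MP * lin y + (C i)%:MP * lin z by exact: lin_lc3.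
have e2 : Theta (bv i) (bv k) o = (A i)%:MP * Theta x (bv k) o + (B i)%:MP * Theta y (bv k) o + (C i)%:MP * Theta z (bv k) o by exact: Theta_lc3l.
by rewrite /Tf !linE !ThE e1 e2; ring.
Qed.

Definition eb_eq r r' : Prop := edge_boundary (fun o => r o - r' o).

Lemma eb_eq_trans r2 r1 r3 : eb_eq r1 r2 -> eb_eq r2 r3 -> eb_eq r1 r3.
Proof. by move=> h1 h2; apply: eb_ext (eb_add h1 h2) => o _; ring. Qed.

Definition mono (m : 'X_{1..3}) k l : 'I_n -> S := fun o => 'X_[m] * theta k l o.

Lemma mono_sym m k l : eb_eq (mono m k l) (mono m l k).
Proof.
apply: eb_ext (eb_mul 'X_[m] (Theta_sym (bvec k) (bvec l))) => o _.
by rewrite !Theta_bvec mulrBr.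
Qed.

Lemma mono_swap m i k l : eb_eq (mono (m + U_(i))%MM k l) (mono (m + U_(k))%MM i l).
Proof.
apply: eb_ext (eb_mul 'X_[m] (Tf_all i k l)) => o _.
by rewrite /mono /Tf !Theta_bvec !lin_bvec !mpolyXD mulrBr !mulrA.
Qed.

Lemma sub_unit (m : 'X_{1..3}) i : (0 < m i)%N -> exists m0, m = (m0 + U_(i))%MM.
Proof.
move=> mi; exists (m - U_(i))%MM; rewrite submK //; apply/mnm_lepP => j; rewrite mnm1E.
by case: eqP => [<-|].
Qed.

Lemma mono_eq1 m m' k l l' : (m + U_(l) = m' + U_(l'))%MM -> eb_eq (mono m k l) (mono m' k l').
Proof.
have [->|ll'] := eqVneq l l'.
  by move=> /(congr1 (fun z => z - U_(l'))%MM); rewrite !addmK => ->; apply: eb_ext eb0 => o _; rewrite subrr.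
move=> E; have /sub_unit[m0 mE] : (0 < m l')%N.
  have := congr1 (fun z : 'X_{1..3} => z l') E; rewrite !mnmDE !mnm1E eqxx (negPf ll') addn0 => ->.
  by rewrite addn1.
have m'E : m' = (m0 + U_(l))%MM.
  have : (m' + U_(l') = m0 + U_(l) + U_(l'))%MM by rewrite -E mE -!addmA (addmC U_(l')%MM).
  by move=> /(congr1 (fun z => z - U_(l'))%MM); rewrite !addmK.
rewrite mE m'E; apply: eb_eq_trans (mono_sym _ _ _) _.
apply: eb_eq_trans (mono_swap _ _ _ _) _; exact: mono_sym.
Qed.

(** Any two ways of splitting off two variables from a monomial are linked by exchanging the two
    variables and by swapping one of them with a factor of the coefficient. *)
Lemma mono_eq m m' k l k' l' : (m + U_(k) + U_(l) = m' + U_(k') + U_(l'))%MM ->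
  eb_eq (mono m k l) (mono m' k' l').
Proof.
have cancel (u v : 'X_{1..3}) i : (u + U_(i) = v + U_(i))%MM -> u = v.
  by move=> /(congr1 (fun z => z - U_(i))%MM); rewrite !addmK.
have [->|kk'] := eqVneq k k'.
  move=> E; apply: mono_eq1; apply: (cancel _ _ k').
  by move: E; rewrite -!addmA !(addmC U_(k')%MM).
have [->|lk'] := eqVneq l k'.
  move=> E; apply: eb_eq_trans (mono_sym _ _ _) _; apply: mono_eq1; apply: (cancel _ _ k').
  by rewrite E -!addmA (addmC U_(k')%MM).
move=> E; have /sub_unit[m0 mE] : (0 < m k')%N.
  have := congr1 (fun z : 'X_{1..3} => z k') E; rewrite !mnmDE !mnm1E eqxx (negPf kk') (negPf lk') !addn0 => ->.
  by rewrite addn1 addSn.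
rewrite mE; apply: eb_eq_trans (mono_swap _ _ _ _) _; apply: mono_eq1; apply: (cancel _ _ k').
move: E; rewrite mE -!addmA => E.
by rewrite (addmC U_(l')%MM) -E !addmA (addmC _ U_(k')%MM) !addmA (addmC U_(k')%MM m0).
Qed.

(* Modulo edge boundaries [X^m * theta k l] depends only on the monomial [X^m X_k X_l]; grouping by
   monomials turns the relation [sum P_kl X_k X_l = 0] into a boundary. *)
Lemma theta_relation (P : 'I_3 -> 'I_3 -> S) : \sum_k \sum_l P k l * ('X_k * 'X_l) = 0 ->
  edge_boundary (fun o => \sum_k \sum_l P k l * theta k l o).
Proof.
move=> P0.
pose rep (M : 'X_{1..3}) : 'X_{1..3} * 'I_3 * 'I_3 := epsilon (inhabits (0%MM, k0, k0))
  (fun t => (t.1.1 + U_(t.1.2) + U_(t.2))%MM = M).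
pose f M := mono (rep M).1.1 (rep M).1.2 (rep M).2.
have fE m k l : eb_eq (mono m k l) (f (m + U_(k) + U_(l))%MM).
  apply: mono_eq; apply/esym.
  apply: (epsilon_spec _ (fun t : 'X_{1..3} * 'I_3 * 'I_3 => (t.1.1 + U_(t.1.2) + U_(t.2))%MM = (m + U_(k) + U_(l))%MM)).
  by exists (m, k, l).
pose N := (\max_k \max_l msize (P k l))%N.
have PN k l : (msize (P k l) <= N)%N by apply: leq_trans (leq_bigmax k); exact: (leq_bigmax l).
have PE k l : P k l = \sum_(m : 'X_{1..3 < N}) ((P k l)@_m)%:MP * 'X_[m].
  by rewrite {1}(mpolywE (PN k l)); apply: eq_bigr => m _; rewrite mul_mpolyC.
(* The linear map sending each monomial to its chosen representative. [N] exceeds the degrees of all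
   [P k l], so [N.+2] exceeds those after multiplication by two variables. *)
pose L o (p : S) := \sum_(M : 'X_{1..3 < N.+2}) (p@_M)%:MP * f M o.
have LD o (p q : S) : L o (p + q) = L o p + L o q.
  by rewrite /L -big_split; apply: eq_bigr => M _; rewrite mcoeffD mpolyCD mulrDl.
have L0 o : L o 0 = 0 by rewrite /L big1 // => M _; rewrite mcoeff0 mpolyC0 mul0r.
have Lsum o (I : Type) (s : seq I) (G : I -> S) : L o (\sum_(i <- s) G i) = \sum_(i <- s) L o (G i).
  by apply: big_morph; [exact: LD|exact: L0].
have LX o (q : R) (m : 'X_{1..3}) : (mdeg m < N.+2)%N -> L o (q%:MP * 'X_[m]) = q%:MP * f m o.
  move=> dm; rewrite /L (bigD1 (BMultinom dm)) //= big1 ?addr0.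
    by rewrite mcoeffCM mcoeffX eqxx mulr1.
  move=> M MM; rewrite mcoeffCM mcoeffX.
  have -> : (m == M) = false by apply: contraNF MM => /eqP mM; apply/eqP/val_inj.
  by rewrite mulr0 mpolyC0 mul0r.
have LP o k l : L o (P k l * ('X_k * 'X_l)) = \sum_(m : 'X_{1..3 < N}) ((P k l)@_m)%:MP * f (m + U_(k) + U_(l))%MM o.
  rewrite {1}PE mulr_suml Lsum; apply: eq_bigr => m _.
  rewrite -mulrA -!mpolyXD -LX; first by rewrite -addmA.
  by rewrite !mdegD !mdeg1 !addn1 !ltnS; exact: (bmdeg m).
have H : edge_boundary (fun o => \sum_k \sum_l \sum_(m : 'X_{1..3 < N}) ((P k l)@_m)%:MP *
    (mono m k l o - f (m + U_(k) + U_(l))%MM o)).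
  by apply: eb_sum => k _; apply: eb_sum => l _; apply: eb_sum => m _; apply: eb_mul; exact: fE.
apply: eb_ext H => o _.
transitivity (\sum_k \sum_l P k l * theta k l o - \sum_k \sum_l L o (P k l * ('X_k * 'X_l))).
  rewrite -sumrB; apply: eq_bigr => k _; rewrite -sumrB; apply: eq_bigr => l _.
  have -> : P k l * theta k l o = \sum_(m : 'X_{1..3 < N}) ((P k l)@_m)%:MP * mono m k l o.
    by rewrite {1}PE mulr_suml; apply: eq_bigr => m _; rewrite /mono mulrA.
  by rewrite LP -sumrB; apply: eq_bigr => m _; rewrite mulrBr.
under [X in _ - X]eq_bigr do rewrite -Lsum.
by rewrite -Lsum P0 L0 subr0.
Qed.

(** Modulo boundaries each generator at a ray may be replaced by the [Theta] of its edge form with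
    itself. The family becomes a combination of the [theta k l], and total zero becomes a relation
    among the products ['X_k * 'X_l]. *)
Lemma theta_syzygies r : (forall i, interior_ray F i -> in_J V F [set i] (r i)) ->
  \sum_(i | interior_ray F i) r i = 0 -> edge_boundary r.
Proof.
move=> /family_decomp[h rE] tot0.
pose P k l : S := \sum_(i | interior_ray F i) \sum_(j | int_2face F [set i; j])
   h i j * (crossv V i j k * crossv V i j l)%:MP.
pose Y o := \sum_k \sum_l P k l * theta k l o.
have YE o : Y o = \sum_(i | interior_ray F i) \sum_(j | int_2face F [set i; j]) h i j * Theta (crossv V i j) (crossv V i j) o.
  rewrite /Y !sum3 /P !mulr_suml -!big_split /=; apply: eq_bigr => i _.
  by rewrite !mulr_suml -!big_split /=; apply: eq_bigr => j _; rewrite /Theta; ring.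
have YrB : edge_boundary (fun o => Y o - r o).
  have H : edge_boundary (fun o => \sum_(i | interior_ray F i) \sum_(j | int_2face F [set i; j])
      h i j * (Theta (crossv V i j) (crossv V i j) o - at_ray i (lin (crossv V i j) * lin (crossv V i j)) o)).
    apply: eb_sum => i ii; apply: eb_sum => j ij; apply: eb_mul.
    by apply: Theta_ray => //; exact: vanish_crossl.
  apply: eb_ext H => o io; rewrite YE rE // -sumrB; apply: eq_bigr => i _.
  rewrite -sumrB; apply: eq_bigr => j ij; rewrite mulrBr; congr (_ - _ * _).
  by rewrite lsqE // (int_edge_neq ij).
have Ytot : \sum_k \sum_l P k l * ('X_k * 'X_l) = 0.
  have := eb_total YrB; rewrite sumrB tot0 subr0 => Y0.
  transitivity (\sum_o Y o).
    rewrite /Y [RHS]exchange_big; apply: eq_bigr => k _; rewrite [RHS]exchange_big; apply: eq_bigr => l _.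
    by rewrite -mulr_sumr -g_tot.
  rewrite (bigID (interior_ray F)) /= Y0 add0r big1 // => o no.
  by rewrite /Y big1 // => k _; rewrite big1 // => l _; rewrite /theta g_supp // ray_quad0 mulr0.
have := eb_sub (theta_relation Ytot) YrB.
by apply: eb_ext => o _; rewrite /Y; ring.
Qed.

End Theta.

Lemma complete_syzygies r : F != set0 -> (forall i, interior_ray F i -> in_J V F [set i] (r i)) ->
  \sum_(i | interior_ray F i) r i = 0 -> edge_boundary r.
Proof.
case/set0Pn => s sF rJ tot0.
have [a [b [c [ab ac bc sE D]]]] := facetP fanF sF.
have sa : a \in s by rewrite sE !inE eqxx.
have sb : b \in s by rewrite sE !inE eqxx orbT.
have scc : c \in s by rewrite sE !inE eqxx orbT.
have ia := cone_interior sF sa; have ib := cone_interior sF sb; have ic := cone_interior sF scc.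
have iab := facet_edge_interior ia sF sa sb ab.
have [_ [s1 [s2 [[s1F s1a s1b] [s2F s2a s2b] s12 only _]]]] := int_edge fanF iab.
have [s' [s'F s'a s'b ss']] : exists s', [/\ s' \in F, a \in s', b \in s' & s' != s].
  by case: (only s sF sa sb) => ->; [exists s2; rewrite eq_sym|exists s1].
(* The fourth ray is the apex of the neighbouring facet across [ab]. *)
have [e [ae be s'E D']] := facet_split fanF s'F s'a s'b ab.
have ce : c != e by apply: contraNneq ss' => ce; rewrite s'E sE ce.
have ie : interior_ray F e by apply: (cone_interior s'F); rewrite s'E !inE eqxx orbT.
have [g [gs gt]] := theta_exists ab ac bc ia ib ic.
exact: (theta_syzygies ab ac bc ae be ce ia ib ic ie gs gt).
Qed.

End Complete.
End Syzygies.

(** * Dimension counting *)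

Section Dimension.
Variable R : realType.

Lemma has_qdim_leq (M : lmodType R) (P Q : M -> Prop) k l :
  has_qdim P Q k -> has_qdim P Q l -> (k <= l)%N.
Proof.
move=> [_ [_ [Qlin [Q0 [_ [B [PB [Bfree _]]]]]]]] [_ [_ [_ [_ [_ [B' [_ [_ B'gen]]]]]]]].
pose c i : 'I_l -> R := epsilon (inhabits (fun=> 0)) (fun c => Q (B i - \sum_j c j *: B' j)).
have cP i : Q (B i - \sum_j c i j *: B' j).
  by apply: (epsilon_spec _ (fun c => Q (B i - \sum_j c j *: B' j))); exact: B'gen.
pose C : 'M[R]_(k, l) := \matrix_(i, j) c i j.
suff : row_free C by rewrite /row_free => /eqP <-; exact: rank_leq_col.
apply: inj_row_free => v vC; apply/rowP => i; rewrite [RHS]mxE.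
apply: (Bfree (v 0)).
have Qsum (I : Type) (s : seq I) (f : I -> M) (x : I -> R) :
    (forall i, Q (f i)) -> Q (\sum_(i <- s) x i *: f i).
  by move=> Qf; elim: s => [|j s IH]; rewrite ?big_nil // big_cons; apply: Qlin.
have := Qsum _ (index_enum 'I_k) _ (v 0) cP.
suff -> : \sum_(j <- index_enum 'I_k) v 0 j *: (B j - \sum_j0 c j j0 *: B' j0) = \sum_j v 0 j *: B j by [].
under eq_bigr do rewrite scalerBr.
rewrite sumrB (_ : \sum_(j <- _) v 0 j *: (\sum_i0 c j i0 *: B' i0) = 0) ?subr0 //.
under eq_bigr do rewrite scaler_sumr.
rewrite exchange_big big1 //= => j _.
under eq_bigr do rewrite scalerA.
rewrite -scaler_suml; have /rowP/(_ j) := vC; rewrite !mxE => E.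
suff -> : \sum_i0 v 0 i0 * c i0 j = 0 by rewrite scale0r.
by rewrite -[RHS]E; apply: eq_bigr => i0 _; rewrite [C _ _]mxE.
Qed.

Lemma qdimE (M : lmodType R) (P Q : M -> Prop) k : has_qdim P Q k -> qdim P Q = k.
Proof.
move=> H; have H' := epsilon_spec (inhabits 0%N) _ (ex_intro _ k H).
by apply/eqP; rewrite eqn_leq (has_qdim_leq H' H) (has_qdim_leq H H').
Qed.

Lemma qdim_vspace (vT : vectType R) (M : lmodType R) (phi : {linear vT -> M}) (U W : {vspace vT})
    (P Q : M -> Prop) : injective phi -> (W <= U)%VS ->
  (forall x, P x <-> exists2 u, u \in U & x = phi u) ->
  (forall x, Q x <-> exists2 u, u \in W & x = phi u) ->
  qdim P Q = (\dim U - \dim W)%N.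
Proof.
move=> inj WU HP HQ; apply: qdimE.
have lin (X : {vspace vT}) (PX : M -> Prop) : (forall x, PX x <-> exists2 u, u \in X & x = phi u) ->
    (forall x y a, PX x -> PX y -> PX (a *: x + y)) /\ PX 0.
  move=> HX; split; last by apply/HX; exists 0; rewrite ?mem0v ?linear0.
  move=> x y a /HX[u uX ->] /HX[v vX ->]; apply/HX; exists (a *: u + v); rewrite ?linearP //.
  by rewrite memvD ?memvZ.
have [Pl P0] := lin U P HP; have [Ql Q0] := lin W Q HQ.
do 4!split=> //; split; first by move=> x /HQ[u uW ->]; apply/HP; exists u; rewrite ?(subvP WU).
have dimE : (\dim U - \dim W)%N = \dim (U :\: W).
  by rewrite -(dimv_cap_compl U W) (capv_idPr WU) addKn.
rewrite dimE; pose b := vbasis (U :\: W).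
have bU i : b`_i \in (U :\: W)%VS.
  have [lti|gei] := ltnP i (size b); first by apply: vbasis_mem; exact: mem_nth.
  by rewrite nth_default // mem0v.
exists (fun i => phi b`_i); split; [|split].
- by move=> i; apply/HP; exists b`_i => //; apply: (subvP (diffvSl U W)).
- move=> c /HQ[u uW]; have -> : \sum_i c i *: phi b`_i = phi (\sum_i c i *: b`_i).
    by rewrite linear_sum; apply: eq_bigr => i _; rewrite linearZ.
  move=> /inj E; have z : \sum_i c i *: b`_i = 0.
    apply/eqP; rewrite -memv0 -(capv_diff U W) memv_cap {2}E uW andbT.
    by apply: memv_suml => i _; rewrite memvZ.
  by apply/freeP: z; exact: (basis_free (vbasisP _)).
- move=> x /HP[u uU ->].
  have /memv_addP[v vD [w]] : u \in (U :\: W + U :&: W)%VS by rewrite addv_diff_cap.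
  rewrite memv_cap => /andP[_ wW] ->.
  exists (fun i => coord b i v); apply/HQ; exists w => //.
  rewrite linearD; suff -> : \sum_i coord b i v *: phi b`_i = phi v by rewrite addrC addKr.
  rewrite {2}(coord_vbasis vD) linear_sum; apply: eq_bigr => i _; by rewrite linearZ.
Qed.

Lemma mkhom (vT wT : vectType R) (f : vT -> wT) : linear f -> exists g : 'Hom(vT, wT), g =1 f.
Proof.
move=> lf.
pose g : {linear vT -> wT} := HB.pack f (GRing.isLinear.Build R vT wT _ f lf).
by exists (linfun g) => x; rewrite lfunE.
Qed.

(** Classically: enlarge a subspace inside [Q] by one missing vector at a time; the dimension bounds
    the process. *)
Lemma vspace_of_pred (vT : vectType R) (Q : vT -> Prop) :
  (forall x y a, Q x -> Q y -> Q (a *: x + y)) -> Q 0 ->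
  exists U : {vspace vT}, forall x, x \in U <-> Q x.
Proof.
move=> Ql Q0.
suff H k (U : {vspace vT}) : (\dim {:vT} - \dim U <= k)%N -> (forall x, x \in U -> Q x) ->
    exists U' : {vspace vT}, forall x, x \in U' <-> Q x.
  by apply: (H _ 0%VS (leqnn _)) => x; rewrite memv0 => /eqP ->.
elim: k U => [|k IH] U dU UQ.
  exists U => x; split; first exact: UQ.
  move=> _; have /eqP -> : (U == fullv)%VS; last exact: memvf.
  by rewrite eqEdim subvf /=; move: dU; rewrite leqn0 subn_eq0.
have [H|H] := Classical_Prop.classic (forall x, Q x -> x \in U).
  by exists U => x; split; [exact: UQ|exact: H].
have [x Hx] := Classical_Pred_Type.not_all_ex_not _ _ H.
have [Qx xU] := Classical_Prop.imply_to_and _ _ Hx.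
apply: (IH (U + <[x]>)%VS).
  have lt : (\dim U < \dim (U + <[x]>))%N.
    rewrite ltnNge; apply/negP => le; apply: xU.
    have /eqP -> : (U == U + <[x]>)%VS by rewrite eqEdim addvSl le.
    by apply: (subvP (addvSr _ _)); exact: memv_line.
  have := dimvS (subvf U); have := dimvS (subvf (U + <[x]>)%VS); lia.
move=> y /memv_addP[u uU [v /vlineP[c ->] ->]]; rewrite addrC; apply: Ql => //; exact: UQ.
Qed.

Lemma prod_space (I : finType) (vT : vectType R) (U : I -> {vspace vT}) :
  exists X : {vspace {ffun I -> vT}}, (forall f, f \in X <-> forall i, f i \in U i) /\
    \dim X = (\sum_i \dim (U i))%N.
Proof.
have [dl dlE] : exists dl : I -> 'Hom(vT, {ffun I -> vT}), forall i w, dl i w = [ffun j => if j == i then w else 0].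
  have H i : exists g : 'Hom(vT, {ffun I -> vT}), forall w, g w = [ffun j => if j == i then w else 0].
    apply: mkhom => a u v; apply/ffunP => j; rewrite !ffunE; case: ifP => // _.
    by rewrite scaler0 addr0.
  pose dl i := epsilon (inhabits (0 : 'Hom(vT, {ffun I -> vT}))) (fun g => forall w, g w = [ffun j => if j == i then w else 0]).
  by exists dl => i; exact: (epsilon_spec _ _ (H i)).
exists (\sum_i (dl i @: U i))%VS; split.
  move=> f; split.
    move=> /memv_sumP[g gU ->] i; rewrite sum_ffunE; apply: memv_suml => j _.
    have /memv_imgP[u uU ->] := gU j isT; rewrite dlE ffunE; case: eqP => [->//|_]; exact: mem0v.
  move=> fU; apply/memv_sumP; exists (fun i => dl i (f i)).
    by move=> i _; apply: memv_img.
  apply/ffunP => j; rewrite sum_ffunE (bigD1 j) //= big1 ?addr0; first by rewrite dlE ffunE eqxx.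
  by move=> i /negPf ij; rewrite dlE ffunE eq_sym ij.
have /directvP /= -> : directv (\sum_i (dl i @: U i)).
  apply/directv_sum_independent => us usU us0 i _.
  have /memv_imgP[u uU E] := usU i isT.
  suff u0 : u = 0 by rewrite E u0 linear0.
  have := congr1 (fun f : {ffun I -> vT} => f i) us0; rewrite sum_ffunE (bigD1 i) //= big1 ?addr0.
    by rewrite E dlE !ffunE eqxx.
  move=> j /negPf ji; have /memv_imgP[v vU ->] := usU j isT.
  by rewrite dlE ffunE eq_sym ji.
apply: eq_bigr => i _; apply: limg_dim_eq; apply/eqP; rewrite -subv0; apply/subvP => u.
rewrite memv_cap memv_ker memv0 => /andP[_ /eqP].
by move/(congr1 (fun f : {ffun I -> vT} => f i)); rewrite dlE !ffunE eqxx => ->.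
Qed.

(** The count for one stage of the complex, with [K] the ideal part of the target. The first term is
    the kernel of the map to the quotient by [K], the second its image enlarged by [K]. *)
Lemma dim_preim (vT wT : vectType R) (f : 'Hom(vT, wT)) (U : {vspace vT}) (K : {vspace wT}) :
  (\dim (U :&: f @^-1: K) + \dim (f @: U + K) = \dim U + \dim K)%N.
Proof.
set X := (U :&: f @^-1: K)%VS.
have kE : (X :&: lker f = U :&: lker f)%VS.
  apply/eqP; rewrite eqEsubv; apply/andP; split; first by rewrite capvS // capvSl.
  rewrite subv_cap capvSr andbT subv_cap capvSl /=; apply/subvP => x.
  by rewrite memv_cap memv_ker -memv_preim => /andP[_ /eqP ->]; exact: mem0v.
have iE : (f @: X = f @: U :&: K)%VS.
  apply/eqP; rewrite eqEsubv; apply/andP; split.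
    rewrite subv_cap limgS ?capvSl //=; apply/subvP => y /memv_imgP[x].
    by rewrite memv_cap -memv_preim => /andP[_ fx] ->.
  apply/subvP => y; rewrite memv_cap => /andP[/memv_imgP[x xU ->] yK].
  by apply: memv_img; rewrite memv_cap xU -memv_preim.
have h1 := limg_ker_dim f X; have h2 := limg_ker_dim f U.
have h3 := dimv_sum_cap (f @: U) K.
by rewrite kE iE in h1; lia.
Qed.

End Dimension.

(** * Exactness and the Euler characteristic *)

Section Ideals.
Variables (R : realType) (n : nat) (V : 'M[R]_(n, 3)) (F : {set {set 'I_n}}).
Local Notation S := {mpoly R[3]}.
Implicit Types (g t : {set 'I_n}) (p q : S).

Lemma in_J_lin g p q c : in_J V F g p -> in_J V F g q -> in_J V F g (c *: p + q).
Proof.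
move=> [h ->] [h' ->]; exists (fun t => c *: h t + h' t).
by rewrite scaler_sumr -big_split; apply: eq_bigr => t _; rewrite mulrDr scalerAr.
Qed.

Lemma in_J0 g : in_J V F g 0.
Proof. by exists (fun=> 0); rewrite big1 // => t _; rewrite mulr0. Qed.

Lemma in_J_sub g g' p : g \subset g' -> in_J V F g' p -> in_J V F g p.
Proof.
move=> gg' [h ->]; exists (fun t => if g' \subset t then h t else 0).
rewrite big_mkcond [RHS]big_mkcond; apply: eq_bigr => t _.
case: (int_2face F t) => //=; have [g't|] := boolP (g' \subset t); last by rewrite mulr0; case: ifP.
by rewrite (subset_trans gg' g't).
Qed.

Lemma in_J_edge a b p : int_2face F [set a; b] ->
  in_J V F [set a; b] p <-> exists h, p = lsq V a b * h.
Proof.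
move=> iab.
have E (f : {set 'I_n} -> S) : \sum_(t | int_2face F t && ([set a; b] \subset t)) lform V t ^+ 2 * f t = lsq V a b * f [set a; b].
  rewrite (big_pred1 [set a; b]) // => t; apply/andP/eqP => [[it st]|->]; last by rewrite iab subxx.
  apply/eqP; rewrite eq_sym eqEcard st /=.
  by case/andP: it => /andP[_ /eqP ->] _; case/andP: iab => /andP[_ /eqP ->].
by split=> [[h ->]|[h ->]]; [exists (h [set a; b])|exists (fun=> h)]; rewrite E.
Qed.

Lemma lin_homog (w : 'I_3 -> R) : lin w \is 1%N.-homog.
Proof.
have X k : ('X_k : S) \is 1%N.-homog by rewrite dhomogX; apply/eqP; exact: (mdeg1 k).
by rewrite /lin !mul_mpolyC !rpredD // rpredZ // X.
Qed.

Lemma lsq_homog a b : a != b -> lsq V a b \is 2%N.-homog.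
Proof. by move=> ab; rewrite lsqE // (dhomogM (lin_homog _) (lin_homog _)). Qed.

(** Used to cut multipliers down to degree [d] without leaving the ideal of an edge. *)
Lemma pihomog_mul (d e : nat) p q : q \is e.-homog ->
  exists p', pihomog mdeg d (p * q) = p' * q.
Proof.
move=> hq; pose k := msize p.
exists (\sum_(i < k | (i + e == d)%N) pihomog mdeg i p).
rewrite {1}(@pihomog_partitionE _ _ mdeg k p) // mulr_suml raddf_sum mulr_suml [RHS]big_mkcond.
apply: eq_bigr => i _; have hi := dhomogM (pihomogP mdeg i p) hq.
case: eqP => [E|/eqP ne]; first by apply: pihomog_dE; rewrite -E.
exact: (pihomog_ne0 ne hi).
Qed.

End Ideals.

Section Exactness.
Variables (R : realType) (n : nat) (V : 'M[R]_(n, 3)) (F : {set {set 'I_n}}) (d : nat).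
Hypotheses (good : good_fan F V) (fanF : is_simplicial_fan3 V F) (herF : hereditary F).
Hypotheses (scF : simply_connected (link_set V F)) (F0 : F != set0).
Local Notation S := {mpoly R[3]}.
Local Notation W := (dhomog 3 R d).
Implicit Types (a b : 'I_n) (s : {set 'I_n}) (f : {ffun {set 'I_n} -> W})
  (h : {ffun 'I_n * 'I_n -> W}) (q : {ffun 'I_n -> W}).

(** Each interior edge is stored once, with increasing endpoints; [ext] recovers the antisymmetric
    data. *)
Definition okp (x : 'I_n * 'I_n) : bool := (x.1 < x.2)%N && int_2face F [set x.1; x.2].

Definition ext h a b : W := if (a < b)%N then h (a, b) else - h (b, a).

Definition facet_map f : {ffun 'I_n * 'I_n -> W} := [ffun x => if okp x then
  \sum_(s in F | (x.1 \in s) && (x.2 \in s)) orient V x.1 x.2 s *: f s else 0].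

Definition edge_map h : {ffun 'I_n -> W} := [ffun a => if interior_ray F a then
  \sum_(b | int_2face F [set a; b]) ext h a b else 0].

Definition ray_map q : W := \sum_(a | interior_ray F a) q a.

Lemma facet_map_linear : linear facet_map.
Proof.
move=> c f f'; apply/ffunP => x; rewrite !ffunE; case: ifP => _; last by rewrite scaler0 addr0.
rewrite scaler_sumr -big_split; apply: eq_bigr => s _.
by rewrite !ffunE scalerDr !scalerA mulrC.
Qed.

Lemma ext_linear c h h' a b : ext (c *: h + h') a b = c *: ext h a b + ext h' a b.
Proof. by rewrite /ext; case: ifP => _; rewrite !ffunE // opprD scalerN. Qed.

Lemma edge_map_linear : linear edge_map.
Proof.
move=> c h h'; apply/ffunP => x; rewrite !ffunE; case: ifP => _; last by rewrite scaler0 addr0.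
by rewrite scaler_sumr -big_split; apply: eq_bigr => b _; rewrite ext_linear.
Qed.

Lemma ray_map_linear : linear ray_map.
Proof.
by move=> c q q'; rewrite /ray_map scaler_sumr -big_split; apply: eq_bigr => a _; rewrite !ffunE.
Qed.

Lemma ext_antisym h a b : a != b -> ext h b a = - ext h a b.
Proof.
by move=> ab; rewrite /ext; case: (ltngtP a b) => [_|_|/val_inj E]; rewrite ?opprK //; rewrite E eqxx in ab.
Qed.

Lemma int_neq_ord a b : int_2face F [set a; b] -> (a < b)%N || (b < a)%N.
Proof. by move=> /int_edge_neq; rewrite -neq_ltn. Qed.

Lemma ext_facet_map f a b : int_2face F [set a; b] ->
  ext (facet_map f) a b = \sum_(s in F | (a \in s) && (b \in s)) orient V a b s *: f s.
Proof.
move=> iab; rewrite /ext !ffunE /okp /= (setUC [set b]) iab !andbT.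
have [ab|ba|/val_inj E] := ltngtP a b => //; last by have := int_edge_neq iab; rewrite E eqxx.
rewrite -sumrN; apply: eq_big => [s|s _]; first by rewrite (andbC (b \in s)).
by rewrite (orient_antisym V a b) scaleNr opprK.
Qed.

Lemma edge_facet_map f : edge_map (facet_map f) = 0.
Proof.
apply/ffunP => a; rewrite !ffunE; case: ifP => // ia.
rewrite (eq_bigr (fun b => \sum_(s in F | (a \in s) && (b \in s)) orient V a b s *: f s)); last first.
  by move=> b iab; rewrite ext_facet_map.
pose G b s : W := if [&& int_2face F [set a; b], s \in F, a \in s & b \in s] then orient V a b s *: f s else 0.
transitivity (\sum_b \sum_s G b s).
  rewrite big_mkcond; apply: eq_bigr => b _; rewrite /G; case: ifP => _ /=; last by rewrite big1.
  by rewrite big_mkcond.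
rewrite exchange_big big1 //= => s _.
have [sF|nF] := boolP (s \in F); last by rewrite big1 // => b _; rewrite /G (negPf nF) andbF.
have [sa|na] := boolP (a \in s); last by rewrite big1 // => b _; rewrite /G (negPf na) !andbF.
have [/(_ s sF)[s3 _] _] := fanF.
have /card_gt0P[b] : (0 < #|s :\ a|)%N by move: s3; rewrite (cardsD1 a s) sa add1n => -[->].
rewrite !inE => /andP[ba sb]; have ab : a != b by rewrite eq_sym.
have [c [ac bc sE _]] := facet_split fanF sF sa sb ab.
have scc : c \in s by rewrite sE !inE eqxx orbT.
rewrite (@sum_set3 _ _ _ a b c) //; last by move=> i; rewrite -sE /G => /negPf ->; rewrite !andbF.
have -> : G a s = 0.
  by rewrite /G; case: ifP => // /andP[/int_edge_neq]; rewrite eqxx.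
rewrite add0r /G !(facet_edge_interior ia sF sa) // sF sa sb scc /=.
by rewrite {1}sE orient_cycle // -sE scaleNr addNr.
Qed.

Lemma vector_potential (H : 'I_n -> 'I_n -> W) : (forall a b, H b a = - H a b) ->
  (forall a, interior_ray F a -> \sum_(b | int_2face F [set a; b]) H a b = 0) ->
  exists f : {set 'I_n} -> W, forall a b, int_2face F [set a; b] ->
    \sum_(s in F | (a \in s) && (b \in s)) orient V a b s *: f s = H a b.
Proof.
move=> Has Hint; pose e := vbasis (fullv : {vspace W}).
pose P i (u : {set 'I_n} -> R) := forall a b, int_2face F [set a; b] ->
   \sum_(s in F | (a \in s) && (b \in s)) orient V a b s * u s = coord e i (H a b).
have ex i : exists u, P i u.
  apply: (global_potential fanF herF scF (G := fun a b => coord e i (H a b))) => [a b|a ia].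
    by rewrite Has raddfN.
  by rewrite -raddf_sum Hint //= raddf0.
pose u i := epsilon (inhabits (fun=> 0)) (P i).
have uP i : P i (u i) by exact: epsilon_spec.
exists (fun s => \sum_i u i s *: e`_i) => a b iab.
rewrite [RHS](coord_vbasis (memvf (H a b))).
under eq_bigr do rewrite scaler_sumr.
rewrite exchange_big /=; apply: eq_bigr => i _.
by rewrite -(uP i a b iab) scaler_suml; apply: eq_bigr => s _; rewrite scalerA.
Qed.

Lemma edge_map_total h : (forall t, ~~ bd_2face F t) -> ray_map (edge_map h) = 0.
Proof.
move=> nobd; rewrite /ray_map.
pose X := \sum_a \sum_(b | int_2face F [set a; b]) ext h a b.
have -> : \sum_(a | interior_ray F a) edge_map h a = X.
  rewrite big_mkcond; apply: eq_bigr => a _; rewrite ffunE; case: (boolP (interior_ray F a)) => // na.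
  by rewrite big_pred0 // => b; apply/negP => /(edge_interior nobd)[ia _]; rewrite ia in na.
have : X = - X.
  rewrite {1}/X; under eq_bigr do rewrite big_mkcond.
  rewrite exchange_big /= /X -sumrN; apply: eq_bigr => a _; rewrite -sumrN [RHS]big_mkcond.
  by apply: eq_bigr => b _; rewrite setUC; case: ifP => // iab; rewrite ext_antisym ?opprK // (int_edge_neq iab).
by move=> /eqP; rewrite -addr_eq0 -mulr2n -scaler_nat scaler_eq0 pnatr_eq0 => /eqP.
Qed.

Lemma homog_val (p : W) : (p : S) \is d.-homog.
Proof. exact: dhomog_is_dhomog. Qed.

(* Exactness at the edges: correct the edge data by multiples of the squared edge forms to make it
   closed, then integrate. *)
Lemma exact_edges h : (forall x, ~~ okp x -> h x = 0) ->
  (forall a, interior_ray F a -> in_J V F [set a] (edge_map h a)) ->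
  exists f, (forall s, s \notin F -> f s = 0) /\ exists j : {ffun 'I_n * 'I_n -> W},
    [/\ h = facet_map f + j, forall x, ~~ okp x -> j x = 0 &
        forall a b, okp (a, b) -> in_J V F [set a; b] (j (a, b))].
Proof.
move=> hs hJ.
have [k [ks kE]] : edge_boundary V F (fun a => edge_map h a : S).
  have [/existsP[t bd]|/existsPn nobd] := boolP [exists t, bd_2face F t].
    exact: (disc_syzygies good bd).
  apply: (complete_syzygies good fanF nobd F0) => //.
  have := congr1 (fun p : W => p : S) (edge_map_total h nobd).
  by rewrite /ray_map raddf_sum.
pose jh a b : W := DHomog (pihomogP mdeg d (k a b * lsq V a b)).
pose j : {ffun 'I_n * 'I_n -> W} := [ffun x => if okp x then jh x.1 x.2 else 0].
have jas a b : jh b a = - jh a b.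
  by apply: val_inj => /=; rewrite ks lsq_sym mulNr raddfN.
have extj a b : int_2face F [set a; b] -> ext j a b = jh a b.
  move=> iab; rewrite /ext !ffunE /okp /= (setUC [set b]) iab !andbT.
  by have [ab|ba|/val_inj E] := ltngtP a b; [|rewrite jas opprK|have := int_edge_neq iab; rewrite E eqxx].
have jJ a b : int_2face F [set a; b] -> in_J V F [set a; b] (jh a b).
  move=> iab; apply/in_J_edge => //.
  have [p' E] := pihomog_mul d (k a b) (lsq_homog V (int_edge_neq iab)).
  by exists p'; rewrite /= E mulrC.
have dj a : interior_ray F a -> \sum_(b | int_2face F [set a; b]) ext j a b = edge_map h a.
  move=> ia; apply: val_inj; rewrite /= raddf_sum /=.
  rewrite -[RHS](pihomog_dE (mf := mdeg) (homog_val _)) kE // raddf_sum; apply: eq_bigr => b iab.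
  by rewrite extj.
pose h' := h - j.
have ext' a b : ext h' a b = ext h a b - ext j a b.
  by rewrite /h' -[h - j]addrC -scaleN1r ext_linear scaleN1r addrC.
(* [ext] at equal endpoints is minus the diagonal entry, so full antisymmetry needs this. *)
have diag a : h' (a, a) = 0 by rewrite !ffunE hs /okp /= ?ltnn // subrr.
have has a b : ext h' b a = - ext h' a b.
  have [->|ab] := eqVneq a b; last exact: ext_antisym.
  by rewrite /ext ltnn diag !oppr0.
have [a ia|f Hf] := vector_potential has.
  under eq_bigr do rewrite ext'.
  by rewrite sumrB dj // ffunE ia subrr.
exists [ffun s => if s \in F then f s else 0]; split; first by move=> s /negPf ns; rewrite ffunE ns.
exists j; split; first last.
- by move=> a b ok; rewrite ffunE ok; apply: jJ; case/andP: ok.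
- by move=> x /negPf nx; rewrite ffunE nx.
apply/ffunP => -[a b]; rewrite [RHS]ffunE [X in X + _]ffunE.
have [ok|no] := boolP (okp (a, b)); last by rewrite hs // ffunE (negPf no) addr0.
have iab : int_2face F [set a; b] by case/andP: ok.
have ab : (a < b)%N by case/andP: ok.
rewrite (eq_bigr (fun s => orient V a b s *: f s)); last by move=> s /andP[sF _]; rewrite ffunE sF.
by rewrite Hf // ext' /ext ab subrK.
Qed.

(** * Exactness at the rays and at the origin *)

Definition at_int a (w : W) : {ffun 'I_n -> W} := [ffun x => if (x == a) && interior_ray F a then w else 0].

Definition hit q : Prop := exists2 h : {ffun 'I_n * 'I_n -> W}, (forall x, ~~ okp x -> h x = 0) & edge_map h = q.

Lemma hit_lin c q q' : hit q -> hit q' -> hit (c *: q + q').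
Proof.
move=> [h hs <-] [h' hs' <-]; exists (c *: h + h'); last by rewrite edge_map_linear.
by move=> x nx; rewrite !ffunE hs // hs' // scaler0 addr0.
Qed.

Lemma hit0 : hit 0.
Proof.
exists 0; first by move=> x _; rewrite ffunE.
by have := edge_map_linear (-1) 0 0; rewrite scaler0 addr0 scaleN1r addNr.
Qed.

Lemma hit_edge a b w : int_2face F [set a; b] -> hit (at_int a w - at_int b w).
Proof.
wlog ab : a b w / (a < b)%N => [H|] iab.
  case/orP: (int_neq_ord iab) => [ab|ba]; first exact: H.
  rewrite setUC in iab; have := hit_lin (-1) (H b a w ba iab) hit0.
  by rewrite addr0 scaleN1r opprB.
exists [ffun x => if x == (a, b) then w else 0].
  by move=> x; rewrite ffunE; case: eqP => // ->; rewrite /okp /= ab iab.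
have ne := int_edge_neq iab; have nba : (b < a)%N = false by rewrite ltnNge ltnW.
apply/ffunP => x; rewrite !ffunE.
have E y z : ext [ffun x => if x == (a, b) then w else 0] y z =
    (if (y == a) && (z == b) then w else 0) - (if (y == b) && (z == a) then w else 0).
  rewrite /ext !ffunE !xpair_eqE; case: (ltnP y z) => yz.
    case: (boolP ((y == b) && _)) => [/andP[/eqP yb /eqP za]|_]; last by rewrite subr0.
    by move: yz; rewrite yb za nba.
  case: (boolP ((y == a) && _)) => [/andP[/eqP ya /eqP zb]|_]; last by rewrite sub0r andbC.
  by move: yz; rewrite ya zb leqNgt ab.
have sumE y z (u v : 'I_n) : \sum_(o | int_2face F [set y; o]) (if (y == u) && (o == v) then z else 0 : W) =
    if (y == u) && int_2face F [set y; v] then z else 0.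
  case: eqP => [_|_] /=; last by rewrite big1.
  rewrite big_mkcond (bigD1 v) //= eqxx big1 ?addr0 // => o /negPf ->; by case: ifP.
case: (boolP (interior_ray F x)) => ix.
  rewrite (eq_bigr _ (fun z _ => E x z)) sumrB !sumE.
  congr (_ - _); case: eqP => [xa|] //=; rewrite -xa ix.
    by rewrite xa iab.
  by rewrite xa setUC iab.
by case: eqP => [<-|] /=; case: eqP => [<-|] /=; rewrite ?(negPf ix) subrr.
Qed.

(** A value can be moved along interior edges within a facet, and from facet to facet by
    [hereditary] at the empty face. Along a boundary edge nothing is to be moved, since [at_int] is
    zero at both ends. *)
Lemma hit_rays s s' a b w : s \in F -> s' \in F -> a \in s -> b \in s' -> hit (at_int a w - at_int b w).
Proof.
move=> sF s'F sa s'b.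
have tr x y z : hit (at_int x w - at_int y w) -> hit (at_int y w - at_int z w) -> hit (at_int x w - at_int z w).
  by move=> h1 h2; have := hit_lin 1 h1 h2; rewrite scale1r addrA subrK.
have loc r x y : r \in F -> x \in r -> y \in r -> hit (at_int x w - at_int y w).
  move=> rF rx ry; have [->|xy] := eqVneq x y; first by rewrite subrr; exact: hit0.
  have [bd|nbd] := boolP (bd_2face F [set x; y]); last first.
    apply: hit_edge; apply: (not_bd_int _ rF) => //; first by rewrite cards2 xy.
    by rewrite set2_sub rx ry.
  have z u : u \in [set x; y] -> at_int u w = 0.
    move=> ub; apply/ffunP => v; rewrite !ffunE /interior_ray.
    suff -> : in_boundary F [set u] by rewrite !andbF.
    by apply/existsP; exists [set x; y]; rewrite bd sub1set.
  by rewrite !z ?subrr ?inE ?eqxx ?orbT //; exact: hit0.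
pose P (r : {set 'I_n}) : Prop := forall x, x \in r -> hit (at_int a w - at_int x w).
(* [star_constant] wants values in a type with decidable equality, hence the boolean version. *)
pose Pb r : bool := if excluded_middle_informative (P r) then true else false.
have PbP r : Pb r <-> P r by rewrite /Pb; case: excluded_middle_informative.
have : Pb s = Pb s'.
  apply: (@star_constant _ F herF _ set0); rewrite ?sub0set //.
    by apply/exists_inP; exists s; rewrite ?sub0set.
  have main r r' : r \in F -> r' \in F -> #|r :&: r'| = 2%N -> P r -> P r'.
    move=> rF r'F c2 Pr x r'x.
    have /card_gt0P[y] : (0 < #|r :&: r'|)%N by rewrite c2.
    by rewrite inE => /andP[ry r'y]; apply: (tr _ y) (Pr y ry) _; exact: (loc r').
  move=> r r' rF r'F _ _ c2; apply/idP/idP => /PbP Pr; apply/PbP.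
    exact: (main r).
  by apply: (main r') => //; rewrite setIC.
have Ps : Pb s by apply/PbP => x sx; exact: (loc s).
by rewrite Ps => /esym/PbP; apply.
Qed.

Lemma at_int_decomp q : (forall a, ~~ interior_ray F a -> q a = 0) -> q = \sum_a at_int a (q a).
Proof.
move=> qs; apply/ffunP => x; rewrite sum_ffunE (bigD1 x) //= ffunE eqxx /= big1 ?addr0.
  by case: ifP => // /negbT /qs.
by move=> y /negPf yx; rewrite ffunE eq_sym yx.
Qed.

Lemma hit_sum (I : Type) (r : seq I) (Q : I -> {ffun 'I_n -> W}) :
  (forall i, hit (Q i)) -> hit (\sum_(i <- r) Q i).
Proof.
move=> HQ; elim: r => [|i r IH]; first by rewrite big_nil; exact: hit0.
by rewrite big_cons -[Q i]scale1r; apply: hit_lin.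
Qed.

Lemma interior_facet a : interior_ray F a -> exists2 s, s \in F & a \in s.
Proof. by case/andP => /exists_inP[s sF]; rewrite sub1set; exists s. Qed.

(** Move every value to a ray on the boundary, where it disappears. *)
Lemma exact_rays_disc q t : bd_2face F t -> (forall a, ~~ interior_ray F a -> q a = 0) -> hit q.
Proof.
move=> bd qs; rewrite (at_int_decomp qs); apply: hit_sum => a.
have [ia|na] := boolP (interior_ray F a); last first.
  rewrite (_ : at_int _ _ = 0); first exact: hit0.
  by apply/ffunP => x; rewrite !ffunE (negPf na) andbF.
have [s sF sa] := interior_facet ia.
case/andP: (bd) => /andP[/exists_inP[s' s'F ts'] /eqP t2] _.
have /card_gt0P[b bt] : (0 < #|t|)%N by rewrite t2.
have := hit_rays (q a) sF s'F sa (subsetP ts' _ bt).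
suff -> : at_int b (q a) = 0 by rewrite subr0.
apply/ffunP => x; rewrite !ffunE /interior_ray (_ : in_boundary F [set b]) ?andbF //.
by apply/existsP; exists t; rewrite bd sub1set.
Qed.

Lemma hit_total q : (forall a, ~~ interior_ray F a -> q a = 0) -> ray_map q = 0 -> hit q.
Proof.
move=> qs tot0.
have [a0 [s0 [s0F s0a]]] : exists a s, s \in F /\ a \in s.
  case/set0Pn: F0 => s sF; have [a [b [c [_ _ _ sE _]]]] := facetP fanF sF.
  by exists a, s; split=> //; rewrite sE !inE eqxx.
have -> : q = \sum_a (at_int a (q a) - at_int a0 (q a)).
  rewrite sumrB -at_int_decomp // (_ : \sum_a at_int a0 (q a) = 0) ?subr0 //.
  apply/ffunP => x; rewrite sum_ffunE !ffunE.
  under eq_bigr do rewrite ffunE.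
  case: (_ && _); last by rewrite big1.
  rewrite -[RHS]tot0 /ray_map [RHS]big_mkcond; apply: eq_bigr => a _.
  by case: ifP => // /negbT /qs.
apply: hit_sum => a; have [ia|na] := boolP (interior_ray F a).
  by have [s sF sa] := interior_facet ia; exact: (hit_rays _ sF s0F sa s0a).
rewrite qs //; have z y : at_int y 0 = 0 by apply/ffunP => x; rewrite !ffunE; case: ifP.
by rewrite !z subrr; exact: hit0.
Qed.

Lemma in_J_sum g (I : Type) (r : seq I) (P : pred I) (p : I -> S) :
  (forall i, P i -> in_J V F g (p i)) -> in_J V F g (\sum_(i <- r | P i) p i).
Proof.
move=> H; elim: r => [|i r IH]; first by rewrite big_nil; exact: in_J0.
by rewrite big_cons; case: ifP => // Pi; rewrite -[p i]scale1r; apply: in_J_lin => //; exact: H.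
Qed.

(** The ideal at the origin is the sum of the edge ideals. The part belonging to an edge is placed
    at one chosen endpoint; subtracting these leaves total zero, which [hit_total] gathers at a
    single ray. *)
Lemma exact_rays_complete q : (forall t, ~~ bd_2face F t) ->
  (forall a, ~~ interior_ray F a -> q a = 0) -> in_J V F set0 (ray_map q) ->
  exists2 j : {ffun 'I_n -> W}, (forall a, ~~ interior_ray F a -> j a = 0) /\
     (forall a, in_J V F [set a] (j a)) & hit (q - j).
Proof.
move=> nobd qs [k kE].
pose jt t : W := DHomog (pihomogP mdeg d (lform V t ^+ 2 * k t)).
have [a0 [s0 [s0F s0a]]] : exists a s, s \in F /\ a \in s.
  case/set0Pn: F0 => s sF; have [a [b [c [_ _ _ sE _]]]] := facetP fanF sF.
  by exists a, s; split=> //; rewrite sE !inE eqxx.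
pose v (t : {set 'I_n}) := odflt a0 [pick a in t].
have vt t : int_2face F t -> v t \in t.
  case/andP => /andP[_ /eqP t2] _; rewrite /v; case: pickP => // E.
  by move: t2; rewrite (eq_card0 E).
have vi t : int_2face F t -> interior_ray F (v t).
  move=> it; case/andP: (it) => /andP[/exists_inP[s sF ts] _] _.
  by apply: (cone_interior nobd sF); apply: (subsetP ts); exact: vt.
have jJ t : int_2face F t -> in_J V F t (jt t).
  move=> it; case/andP: (it) => /andP[_ t2] _; have /cards2P[a [b [ab tE]]] := t2.
  rewrite tE in it *; apply/in_J_edge => //.
  have [p' E] := pihomog_mul d (k [set a; b]) (lsq_homog V ab).
  by exists p'; rewrite /= mulrC E mulrC.
exists (\sum_(t | int_2face F t) at_int (v t) (jt t)); first split.
- move=> a na; rewrite sum_ffunE big1 // => t it; rewrite ffunE; case: eqP => // E.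
  by rewrite E vi in na.
- move=> a; rewrite sum_ffunE raddf_sum; apply: in_J_sum => t it /=.
  rewrite ffunE vi // andbT; case: eqP => [->|_]; last exact: in_J0.
  by apply: in_J_sub (jJ t it); rewrite sub1set vt.
apply: hit_total.
  move=> a na; rewrite !ffunE qs // sum_ffunE big1 ?subrr // => t it; rewrite ffunE; case: eqP => // E.
  by rewrite E vi in na.
have -> x y : ray_map (x - y) = ray_map x - ray_map y.
  by rewrite -scaleN1r addrC ray_map_linear scaleN1r addrC.
have -> : ray_map (\sum_(t | int_2face F t) at_int (v t) (jt t)) = \sum_(t | int_2face F t) jt t.
  rewrite /ray_map; under eq_bigr do rewrite sum_ffunE.
  rewrite exchange_big; apply: eq_bigr => t it; rewrite (bigD1 (v t)) ?vi //= ffunE eqxx vi //= big1 ?addr0 //.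
  by move=> a /andP[_ /negPf av]; rewrite ffunE av.
apply/eqP; rewrite subr_eq0; apply/eqP/val_inj; rewrite /= -(pihomog_dE (mf := mdeg) (homog_val (ray_map q))) kE.
by rewrite !raddf_sum; apply: eq_bigl => t; rewrite sub0set andbT.
Qed.

(** On an interior edge [facet_map] is the difference of the two facet values times a sign, and the
    sign does not affect divisibility. *)
Lemma spline_edge_iff f : (forall s, s \notin F -> f s = 0) ->
  (forall a b, okp (a, b) -> in_J V F [set a; b] (facet_map f (a, b))) <->
  (forall s1 s2, s1 \in F -> s2 \in F -> #|s1 :&: s2| = 2%N ->
     exists p : S, (f s1 : S) - f s2 = lform V (s1 :&: s2) ^+ 2 * p).
Proof.
move=> fs; split=> [H s1 s2 s1F s2F c2|H a b ok].
  have /cards2P[x [y [xy tE]]] := introT eqP c2.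
  have [a [b [ab tE']]] : exists a b, (a < b)%N /\ s1 :&: s2 = [set a; b].
    by have [l|l|/val_inj E] := ltngtP x y; [exists x, y|exists y, x; rewrite setUC|rewrite E eqxx in xy].
  have [s1a s2a] : a \in s1 /\ a \in s2 by apply/andP; have := set21 a b; rewrite -tE' inE.
  have [s1b s2b] : b \in s1 /\ b \in s2 by apply/andP; have := set22 a b; rewrite -tE' inE.
  have s12 : s1 != s2 by apply: contra_eq_neq c2 => <-; rewrite setIid (facet3 fanF).
  have ne : a != b by rewrite neq_ltn ab.
  have iab := two_facets_int s1F s2F s12 ne s1a s1b s2a s2b.
  have ok : okp (a, b) by rewrite /okp /= ab.
  have [p E] := (in_J_edge V _ iab).1 (H a b ok).
  have [_ [r1 [r2 [[r1F r1a r1b] [r2F r2a r2b] r12 only [o2 o1]]]]] := int_edge fanF iab.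
  rewrite ffunE ok (sum_int_edge f r1F r1a r1b r2F r2a r2b r12 only o2) in E.
  have E' : (f r1 : S) - f r2 = lform V [set a; b] ^+ 2 * (orient V a b r1 *: p).
    by rewrite -scalerAr -/(lsq V a b) -E linearZ /= scalerA -expr2 o1 scale1r.
  rewrite tE'; case: (only _ s1F s1a s1b) (only _ s2F s2a s2b) s12 => -> [] ->; rewrite ?eqxx // => _.
    by exists (orient V a b r1 *: p).
  by exists (- (orient V a b r1 *: p)); rewrite mulrN -E' opprB.
have iab : int_2face F [set a; b] by case/andP: ok.
have [ab [r1 [r2 [[r1F r1a r1b] [r2F r2a r2b] r12 only [o2 o1]]]]] := int_edge fanF iab.
have IE : r1 :&: r2 = [set a; b].
  have [c [ac bc E1 _]] := facet_split fanF r1F r1a r1b ab.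
  have [e [ae be E2 _]] := facet_split fanF r2F r2a r2b ab.
  have ce : c != e by apply: contraNneq r12 => ce; rewrite E1 E2 ce.
  apply/setP => x; rewrite E1 E2 !inE; case: (x == a) => //; case: (x == b) => //=.
  by apply/negP => /andP[/eqP xc /eqP xe]; rewrite -xc -xe eqxx in ce.
have [|p E] := H r1 r2 r1F r2F; first by rewrite IE cards2 ab.
apply/(in_J_edge V _ iab); exists (orient V a b r1 *: p).
rewrite ffunE ok (sum_int_edge f r1F r1a r1b r2F r2a r2b r12 only o2).
have {}E : ((f r1 - f r2 : W) : S) = lsq V a b * p by rewrite /lsq -IE -E.
transitivity (orient V a b r1 *: ((f r1 - f r2 : W) : S)); first exact: linearZ.
by rewrite E scalerAr.
Qed.

Lemma sum_okp (g : {set 'I_n} -> int) :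
  \sum_(t | int_2face F t) g t = \sum_(x | okp x) g [set x.1; x.2].
Proof.
rewrite [RHS](partition_big (fun x : 'I_n * 'I_n => [set x.1; x.2]) (int_2face F)) /=; last by move=> x /andP[].
apply: eq_bigr => t it; case/andP: (it) => /andP[_ t2] _; have /cards2P[x [y [xy tE]]] := t2.
have [a [b [ab tE']]] : exists a b, (a < b)%N /\ t = [set a; b].
  by have [l|l|/val_inj E] := ltngtP x y; [exists x, y|exists y, x; rewrite setUC|rewrite E eqxx in xy].
rewrite (big_pred1 (a, b)) /= ?tE' // => -[u v]; rewrite /okp /= xpair_eqE.
apply/andP/andP => [[/andP[uv _] /eqP/setP E]|[/eqP -> /eqP ->]]; last by rewrite ab -tE' it eqxx.
have := E v; have := E u; rewrite !inE !eqxx ?orbT => /esym/orP[] /eqP eu /esym/orP[] /eqP ev.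
- by rewrite eu ev ltnn in uv.
- by rewrite eu ev !eqxx.
- by rewrite eu ev ltnNge ltnW in uv.
- by rewrite eu ev ltnn in uv.
Qed.

End Exactness.

Section EulerCount.
Variables (R : realType) (n : nat) (V : 'M[R]_(n, 3)) (F : {set {set 'I_n}}) (d : nat).
Hypotheses (good : good_fan F V) (fanF : is_simplicial_fan3 V F) (herF : hereditary F).
Hypotheses (scF : simply_connected (link_set V F)) (F0 : F != set0).
Local Notation S := {mpoly R[3]}.
Local Notation W := (dhomog 3 R d).

Lemma ideal_spaces : exists J : {set 'I_n} -> {vspace W},
  (forall g (x : W), x \in J g <-> in_J V F g x) /\
  (forall g, (HF_quot V F g d)%:Z = (\dim {:W})%:Z - (\dim (J g))%:Z).
Proof.
have ex g : exists U : {vspace W}, forall x, x \in U <-> in_J V F g x.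
  apply: vspace_of_pred => [x y c hx hy|]; last exact: in_J0.
  by have := in_J_lin c hx hy.
pose J g := epsilon (inhabits (0%VS : {vspace W})) (fun U => forall x, x \in U <-> in_J V F g x).
have JP g : forall x, x \in J g <-> in_J V F g x by exact: (epsilon_spec _ _ (ex g)).
exists J; split=> // g.
have -> : HF_quot V F g d = (\dim {:W} - \dim (J g))%N.
  apply: (qdim_vspace (phi := @mpoly_of_dhomog 3 R d)) => [||p|p].
  - exact: val_inj.
  - exact: subvf.
  - split=> [hp|[u _ ->]]; last exact: homog_val.
    by exists (DHomog hp); rewrite ?memvf.
  - split=> [[hp Jp]|[u /JP uJ ->]]; last by split=> //; exact: homog_val.
    by exists (DHomog hp) => //; apply/JP.
by rewrite subzn // dimvS ?subvf.
Qed.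

Lemma interior_cond (g : {set 'I_n}) : #|g| = 2%N ->
  (is_cone F g && ~~ in_boundary F g) = int_2face F g.
Proof.
move=> g2; rewrite /int_2face g2 eqxx andbT; congr (_ && ~~ _).
apply/existsP/idP => [[t /andP[bd gt]]|bd]; last by exists g; rewrite bd subxx.
by rewrite (sub_card_eq gt) // g2 (bd_card bd).
Qed.

(** The [U] spaces hold all data on facets, edges and rays, the [K] spaces the ideal parts.
    Exactness is written as equalities between an image plus [K] and the preimage of the next [K],
    so the identities [dim_preim] telescope. *)
Lemma euler_count : (sp_dim (spline_d V F d))%:Z = chi_RJ V F d.
Proof.
have [J [JP HF]] := ideal_spaces.
pose dW := \dim {:W}.
have [UA [UAm UAd]] := prod_space (fun s : {set 'I_n} => if s \in F then fullv else 0%VS : {vspace W}).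
have [UB [UBm UBd]] := prod_space (fun x : 'I_n * 'I_n => if okp F x then fullv else 0%VS : {vspace W}).
have [KB [KBm KBd]] := prod_space (fun x : 'I_n * 'I_n => if okp F x then J [set x.1; x.2] else 0%VS : {vspace W}).
have [UC [UCm UCd]] := prod_space (fun a : 'I_n => if interior_ray F a then fullv else 0%VS : {vspace W}).
have [KC [KCm KCd]] := prod_space (fun a : 'I_n => if interior_ray F a then J [set a] else 0%VS : {vspace W}).
have supp (I : finType) (P : pred I) (U : {vspace {ffun I -> W}}) :
    (forall f, f \in U <-> forall i, f i \in (if P i then fullv else 0%VS : {vspace W})) ->
    forall f, f \in U <-> forall i, ~~ P i -> f i = 0.
  move=> Um f; rewrite Um; split=> H i; have := H i; case: (P i) => //=.
  - by rewrite memv0 => /eqP.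
  - by rewrite memvf.
  - by move=> /(_ isT) ->; exact: mem0v.
have UAs := supp _ _ _ UAm; have UBs := supp _ _ _ UBm; have UCs := supp _ _ _ UCm.
have KBs f : f \in KB <-> (forall x, ~~ okp F x -> f x = 0) /\ forall a b, okp F (a, b) -> in_J V F [set a; b] (f (a, b)).
  rewrite KBm; split=> [H|[H1 H2] [a b]].
    split=> [x /negPf nx|a b ok]; first by have := H x; rewrite nx memv0 => /eqP.
    by apply/JP; have := H (a, b); rewrite ok.
  by case: (boolP (okp F (a, b))) => [ok|/H1 ->]; [apply/JP; exact: H2|exact: mem0v].
have KCs q : q \in KC <-> (forall a, ~~ interior_ray F a -> q a = 0) /\ forall a, interior_ray F a -> in_J V F [set a] (q a).
  rewrite KCm; split=> [H|[H1 H2] a].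
    split=> [a /negPf na|a ia]; first by have := H a; rewrite na memv0 => /eqP.
    by apply/JP; have := H a; rewrite ia.
  by case: (boolP (interior_ray F a)) => [ia|/H1 ->]; [apply/JP; exact: H2|exact: mem0v].
have [D DE] := mkhom (@facet_map_linear R n V F d).
have [E EE] := mkhom (@edge_map_linear R n F d).
have [Y YE] := mkhom (@ray_map_linear R n F d).
have spl : sp_dim (spline_d V F d) = \dim (UA :&: D @^-1: KB).
  have lphi : linear (fun f : {ffun {set 'I_n} -> W} => [ffun s => (f s : S)]).
    by move=> c f f'; apply/ffunP => s; rewrite !ffunE.
  pose phi : {linear {ffun {set 'I_n} -> W} -> {ffun {set 'I_n} -> S}} :=
    HB.pack (fun f : {ffun {set 'I_n} -> W} => [ffun s => (f s : S)])
      (GRing.isLinear.Build R {ffun {set 'I_n} -> W} {ffun {set 'I_n} -> S} _ _ lphi).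
  transitivity (\dim (UA :&: D @^-1: KB) - \dim (0%VS : {vspace {ffun {set 'I_n} -> W}}))%N; last by rewrite dimv0 subn0.
  apply: (qdim_vspace (phi := phi)) => [f f'||x|x].
  - by move=> /ffunP e; apply/ffunP => s; apply: val_inj; have := e s; rewrite !ffunE.
  - exact: sub0v.
  - split=> [[xs [xh xe]]|[f]].
      have hx s : x s \is d.-homog.
        by have [sF|/xs ->] := boolP (s \in F); [exact: xh|exact: rpred0].
      pose f : {ffun {set 'I_n} -> W} := [ffun s => DHomog (hx s)].
      have fs s : s \notin F -> f s = 0 by move=> ns; apply: val_inj; rewrite ffunE /= xs.
      exists f; last by apply/ffunP => s; rewrite !ffunE.
      rewrite memv_cap -memv_preim DE; apply/andP; split; first exact/UAs.
      apply/KBs; split; first by move=> y /negPf ny; rewrite ffunE ny.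
      apply/(spline_edge_iff fanF fs) => s1 s2 s1F s2F c2; rewrite !ffunE; exact: xe.
    rewrite memv_cap -memv_preim DE => /andP[/UAs fs /KBs[_ fK]] ->.
    split; first by move=> s /fs E0; rewrite ffunE E0.
    split; first by move=> s _; rewrite ffunE; exact: homog_val.
    by move=> s1 s2 s1F s2F c2; rewrite !ffunE; apply: (proj1 (spline_edge_iff fanF fs)).
  - split=> [->|[u]]; first by exists 0; rewrite ?mem0v // linear0.
    by rewrite memv0 => /eqP -> ->; rewrite linear0.
have X1 : (D @: UA + KB = UB :&: E @^-1: KC)%VS.
  apply/eqP; rewrite eqEsubv; apply/andP; split.
    rewrite subv_add; apply/andP; split; apply/subvP => h.
      move=> /memv_imgP[f _ ->]; rewrite memv_cap -memv_preim EE DE edge_facet_map // mem0v andbT.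
      by apply/UBs => x /negPf nx; rewrite ffunE nx.
    move=> /KBs[h0 hJ]; rewrite memv_cap -memv_preim EE; apply/andP; split; first exact/UBs.
    apply/KCs; split=> a; first by move=> /negPf na; rewrite ffunE na.
    move=> ia; rewrite ffunE ia raddf_sum; apply: in_J_sum => b iab /=; rewrite /ext.
    have [ab|ba] := ltnP a b.
      by apply: in_J_sub (hJ a b _); rewrite ?sub1set ?inE ?eqxx // /okp /= ab.
    have ba' : (b < a)%N by rewrite ltn_neqAle ba eq_sym (int_edge_neq iab : a != b :> nat).
    rewrite raddfN -[- _]addr0 -scaleN1r; apply: in_J_lin; last exact: in_J0.
    by apply: in_J_sub (hJ b a _); rewrite ?sub1set ?inE ?eqxx ?orbT // /okp /= ba' setUC.
  apply/subvP => h; rewrite memv_cap -memv_preim EE => /andP[/UBs h0 /KCs[_ hJ]].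
  have [f [fs [j [-> j0 jJ]]]] := exact_edges good fanF herF scF F0 h0 hJ.
  apply: memv_add; last by apply/KBs.
  by rewrite -DE; apply: memv_img; apply/UAs.
have hitE q : hit F q -> q \in (E @: UB)%VS.
  by move=> [h h0 <-]; rewrite -EE; apply: memv_img; apply/UBs.
have EUC h : E h \in UC by rewrite EE; apply/UCs => a /negPf na; rewrite ffunE na.
have KCUC : (KC <= UC)%VS by apply/subvP => q /KCs[q0 _]; apply/UCs.
have e1 := dim_preim D UA KB; have e2 := dim_preim E UB KC.
rewrite -spl in e1; rewrite X1 in e1.
pose c0 : int := \sum_(g | is_cone F g && (#|g| == 3%N) && ~~ in_boundary F g) (HF_quot V F g d)%:Z.
pose c1 : int := \sum_(g | is_cone F g && (#|g| == 2%N) && ~~ in_boundary F g) (HF_quot V F g d)%:Z.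
pose c2 : int := \sum_(g | is_cone F g && (#|g| == 1%N) && ~~ in_boundary F g) (HF_quot V F g d)%:Z.
pose c3 : int := \sum_(g | is_cone F g && (#|g| == 0%N) && ~~ in_boundary F g) (HF_quot V F g d)%:Z.
have chiE : chi_RJ V F d = c0 - c1 + c2 - c3.
  by rewrite /chi_RJ !big_ord_recl big_ord0 /= /bump /= !expr0 !expr1 /c0 /c1 /c2 /c3; ring.
have PoszS (I : finType) (f : I -> nat) : ((\sum_i f i)%N)%:Z = \sum_i (f i)%:Z.
  by rewrite (big_morph Posz PoszD (erefl 0%:Z)).
have c0E : c0 = (\dim UA)%:Z.
  rewrite UAd PoszS /c0 big_mkcond; apply: eq_bigr => g _.
  have -> : is_cone F g && (#|g| == 3%N) && ~~ in_boundary F g = (g \in F).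
    apply/idP/idP => [/andP[/andP[/exists_inP[s sF gs] /eqP g3] _]|gF].
      by rewrite (sub_card_eq gs) // g3 (facet3 fanF).
    rewrite facet_cone // (facet3 fanF) //=; apply/existsP => -[t /andP[bd /subset_leq_card]].
    by rewrite (facet3 fanF) // (bd_card bd).
  case: ifP => gF; last by rewrite dimv0.
  rewrite HF (_ : J g = 0%VS) ?dimv0 ?subr0 //; apply/eqP; rewrite -subv0; apply/subvP => x /JP[h xE].
  rewrite memv0; apply/eqP/val_inj; rewrite /= xE big_pred0 // => t; apply/negP => /andP[it /subset_leq_card].
  by rewrite (facet3 fanF) //; case/andP: it => /andP[_ /eqP ->].
have c1E : c1 = (\dim UB)%:Z - (\dim KB)%:Z.
  rewrite UBd KBd !PoszS -sumrB.
  transitivity (\sum_(t | int_2face F t) ((HF_quot V F t d)%:Z)).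
    apply: eq_bigl => g; rewrite andbAC; have [g2|g2] := eqVneq #|g| 2%N; first by rewrite andbT interior_cond.
    by rewrite andbF /int_2face (negPf g2) andbF.
  rewrite sum_okp big_mkcond; apply: eq_bigr => x _; case: ifP => _; last by rewrite dimv0 subrr.
  exact: HF.
have c2E : c2 = (\dim UC)%:Z - (\dim KC)%:Z.
  rewrite UCd KCd !PoszS -sumrB.
  transitivity (\sum_(a | interior_ray F a) ((HF_quot V F [set a] d)%:Z)).
    rewrite (partition_big (fun a : 'I_n => [set a]) (fun g => is_cone F g && (#|g| == 1%N) && ~~ in_boundary F g)) /=; last first.
      by move=> a /andP[-> ->]; rewrite cards1.
    apply: eq_bigr => g /andP[/andP[cg /cards1P[a gE]] nb]; rewrite (big_pred1 a) gE // => b.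
    apply/andP/eqP => [[_ /eqP E']|->]; first exact: set1_inj E'.
    by rewrite /interior_ray -gE cg nb.
  rewrite big_mkcond; apply: eq_bigr => a _; case: ifP => _; last by rewrite dimv0 subrr.
  exact: HF.
(* With a boundary edge the origin lies in the boundary, the last term of the complex is absent and
   the edges already reach all ray data. *)
have [/existsP[t bd]|/existsPn nobd] := boolP [exists t, bd_2face F t].
  have c3E : c3 = 0.
    rewrite /c3 big_pred0 // => g; apply/negP => /andP[/andP[_ /eqP/cards0_eq ->] /existsPn/(_ t)].
    by rewrite bd sub0set.
  have X2 : (E @: UB + KC = UC)%VS.
    apply/eqP; rewrite eqEsubv subv_add KCUC andbT; apply/andP; split.
      by apply/subvP => q /memv_imgP[h _ ->].
    apply/subvP => q /UCs q0; apply: (subvP (addvSl _ _)); apply: hitE.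
    exact: (exact_rays_disc herF bd q0).
  rewrite X2 in e2; rewrite chiE c0E c1E c2E c3E.
  have ar (x a b b' c c' m : nat) : (x + m = a + b')%N -> (m + c = b + c')%N ->
      x%:Z = a%:Z - (b%:Z - b'%:Z) + (c%:Z - c'%:Z) - 0 by lia.
  exact: ar e1 e2.
have c3E : c3 = dW%:Z - (\dim (J set0))%:Z.
  rewrite /c3 (big_pred1 set0) ?HF // => g; apply/idP/eqP => [/andP[/andP[_ /eqP/cards0_eq]]//|->].
  rewrite cards0 eqxx andbT; apply/andP; split.
    by case/set0Pn: F0 => s sF; apply/exists_inP; exists s; rewrite ?sub0set.
  by apply/existsP => -[t]; rewrite (negPf (nobd t)).
have X2 : (E @: UB + KC = UC :&: Y @^-1: J set0)%VS.
  apply/eqP; rewrite eqEsubv; apply/andP; split.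
    rewrite subv_add; apply/andP; split; apply/subvP => q.
      move=> /memv_imgP[h _ ->]; rewrite memv_cap EUC -memv_preim YE EE /=.
      by rewrite edge_map_total // mem0v.
    move=> qK; rewrite memv_cap (subvP KCUC) //= -memv_preim YE; apply/JP.
    case/KCs: qK => _ qJ; rewrite /ray_map raddf_sum; apply: in_J_sum => a ia.
    by apply: in_J_sub (qJ a ia); exact: sub0set.
  apply/subvP => q; rewrite memv_cap -memv_preim YE => /andP[/UCs q0 /JP qJ].
  have [j [j0 jJ] hj] := exact_rays_complete fanF herF F0 nobd q0 qJ.
  rewrite -(subrK j q); apply: memv_add; first exact: hitE.
  by apply/KCs; split.
have X3 : (Y @: UC + J set0 = fullv)%VS.
  apply/eqP; rewrite eqEsubv subvf; apply/subvP => w _; apply: (subvP (addvSl _ _)).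
  have [a ia] : exists a, interior_ray F a.
    case/set0Pn: F0 => s sF; have [a [b [c [_ _ _ sE _]]]] := facetP fanF sF.
    by exists a; apply: (cone_interior nobd sF); rewrite sE !inE eqxx.
  have -> : w = Y (at_int F a w).
    rewrite YE /ray_map (bigD1 a) //= ffunE eqxx ia big1 ?addr0 // => b /andP[_ /negPf ba].
    by rewrite ffunE ba.
  by apply: memv_img; apply/UCs => b nb; rewrite ffunE; case: eqP => // E'; rewrite E' ia in nb.
have e3 := dim_preim Y UC (J set0); rewrite X3 in e3; rewrite -X2 -/dW in e3.
rewrite chiE c0E c1E c2E c3E.
have ar (x a b b' c c' e e' m l : nat) : (x + m = a + b')%N -> (m + l = b + c')%N -> (l + e = c + e')%N ->
    x%:Z = a%:Z - (b%:Z - b'%:Z) + (c%:Z - c'%:Z) - (e%:Z - e'%:Z) by lia.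
exact: ar e1 e2 e3.
Qed.

End EulerCount.

Theorem theorem9p9 (R : realType) (n : nat) (F : {set {set 'I_n}}) :
  hereditary F ->
  exists p : {mpoly R[n * 3]}, p != 0 /\
    forall V : 'M[R]_(n, 3),
      eval_coords p V != 0 ->
      is_simplicial_fan3 V F ->
      simply_connected (link_set V F) ->
      forall d : nat, (sp_dim (spline_d V F d))%:Z = chi_RJ V F d.
Proof.
move=> herF.
have [fanF|nofan] := Classical_Prop.classic (F != set0 /\ exists V : 'M[R]_(n, 3), is_simplicial_fan3 V F).
  have [F0 ex] := fanF; have [p p0 Hp] := good_fan_generic herF F0 ex.
  by exists p; split=> // V pV fV scV d; apply: euler_count => //; exact: Hp.
(* If [F] is empty or not realizable, any nonzero polynomial will do: a simply connected link is
   nonempty, so its facet together with the fan [V] gives a contradiction. *)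
exists 1; split; first exact: oner_neq0.
move=> V _ fV [[x [_ [s sF _]]] _]; exfalso; apply: nofan; split; last by exists V.
by apply/set0Pn; exists s.
Qed.
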